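(* Let $C=11\cdot 195^2$. Let $n\ge 2$ and let $\mathbf G=(G_1,G_2,G_3)$ be a graph triple of order $n$ with $\Delta(G_1),\Delta(G_2)\le n-2$ and $\Delta(G_3)\le n-1$. If $|E_1|+|E_2|+|E_3|+\max\{\Delta(G_1),\Delta(G_2)\}+\Delta(G_3)\le 3n-C$, then $\mathbf G$ packs.
   Context: A graph triple $\mathbf G=(G_1,G_2,G_3)$ of order $n$ consists of two disjoint $n$-vertex graphs $G_1=(V_1,E_1)$, $G_2=(V_2,E_2)$ and a bipartite graph $G_3=(V_1\cup V_2,E_3)$ with parts $V_1,V_2$. $\mathbf G$ packs if there is a bijection $f:V_1\to V_2$ such that $vf(v)\notin E_3$ for every $v\in V_1$, and $uv\in E_1$ implies $f(u)f(v)\notin E_2$. $\Delta(G)$ is the maximum degree of $G$. *)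

(* Defs.v *)
From mathcomp Require Import all_boot.
Set Implicit Arguments. Unset Strict Implicit. Unset Printing Implicit Defensive.

Definition simple_graph (T : finType) (e : rel T) : Prop :=
  symmetric e /\ irreflexive e.

Definition nedges (n : nat) (e : rel 'I_n) : nat :=
  #|[set p : 'I_n * 'I_n | (p.1 < p.2) && e p.1 p.2]|.

Definition deg (T : finType) (e : rel T) (v : T) : nat := #|[set u | e v u]|.

Definition maxdeg (T : finType) (e : rel T) : nat := \max_(v : T) deg e v.

(* Bipartite graph G3 between V1 = 'I_n (first copy) and V2 = 'I_n (second copy):
   e3 v w means the edge between v in V1 and w in V2. *)
Definition nedges_bip (n : nat) (e3 : 'I_n -> 'I_n -> bool) : nat :=
  #|[set p : 'I_n * 'I_n | e3 p.1 p.2]|.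

Definition maxdeg_bip (n : nat) (e3 : 'I_n -> 'I_n -> bool) : nat :=
  maxn (\max_(v : 'I_n) #|[set w | e3 v w]|) (\max_(w : 'I_n) #|[set v | e3 v w]|).

Definition packs (n : nat) (e1 e2 : rel 'I_n) (e3 : 'I_n -> 'I_n -> bool) : Prop :=
  exists f : 'I_n -> 'I_n, bijective f /\
    (forall v, ~~ e3 v (f v)) /\
    (forall u v, e1 u v -> ~~ e2 (f u) (f v)).

(* Main.v *)
Require Import Defs.
From mathcomp Require Import all_boot all_fingroup all_order all_algebra.
From mathcomp Require Import zify.
(** The proof is an induction on the order, over arbitrary finite vertex types. Placing some
vertices p of V1 on vertices f(p) of V2 leaves a smaller triple whose third graph gains the
pairs N1(p) x N2(f(p)); the induction hypothesis applies as soon as k placements lower the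
left-hand side by 3k.

If all total degrees (degree in the own graph plus degree in G3) are at most n/250, a second
moment computation yields a bijection with few conflicts and balanced loads, and the
conflicts are then removed one by one by transpositions. Otherwise let v, say in V1, have the largest
total degree D. Sending v to a vertex w of low degree gains about D; the price is that the
neighbours of w must receive hosts, i.e. vertices of V1 of degree at most 3 away from v, which
exist in abundance because of the edge budget. If this is impossible because the neighbours
of w are too big, then V2 also has vertices of large total degree, many vertices are
leaves or near-leaves of large vertices, and one can choose leaves x, x' of large z, z' in
V1 and near-leaves w, w' of large y, y' in V2 and place x, x', z, z' on y, y', w', w. *)

Set Implicit Arguments. Unset Strict Implicit. Unset Printing Implicit Defensive.

(** * Triples and residual triples *)

Section Neighbourhoods.

(** Only an additive constant C is lost against 3n, so every error term must be bounded absolutely.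
    This is what the cutoff n/250 provides: beyond it at most 120 * 250 vertices of V2 have total
    degree above D/20, and the same count against a maximum up to six times smaller gives 120 *
    1500. C outweighs these numbers. It also gives n >= C/3 and keeps the degrees of a minimal
    counterexample away from n: by 200000 in G1 and G2, since 418000 = 2 * 200000 + 18000 leaves a
    surplus for a first moment argument, and by about C/3 in G3. This distance matters because a
    placement may enlarge rows and columns of the third graph, whose degrees must stay below the
    order of the residual triple. The recurring lower bound comes from discharging: n vertices, none
    isolated, whose leaves all hang on vertices of degree at least h have degree sum at least
    2nh/(h+1). So either some leaf hangs on a small vertex, which makes a cheap placement, or G2
    alone consumes nearly 2n of the doubled budget 6n. *)

Definition nbr (A B : finType) (r : A -> B -> bool) (x : A) : {set B} := [set y | r x y].

Definition flip (A B : Type) (r : A -> B -> bool) (y : B) (x : A) : bool := r x y.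

Definition mass (A B : finType) (r : A -> B -> bool) : nat := \sum_x #|nbr r x|.

Lemma in_nbr (A B : finType) (r : A -> B -> bool) x y : (y \in nbr r x) = r x y.
Proof. by rewrite inE. Qed.

Lemma exchange_card (A B : finType) (r : A -> B -> bool) (P : {set A}) (Q : {set B}) :
  \sum_(x in P) #|nbr r x :&: Q| = \sum_(y in Q) #|nbr (flip r) y :&: P|.
Proof.
transitivity (\sum_(x in P) \sum_(y in Q | r x y) 1).
  apply: eq_bigr => x _; rewrite sum1dep_card; apply: eq_card => y.
  by rewrite !inE andbC.
transitivity (\sum_(y in Q) \sum_(x in P | r x y) 1).
  rewrite (exchange_big_dep (mem Q)) /=; last by move=> x y _ /andP[].
  by apply: eq_bigr => y yQ; apply: eq_bigl => x; rewrite yQ.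
apply: eq_bigr => y _; rewrite sum1dep_card; apply: eq_card => x.
by rewrite !inE andbC.
Qed.

Lemma mass_flip (A B : finType) (r : A -> B -> bool) : mass (flip r) = mass r.
Proof.
rewrite /mass.
have := exchange_card r [set: A] [set: B].
by under eq_bigr do rewrite setIT; under [in RHS]eq_bigr do rewrite setIT;
  rewrite !(eq_bigl _ _ (fun x => in_setT x)) => ->.
Qed.

Lemma flip_sym (T : finType) (e : rel T) : symmetric e -> flip e =2 e.
Proof. by move=> se x y; rewrite /flip se. Qed.

Lemma nbr_flip_sym (T : finType) (e : rel T) x : symmetric e -> nbr (flip e) x = nbr e x.
Proof. by move=> se; apply/setP => y; rewrite !inE flip_sym. Qed.

Lemma sum_setC (A : finType) (X : {set A}) (F : A -> nat) :
  \sum_(x in ~: X) F x + \sum_(x in X) F x = \sum_x F x.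
Proof.
rewrite addnC [RHS](bigID (mem X)) /=; congr (_ + _).
by apply: eq_bigl => x; rewrite inE.
Qed.

(** An edge between X and its complement has both its units charged to its end in X, hence two
    summands for each p. With X the set of placed vertices, the second sum is the mass lost by the
    removal. *)
Lemma mass_outside (T : finType) (e : rel T) (X : {set T}) : symmetric e ->
  \sum_(x in ~: X) #|nbr e x :\: X| + \sum_(p in X) (#|nbr e p| + #|nbr e p :\: X|) = mass e.
Proof.
move=> se; rewrite /mass -(sum_setC X) big_split /=.
have H x : #|nbr e x| = #|nbr e x :\: X| + #|nbr e x :&: X| by rewrite addnC cardsID.
rewrite [X in _ = X + _](eq_bigr _ (fun x _ => H x)) big_split /=.
rewrite exchange_card.
have -> : \sum_(y in X) #|nbr (flip e) y :&: ~: X| = \sum_(p in X) #|nbr e p :\: X|.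
  by apply: eq_bigr => p _; rewrite nbr_flip_sym // setDE.
lia.
Qed.

Lemma bip_mass_outside (A B : finType) (r : A -> B -> bool) (X : {set A}) (Y : {set B}) :
  \sum_(x in ~: X) #|nbr r x :\: Y| + \sum_(p in X) #|nbr r p|
    + \sum_(q in Y) #|nbr (flip r) q :\: X| = mass r.
Proof.
rewrite /mass -(sum_setC X).
have H x : #|nbr r x| = #|nbr r x :\: Y| + #|nbr r x :&: Y| by rewrite addnC cardsID.
rewrite [X in _ = X + _](eq_bigr _ (fun x _ => H x)) big_split /= exchange_card.
have -> : \sum_(y in Y) #|nbr (flip r) y :&: ~: X| = \sum_(q in Y) #|nbr (flip r) q :\: X|.
  by apply: eq_bigr => p _; rewrite setDE.
lia.
Qed.

End Neighbourhoods.

(** Arbitrary types, because the vertex sets of residual triples are subtypes. Between types of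
    equal cardinality an injection is a bijection. *)
Definition packable (T1 T2 : finType) (e1 : rel T1) (e2 : rel T2) (e3 : T1 -> T2 -> bool) : Prop :=
  exists f : T1 -> T2, injective f /\
    (forall v, ~~ e3 v (f v)) /\ (forall u v, e1 u v -> ~~ e2 (f u) (f v)).

Lemma packable_flip (T1 T2 : finType) (e1 : rel T1) (e2 : rel T2) (e3 : T1 -> T2 -> bool) :
  #|T1| = #|T2| -> packable e2 e1 (flip e3) -> packable e1 e2 e3.
Proof.
move=> eqT [f [finj [f3 f12]]].
have [g fK gK] : bijective f by apply: inj_card_bij => //; rewrite eqT.
exists g; split; first exact: can_inj gK.
split=> [v|u v e1uv]; first by have := f3 (g v); rewrite /flip gK.
apply/negP => /f12; by rewrite !gK e1uv.
Qed.

Section Removal.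

Variables (T1 T2 : finType) (e1 : rel T1) (e2 : rel T2) (e3 : T1 -> T2 -> bool).
Variable ps : seq (T1 * T2).

Definition Xof : {set T1} := [set x in unzip1 ps].
Definition Yof : {set T2} := [set y in unzip2 ps].

Definition res1 : finType := {x | x \in ~: Xof}.
Definition res2 : finType := {y | y \in ~: Yof}.
Definition re1 : rel res1 := fun x y => e1 (val x) (val y).
Definition re2 : rel res2 := fun x y => e2 (val x) (val y).
(* Once p.1 sits on p.2, no remaining neighbour of p.1 may go to a neighbour of p.2. *)
Definition re3 (x : res1) (y : res2) : bool :=
  e3 (val x) (val y) || has (fun p => e1 p.1 (val x) && e2 p.2 (val y)) ps.

Definition partial_packing : Prop :=
  [/\ uniq (unzip1 ps), uniq (unzip2 ps), (forall p, p \in ps -> ~~ e3 p.1 p.2) &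
      (forall p q, p \in ps -> q \in ps -> e1 p.1 q.1 -> ~~ e2 p.2 q.2)].

Lemma packable_residual : symmetric e1 -> symmetric e2 -> partial_packing ->
  packable re1 re2 re3 -> packable e1 e2 e3.
Proof.
move=> s1 s2 [u1 u2 v3 v12] [g [ginj [g3 g12]]].
(* The extension is built as a relation, the union of the graph of [g] and of [ps]; each property
   below is then a case analysis on where the pairs come from. *)
pose R x y := (exists u : res1, x = val u /\ y = val (g u)) \/ (x, y) \in ps.
have exR x : exists y, R x y.
  case: (boolP (x \in Xof)) => [|nx].
    by rewrite inE => /mapP[[a b] /= pin ->]; exists b; right.
  have xr : x \in ~: Xof by rewrite inE.
  by exists (val (g (Sub x xr))); left; exists (Sub x xr).
have [f fR] := @fin_all_exists _ _ R exR.
have inX x y : (x, y) \in ps -> x \in Xof by move=> h; rewrite inE; apply/mapP; exists (x, y).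
have inY x y : (x, y) \in ps -> y \in Yof by move=> h; rewrite inE; apply/mapP; exists (x, y).
have notX (u : res1) : val u \notin Xof by have := valP u; rewrite inE.
have notY (u : res2) : val u \notin Yof by have := valP u; rewrite inE.
have uniq_snd p q : p \in ps -> q \in ps -> p.2 = q.2 -> p = q.
  move=> pi qi eqpq; have hs : size (unzip2 ps) = size ps by rewrite size_map.
  have ip : index p ps < size ps by rewrite index_mem.
  have iq : index q ps < size ps by rewrite index_mem.
  have eqi : index p ps == index q ps.
    rewrite -(nth_uniq p.2 _ _ u2) ?hs //.
    by rewrite !(nth_map p) // !nth_index // eqpq.
  by rewrite -(nth_index p pi) (eqP eqi) nth_index.
exists f; split.
  move=> x y; case: (fR x) => [[u [-> ->]]|xp]; case: (fR y) => [[w [-> ->]]|yp] eqf.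
  - by move: eqf => /val_inj/ginj ->.
  - by have := inY _ _ yp; rewrite -eqf (negPf (notY _)).
  - by have := inY _ _ xp; rewrite eqf (negPf (notY _)).
  - by have [] := uniq_snd _ _ xp yp eqf.
split=> [x|x y].
  case: (fR x) => [[u [-> ->]]|xp]; last exact: v3 xp.
  by have := g3 u; rewrite /re3 negb_or => /andP[].
case: (fR x) => [[u [-> ->]]|xp]; case: (fR y) => [[w [-> ->]]|yp] exy.
- exact: g12 exy.
- have := g3 u; rewrite /re3 negb_or => /andP[_ /hasPn/(_ _ yp)] /=.
  by rewrite s1 exy /= s2.
- by have := g3 w; rewrite /re3 negb_or => /andP[_ /hasPn/(_ _ xp)] /=; rewrite exy.
- exact: v12 xp yp exy.
Qed.

Lemma Xof_sum (F : T1 -> nat) : uniq (unzip1 ps) -> \sum_(x in Xof) F x = \sum_(p <- ps) F p.1.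
Proof.
move=> u1; rewrite -(big_map fst xpredT) /= big_uniq //=.
by apply: eq_bigl => x; rewrite inE.
Qed.

Lemma Yof_sum (F : T2 -> nat) : uniq (unzip2 ps) -> \sum_(x in Yof) F x = \sum_(p <- ps) F p.2.
Proof.
move=> u1; rewrite -(big_map snd xpredT) /= big_uniq //=.
by apply: eq_bigl => x; rewrite inE.
Qed.

Lemma card_res1 : uniq (unzip1 ps) -> #|res1| + size ps = #|T1|.
Proof.
move=> u1; rewrite card_sig -(cardsC Xof) addnC.
rewrite [#|Xof|](_ : _ = size ps); first by congr (_ + _); apply: eq_card => x; rewrite inE.
by rewrite cardsE (card_uniqP u1) size_map.
Qed.

Lemma card_res2 : uniq (unzip2 ps) -> #|res2| + size ps = #|T2|.
Proof.
move=> u1; rewrite card_sig -(cardsC Yof) addnC.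
rewrite [#|Yof|](_ : _ = size ps); first by congr (_ + _); apply: eq_card => x; rewrite inE.
by rewrite cardsE (card_uniqP u1) size_map.
Qed.

Lemma card_sub_nbr (A : finType) (S : {set A}) (P : pred A) :
  #|[set u : {x | x \in S} | P (val u)]| = #|[set x | P x] :&: S|.
Proof.
rewrite -(card_imset _ val_inj); apply: eq_card => x; rewrite !inE.
apply/imsetP/andP => [[u]|[Px xS]]; first by rewrite inE => Pu ->; split=> //; exact: valP.
by exists (Sub x xS); rewrite ?inE.
Qed.

Definition outer1 (p : T1 * T2) := #|nbr e1 p.1 :\: Xof|.
Definition outer2 (p : T1 * T2) := #|nbr e2 p.2 :\: Yof|.

Lemma deg_re1 u : #|nbr re1 u| = #|nbr e1 (val u) :\: Xof|.
Proof. by rewrite /nbr card_sub_nbr setDE. Qed.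

Lemma deg_re2 u : #|nbr re2 u| = #|nbr e2 (val u) :\: Yof|.
Proof. by rewrite /nbr card_sub_nbr setDE. Qed.

Lemma deg_re3 (u : res1) : #|nbr re3 u| <=
  #|nbr e3 (val u) :\: Yof| + \sum_(p <- ps | e1 p.1 (val u)) outer2 p.
Proof.
have -> : #|nbr re3 u| = #|[set y | e3 (val u) y || has (fun p => e1 p.1 (val u) && e2 p.2 y) ps] :\: Yof|.
  rewrite setDE -card_sub_nbr; apply: eq_card => y; by rewrite !inE.
have sub : [set y | e3 (val u) y || has (fun p => e1 p.1 (val u) && e2 p.2 y) ps] :\: Yof
  \subset (nbr e3 (val u) :\: Yof) :|:
     \bigcup_(p <- ps | e1 p.1 (val u)) (nbr e2 p.2 :\: Yof).
  apply/subsetP => y; rewrite !inE => /andP[nY] /orP[->|/hasP[p pin /andP[e1p e2p]]].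
    by rewrite nY.
  apply/orP; right.
  rewrite (big_rem p) //= e1p inE; apply/orP; left; by rewrite !inE nY.
apply: leq_trans (subset_leq_card sub) _.
apply: leq_trans (leq_card_setU _ _) _; rewrite leq_add2l.
elim/big_rec2: _ => [|p k A _ IH]; first by rewrite cards0.
exact: leq_trans (leq_card_setU _ _) (leq_add (leqnn _) IH).
Qed.

Lemma mass_re1 : symmetric e1 -> uniq (unzip1 ps) ->
  mass re1 + \sum_(p <- ps) (#|nbr e1 p.1| + outer1 p) = mass e1.
Proof.
move=> s1 u1; rewrite -(mass_outside Xof s1).
rewrite -(Xof_sum (fun x => #|nbr e1 x| + #|nbr e1 x :\: Xof|)) //; congr (_ + _).
rewrite /mass (eq_bigr _ (fun u _ => deg_re1 u)).
by rewrite -(big_sub (mem (~: Xof)) (fun x => #|nbr e1 x :\: Xof|)).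
Qed.

Lemma mass_re2 : symmetric e2 -> uniq (unzip2 ps) ->
  mass re2 + \sum_(p <- ps) (#|nbr e2 p.2| + outer2 p) = mass e2.
Proof.
move=> s1 u1; rewrite -(mass_outside Yof s1).
rewrite -(Yof_sum (fun y => #|nbr e2 y| + #|nbr e2 y :\: Yof|)) //; congr (_ + _).
rewrite /mass (eq_bigr _ (fun u _ => deg_re2 u)).
by rewrite -(big_sub (mem (~: Yof)) (fun x => #|nbr e2 x :\: Yof|)).
Qed.

(** Rows of placed vertices are counted whole and columns only outside [Xof], so that a pair with
    both ends placed is subtracted once. Only unplaced neighbours can form new pairs, whence the
    product of the outer degrees. *)
Lemma mass_re3 : symmetric e1 -> uniq (unzip1 ps) -> uniq (unzip2 ps) ->
  mass re3 + \sum_(p <- ps) (#|nbr e3 p.1| + #|nbr (flip e3) p.2 :\: Xof|)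
   <= mass e3 + \sum_(p <- ps) outer1 p * outer2 p.
Proof.
move=> s1 u1 u2; rewrite -(bip_mass_outside e3 Xof Yof) big_split /=.
rewrite -(Xof_sum (fun x => #|nbr e3 x|)) // -(Yof_sum (fun y => #|nbr (flip e3) y :\: Xof|)) //.
suff : mass re3 <= \sum_(x in ~: Xof) #|nbr e3 x :\: Yof| + \sum_(p <- ps) outer1 p * outer2 p by lia.
have le_sum : mass re3 <= \sum_(u : res1) (#|nbr e3 (val u) :\: Yof| + \sum_(p <- ps | e1 p.1 (val u)) outer2 p).
  by rewrite /mass; apply: leq_sum => u _; exact: deg_re3.
apply: leq_trans le_sum _.
rewrite -(big_sub (mem (~: Xof)) (fun x => #|nbr e3 x :\: Yof| + \sum_(p <- ps | e1 p.1 x) outer2 p)).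
rewrite big_split /= leq_add2l.
rewrite (exchange_big_dep xpredT) //=; apply: leq_sum => p _.
rewrite sum_nat_const leq_mul2r; apply/orP; right.
apply: subset_leq_card; apply/subsetP => x; rewrite !inE unfold_in => /andP[hx ex]; rewrite ex andbT; by move: hx; rewrite /= !inE.
Qed.

End Removal.

Lemma flip_re3 (T1 T2 : finType) (e1 : rel T1) (e2 : rel T2) (e3 : T1 -> T2 -> bool) ps (y : res2 ps) :
  #|nbr (flip (@re3 T1 T2 e1 e2 e3 ps)) y| <=
  #|nbr (flip e3) (val y) :\: Xof ps| + \sum_(p <- ps | e2 p.2 (val y)) outer1 e1 ps p.
Proof.
have -> : #|nbr (flip (@re3 T1 T2 e1 e2 e3 ps)) y| = #|[set x | e3 x (val y) || has (fun p => e1 p.1 x && e2 p.2 (val y)) ps] :\: Xof ps|.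
  rewrite setDE -card_sub_nbr; apply: eq_card => x; by rewrite !inE.
have sub : [set x | e3 x (val y) || has (fun p => e1 p.1 x && e2 p.2 (val y)) ps] :\: Xof ps
  \subset (nbr (flip e3) (val y) :\: Xof ps) :|:
     \bigcup_(p <- ps | e2 p.2 (val y)) (nbr e1 p.1 :\: Xof ps).
  apply/subsetP => x; rewrite !inE => /andP[nY] /orP[e|/hasP[p pin /andP[e1p e2p]]].
    by rewrite nY /flip e.
  apply/orP; right.
  rewrite (big_rem p) //= e2p inE; apply/orP; left; by rewrite !inE nY.
apply: leq_trans (subset_leq_card sub) _.
apply: leq_trans (leq_card_setU _ _) _; rewrite leq_add2l.
elim/big_rec2: _ => [|p k A _ IH]; first by rewrite cards0.
exact: leq_trans (leq_card_setU _ _) (leq_add (leqnn _) IH).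
Qed.

(* All quantities are doubled: [mass] counts an edge of G1 or G2 twice and an edge of G3 once.
   [Dl] and [D3] only bound the maximum degrees, so that residual triples keep [Dl]. *)
Record budget (C n : nat) (T1 T2 : finType) (e1 : rel T1) (e2 : rel T2)
    (e3 : T1 -> T2 -> bool) (Dl D3 : nat) : Prop := Budget {
  bg_card1 : #|T1| = n;
  bg_card2 : #|T2| = n;
  bg_graph1 : simple_graph e1;
  bg_graph2 : simple_graph e2;
  bg_deg1 : forall x, #|nbr e1 x| <= Dl;
  bg_deg2 : forall y, #|nbr e2 y| <= Dl;
  bg_deg3l : forall x, #|nbr e3 x| <= D3;
  bg_deg3r : forall y, #|nbr (flip e3) y| <= D3;
  bg_Dl : Dl + 2 <= n;
  bg_D3 : D3 + 1 <= n;
  bg_sum : mass e1 + mass e2 + 2 * mass e3 + 2 * Dl + 2 * D3 + 2 * C <= 6 * n }.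

Lemma budget_flip C n (T1 T2 : finType) (e1 : rel T1) (e2 : rel T2) e3 Dl D3 :
  budget C n e1 e2 e3 Dl D3 -> budget C n e2 e1 (flip e3) Dl D3.
Proof.
case=> c1 c2 g1 g2 h1 h2 h3 h4 b1 b2 b3; split=> //.
by rewrite mass_flip; lia.
Qed.

Definition packs_below (C n : nat) : Prop :=
  forall n' (T1 T2 : finType) (e1 : rel T1) (e2 : rel T2) e3 Dl D3,
    n' < n -> budget C n' e1 e2 e3 Dl D3 -> packable e1 e2 e3.

Section Reduction.

Variables (C n : nat) (T1 T2 : finType) (e1 : rel T1) (e2 : rel T2) (e3 : T1 -> T2 -> bool).
Variables (Dl D3 : nat).
Hypothesis bg : budget C n e1 e2 e3 Dl D3.
Hypothesis IH : packs_below C n.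

(** The doubled budget must drop by 6 per placed pair. In the last hypothesis the left-hand side
    collects this drop and what may grow, the new pairs of G3 and its new degree bound [D3']; the
    right-hand side collects what disappears. [Dl] is kept, so it contributes no gain. *)
Lemma reduction (ps : seq (T1 * T2)) (D3' : nat) :
  0 < size ps -> partial_packing e1 e2 e3 ps ->
  Dl + 2 + size ps <= n -> D3' + 1 + size ps <= n ->
  (forall x, x \notin Xof ps ->
     #|nbr e3 x :\: Yof ps| + \sum_(p <- ps | e1 p.1 x) outer2 e2 ps p <= D3') ->
  (forall y, y \notin Yof ps ->
     #|nbr (flip e3) y :\: Xof ps| + \sum_(p <- ps | e2 p.2 y) outer1 e1 ps p <= D3') ->
  2 * \sum_(p <- ps) outer1 e1 ps p * outer2 e2 ps p + 2 * D3' + 6 * size ps <=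
    \sum_(p <- ps) (#|nbr e1 p.1| + outer1 e1 ps p) +
    \sum_(p <- ps) (#|nbr e2 p.2| + outer2 e2 ps p) +
    2 * \sum_(p <- ps) (#|nbr e3 p.1| + #|nbr (flip e3) p.2 :\: Xof ps|) + 2 * D3 ->
  packable e1 e2 e3.
Proof.
move=> ps0 pp hDl hD3 hx hy hsum.
case: (bg) => c1 c2 g1 g2 h1 h2 h3 h4 b1 b2 b3.
have [[s1 i1] [s2 i2]] := (g1, g2).
have [u1 u2 _ _] := pp.
apply: (packable_residual s1 s2 pp).
have eq_sub a b c : a + b = c -> a = c - b by move=> <-; rewrite addnK.
have k1 := eq_sub _ _ _ (card_res1 u1); have k2 := eq_sub _ _ _ (card_res2 u2).
have ps_le : size ps <= n by lia.
have ltn' : n - size ps < n by rewrite ltn_subrL ps0 (leq_trans ps0 ps_le).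
refine (@IH (n - size ps) (res1 ps) (res2 ps) (@re1 T1 T2 e1 ps) (@re2 T1 T2 e2 ps) (@re3 T1 T2 e1 e2 e3 ps) Dl D3' ltn' _).
split.
- by rewrite -c1; exact: k1.
- by rewrite -c2; exact: k2.
- by split=> [x y|x]; [exact: s1|exact: i1].
- by split=> [x y|x]; [exact: s2|exact: i2].
- by move=> x; rewrite deg_re1; apply: leq_trans (h1 (val x)); rewrite subset_leq_card ?subsetDl.
- by move=> x; rewrite deg_re2; apply: leq_trans (h2 (val x)); rewrite subset_leq_card ?subsetDl.
- move=> x; apply: (leq_trans (@deg_re3 T1 T2 e1 e2 e3 ps x) (hx _ _)); by have := valP x; rewrite inE.
- move=> y; apply: (leq_trans (@flip_re3 T1 T2 e1 e2 e3 ps y) (hy _ _)); by have := valP y; rewrite inE.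
- by rewrite leq_subRL //; move: hDl; clear; lia.
- by move: hD3; clear; lia.
- have := mass_re1 s1 u1; have := mass_re2 s2 u2; have := mass_re3 e2 e3 s1 u1 u2; move: hsum b3 hD3; rewrite -/(mass _). clear. do ! move: (bigop _ _ _) => ?. do ! move: (mass _) => ?. move: (size ps) => ?. lia.
Qed.

End Reduction.

(** * Sparse triples *)

Section PermutationAverages.

Variable T : finType.

Import GroupScope.

Lemma reindex_mulperm (V : Type) (idx : V) (op : Monoid.com_law idx) (p : {perm T}) (F : {perm T} -> V) :
  \big[op/idx]_s F (p * s) = \big[op/idx]_s F s.
Proof. by rewrite [RHS](reindex_inj (mulgI p)). Qed.

Lemma sum_perm_inv (V : Type) (idx : V) (op : Monoid.com_law idx) (F : {perm T} -> V) :
  \big[op/idx]_s F s^-1 = \big[op/idx]_s F s.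
Proof. by rewrite [RHS](reindex_inj invg_inj). Qed.

Import GRing.Theory Num.Theory.
Local Open Scope ring_scope.

Lemma sum_perm1 (g : T -> int) (x : T) :
  (\sum_(s : {perm T}) g (s x)) *+ #|T| = (\sum_y g y) *+ #|{perm T}|.
Proof.
have indep y : \sum_(s : {perm T}) g (s x) = \sum_(s : {perm T}) g (s y).
  rewrite -(reindex_mulperm _ (tperm x y) (fun s : {perm T} => g (s x))) /=.
  by apply: eq_bigr => s _; rewrite permM tpermL.
rewrite -[LHS]sumr_const (eq_bigr _ (fun y _ => indep y)) exchange_big /= -sumr_const.
apply: eq_bigr => s _; by rewrite [RHS](reindex_inj (@perm_inj _ s)).
Qed.

Lemma two_transitive (x x' y y' : T) : x != x' -> y != y' ->
  exists p : {perm T}, p x = y /\ p x' = y'.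
Proof.
move=> nx ny; exists (tperm x y * tperm (tperm x y x') y')%g; rewrite !permM tpermL tpermL.
split=> //; rewrite tpermD // 1?eq_sym //.
by rewrite -{1}(tpermL x y) (inj_eq (@perm_inj _ _)).
Qed.

Lemma sum_perm2 (g : T -> T -> int) (x x' : T) : x != x' ->
  (\sum_(s : {perm T}) g (s x) (s x')) *+ (#|T| * #|T|.-1) =
  (\sum_y \sum_(y' | y' != y) g y y') *+ #|{perm T}|.
Proof.
move=> nx.
have indep y y' : y' != y ->
    \sum_(s : {perm T}) g (s x) (s x') = \sum_(s : {perm T}) g (s y) (s y').
  rewrite eq_sym => /(two_transitive nx) [p [px px']].
  rewrite -(reindex_mulperm _ p (fun s : {perm T} => g (s x) (s x'))) /=.
  by apply: eq_bigr => s _; rewrite !permM px px'.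
have -> : (\sum_(s : {perm T}) g (s x) (s x')) *+ (#|T| * #|T|.-1) =
   \sum_(y : T) \sum_(y' | y' != y) \sum_(s : {perm T}) g (s y) (s y').
  rewrite mulnC mulrnA -[LHS]sumr_const; apply: eq_bigr => y _.
  have -> : #|T|.-1 = #|[pred y' | y' != y]| by rewrite -(cardC1 y); apply: eq_card => z; rewrite !inE.
  rewrite -[LHS]sumr_const; apply: eq_bigr => y' hy; exact: indep.
rewrite (eq_bigr (fun y => \sum_(s : {perm T}) \sum_(y' | y' != y) g (s y) (s y'))); last first.
  by move=> y _; rewrite exchange_big.
rewrite exchange_big /= -sumr_const; apply: eq_bigr => s _.
rewrite [RHS](reindex_inj (@perm_inj _ s)) /=; apply: eq_bigr => y _.
rewrite [RHS](reindex_inj (@perm_inj _ s)) /=; apply: eq_bigl => y'.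
by rewrite (inj_eq (@perm_inj _ s)).
Qed.

(** Sampling without replacement: since [g] sums to 0, its sum over the points other than y is - g
    y, so the mixed terms have nonpositive average and only the squares remain. *)
Lemma second_moment (g : T -> int) (S : {set T}) : \sum_y g y = 0 ->
  (\sum_(s : {perm T}) (\sum_(x in S) g (s x)) ^+ 2) *+ #|T| <=
  ((\sum_y g y ^+ 2) *+ #|{perm T}|) *+ #|S|.
Proof.
move=> g0.
have split_sq (s : {perm T}) : (\sum_(x in S) g (s x)) ^+ 2 =
    \sum_(x in S) g (s x) ^+ 2 + \sum_(x in S) \sum_(x' in S | x' != x) g (s x) * g (s x').
  rewrite -big_split /= expr2 mulr_suml; apply: eq_bigr => x xS.
  by rewrite mulr_sumr (bigD1 x) //= expr2.
rewrite (eq_bigr _ (fun s _ => split_sq s)) big_split /= mulrnDl.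
have -> : (\sum_(s : {perm T}) \sum_(x in S) g (s x) ^+ 2) *+ #|T| =
   ((\sum_y g y ^+ 2) *+ #|{perm T}|) *+ #|S|.
  rewrite exchange_big /= -sumrMnl -[RHS]sumr_const.
  by apply: eq_bigr => x _; rewrite (sum_perm1 (fun y => g y ^+ 2)).
suff : \sum_(s : {perm T}) \sum_(x in S) \sum_(x' in S | x' != x) g (s x) * g (s x') <= 0.
  by move=> h; rewrite gerDl mulrn_wle0.
rewrite exchange_big /=; apply: sumr_le0 => x xS; rewrite exchange_big /=.
apply: sumr_le0 => x' /andP[x'S nx].
have np : (0 < #|T| * #|T|.-1)%N.
  have : (1 < #|T|)%N by rewrite (cardD1 x) (cardD1 x') !inE nx.
  by case: #|T| => [//|[//|k]].
rewrite -(pmulrn_lle0 _ np) (sum_perm2 (fun a b => g a * g b)) ?[x == x']eq_sym //.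
rewrite mulrn_wle0 //; apply: sumr_le0 => y _; rewrite -mulr_sumr.
have -> : \sum_(y' | y' != y) g y' = - g y.
  by move: g0; rewrite (bigD1 y) //= addrC => /eqP; rewrite addr_eq0 => /eqP.
by rewrite mulrN oppr_le0 -expr2 sqr_ge0.
Qed.

End PermutationAverages.

(** * Removing conflicts by transpositions *)

Section OneType.

Variables (T : finType) (e1 e2 : rel T) (e3 : T -> T -> bool).
Hypotheses (g1 : simple_graph e1) (g2 : simple_graph e2).

Definition clash12 (s : {perm T}) (u v : T) : bool := e1 u v && e2 (s u) (s v).

(** The double sum runs over ordered pairs and sees each clash of two edges twice. The factor 2
    gives a conflict with G3 the same weight, so that for simple graphs a value below 2 means no
    conflict at all. *)
Definition conflicts (s : {perm T}) : nat :=
  \sum_u \sum_v clash12 s u v + 2 * \sum_u e3 u (s u).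

(** Bounds the number of vertices whose image is adjacent to the image of a neighbour of u, that is,
    the positions closed to u in a transposition. *)
Definition load (e e' : rel T) (s : {perm T}) (u : T) : nat :=
  \sum_(x in nbr e u) #|nbr e' (s x)|.

Lemma clash12_sym s u v : clash12 s u v = clash12 s v u.
Proof. by rewrite /clash12 (proj1 g1) (proj1 g2). Qed.

Lemma clash12_irr s u : clash12 s u u = false.
Proof. by rewrite /clash12 (proj2 g1). Qed.

Lemma conflicts_at s (u : T) :
  conflicts s = \sum_(a | a != u) \sum_(b | b != u) clash12 s a b + 2 * \sum_(a | a != u) e3 a (s a)
     + 2 * (\sum_b clash12 s u b + e3 u (s u)).
Proof.
rewrite /conflicts (bigD1 u) //= [in X in _ + 2 * X](bigD1 u) //=.
rewrite [X in _ + X + _ = _](eq_bigr (fun a => clash12 s u a + \sum_(b | b != u) clash12 s a b)); last first.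
  by move=> a _; rewrite (bigD1 u) //= [in LHS]clash12_sym.
rewrite big_split /=.
have -> : \sum_b clash12 s u b = \sum_(b | b != u) clash12 s u b.
  by rewrite (bigD1 u) //= clash12_irr.
lia.
Qed.

Lemma no_conflict s : conflicts s < 2 -> packable e1 e2 e3.
Proof.
move=> cs; exists s; split; first exact: perm_inj.
have H u : \sum_b clash12 s u b + e3 u (s u) = 0.
  by move: cs; rewrite (conflicts_at s u); lia.
split=> [u|u v e1uv]; first by have := H u; case: (e3 u (s u)) => //; rewrite addn1.
apply/negP => e2uv; have := H u; rewrite (bigD1 v) //= /clash12 e1uv e2uv; lia.
Qed.

Section Swap.

Variables (D L : nat).
Hypothesis d1D : forall x, #|nbr e1 x| <= D.
Hypothesis d2D : forall x, #|nbr e2 x| <= D.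
Hypothesis d3D : forall x, #|nbr e3 x| <= D.
Hypothesis d3rD : forall x, #|nbr (flip e3) x| <= D.
Hypothesis room : 100 * (2 * L + 3 * D + 1) + mass e1 + mass e2 < 100 * #|T|.

Lemma sum_pred1_le (P : {set T}) x k : \sum_(y in P) (y == x) * k <= k.
Proof.
rewrite -big_distrl /= -[X in _ <= X]mul1n leq_mul2r; apply/orP; right.
apply: (@leq_trans (\sum_y (y == x))); last by rewrite (bigD1 x) //= eqxx big1 // => y /negPf ->.
by rewrite [X in _ <= X](bigID (mem P)) /= leq_addr.
Qed.

Lemma load_swap (e e' : rel T) (s s' : {perm T}) u x x' :
  (forall y, #|nbr e' y| <= D) ->
  #|nbr e' (s' x)| <= 100 -> (forall y, y != x -> y != x' -> s' y = s y) ->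
  load e e' s' u <= load e e' s u + (D + 100).
Proof.
move=> dD' low agree; rewrite /load.
apply: (@leq_trans (\sum_(y in nbr e u) (#|nbr e' (s y)| + ((y == x') * D + (y == x) * 100)))).
  apply: leq_sum => y _; case: (eqVneq y x) => [->|nx].
    by apply: leq_trans low _; rewrite mul1n addnA leq_addl.
  case: (eqVneq y x') => [->|nx']; last by rewrite agree ?leq_addr.
  by apply: leq_trans (dD' _) _; rewrite mul1n; lia.
by rewrite big_split /= leq_add2l big_split /= leq_add ?sum_pred1_le.
Qed.

Lemma card_high (e : rel T) : 100 * #|[set x | 100 < #|nbr e x|]| <= mass e.
Proof.
rewrite /mass (bigID (fun x => 100 < #|nbr e x|)) /=.
apply: leq_trans (leq_addr _ _); rewrite mulnC -sum1dep_card big_distrl /=.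
by apply: leq_sum => x hx; rewrite mul1n ltnW.
Qed.

(** A union bound over the excluded partners: those that would clash after u moves ([B3]) or after
    they move themselves ([B4]), at most L each by the loads; the neighbours in G1 and G3, at most
    3D; the vertices of degree above 100 in either graph, at most mass/100 each. The degree cap
    prepares the later swaps: it limits the growth of every load to D + 100. *)
Lemma swap_partner (s : {perm T}) u : load e1 e2 s u <= L -> load e2 e1 (s^-1)%g (s u) <= L ->
  exists u', [/\ u' != u, ~~ e1 u u' & #|nbr e1 u'| <= 100] /\
   [/\ #|nbr e2 (s u')| <= 100, ~~ e3 u (s u'), ~~ e3 u' (s u),
       (forall x, e1 u x -> ~~ e2 (s x) (s u')) &
       (forall x, e1 x u' -> ~~ e2 (s u) (s x))].
Proof.
move=> l1 l2.
pose B3 := \bigcup_(x in nbr e1 u) (s @^-1: nbr e2 (s x)).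
pose B4 := \bigcup_(z in nbr e2 (s u)) (nbr e1 (s^-1 z)%g).
have cpre (A : {set T}) : #|s @^-1: A| = #|A| by apply: card_preimset; exact: perm_inj.
have cbig (I : finType) (P : {set I}) (F : I -> {set T}) : #|\bigcup_(i in P) F i| <= \sum_(i in P) #|F i|.
  elim/big_rec2: _ => [|i k A _ IH]; first by rewrite cards0.
  exact: leq_trans (leq_card_setU _ _) (leq_add (leqnn _) IH).
have c3 : #|B3| <= L.
  apply: leq_trans (cbig _ _ _) _; apply: leq_trans l1; rewrite /load.
  by apply: leq_sum => x _; rewrite cpre.
have c4 : #|B4| <= L by apply: leq_trans (cbig _ _ _) _.
have h1 := card_high e1; have h2 := card_high e2.
pose H2 := s @^-1: [set y | 100 < #|nbr e2 y|].
have cH2 : #|H2| = #|[set x | 100 < #|nbr e2 x|]| by rewrite cpre.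
pose Bad := s @^-1: nbr e3 u :|: nbr (flip e3) (s u) :|: B3 :|: B4 :|: nbr e1 u :|: [set u]
   :|: [set x | 100 < #|nbr e1 x|] :|: H2.
have cBad : #|Bad| < #|T|.
  have cU (A B : {set T}) k l : #|A| <= k -> #|B| <= l -> #|A :|: B| <= k + l.
    by move=> hA hB; apply: leq_trans (leq_card_setU _ _) (leq_add hA hB).
  have : #|Bad| <= D + D + L + L + D + 1 + #|[set x | 100 < #|nbr e1 x|]| + #|[set x | 100 < #|nbr e2 x|]|.
    apply: (cU); last by rewrite cH2.
    apply: (cU); last by [].
    apply: (cU); last by rewrite cards1.
    apply: (cU); last exact: d1D.
    apply: (cU); last by [].
    apply: (cU); last by [].
    by apply: (cU); [rewrite cpre; exact: d3D | exact: d3rD].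
  by move: h1 h2 room; clear; lia.
have [u' nB] : exists u', u' \notin Bad.
  apply/existsP; rewrite -negb_forall; apply/negP => /forallP all.
  by move: cBad; rewrite ltnNge; move/negP; apply; rewrite subset_leq_card //; apply/subsetP => z _; exact: all.
exists u'; move: nB; rewrite !inE !negb_or -!andbA => /and5P[n3 n3' nB3 nB4 /and4P[n1 nu nh1 nh2]].
split; split=> //; rewrite 1?leqNgt //.
- move=> x e1ux; apply/negP => h; case/negP: nB3; apply/bigcupP; exists x; by rewrite !inE.
- move=> x e1xu; apply/negP => h; case/negP: nB4; apply/bigcupP; exists (s x); rewrite !inE // permK.
  exact: e1xu.
Qed.

Lemma swap_step (s : {perm T}) u : 0 < \sum_b clash12 s u b + e3 u (s u) ->
  load e1 e2 s u <= L -> load e2 e1 (s^-1)%g (s u) <= L ->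
  exists s' : {perm T}, [/\ conflicts s' + 2 <= conflicts s,
    (forall v, load e1 e2 s' v <= load e1 e2 s v + (D + 100)) &
    (forall v, load e2 e1 (s'^-1)%g v <= load e2 e1 (s^-1)%g v + (D + 100))].
Proof.
move=> cu l1 l2; have [u' [[nu n1 h1] [h2 n3 n3' A1 A2]]] := swap_partner l1 l2.
pose s' := (tperm u u' * s)%g; exists s'.
have s'u : s' u = s u' by rewrite permM tpermL.
have s'u' : s' u' = s u by rewrite permM tpermR.
have s'x x : x != u -> x != u' -> s' x = s x by move=> hx hx'; rewrite permM tpermD // eq_sym.
have irr1 x : e1 x x = false by exact: (proj2 g1).
have sy1 x y : e1 x y = e1 y x by exact: (proj1 g1).
have sy2 x y : e2 x y = e2 y x by exact: (proj1 g2).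
have new_u b : clash12 s' u b = false.
  rewrite /clash12 s'u; case: (eqVneq b u) => [->|nb]; first by rewrite irr1.
  case: (eqVneq b u') => [->|nb']; first by rewrite (negPf n1).
  by rewrite s'x //; case: (boolP (e1 u b)) => //= /A1; rewrite sy2 => /negPf.
have new_u' b : b != u -> clash12 s' u' b = false.
  move=> nb; rewrite /clash12 s'u'; case: (eqVneq b u') => [->|nb']; first by rewrite irr1.
  by rewrite s'x //; case: (boolP (e1 u' b)) => //=; rewrite sy1 => /A2 /negPf.
have old a b : a != u -> b != u -> clash12 s' a b <= clash12 s a b.
  move=> na nb; case: (eqVneq a u') => [->|na']; first by rewrite new_u'.
  case: (eqVneq b u') => [->|nb']; first by rewrite clash12_sym new_u'.
  by rewrite /clash12 !s'x.
have old3 a : a != u -> e3 a (s' a) <= e3 a (s a).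
  move=> na; case: (eqVneq a u') => [->|na']; last by rewrite s'x.
  by rewrite s'u' (negPf n3').
split.
- rewrite (conflicts_at s u) (conflicts_at s' u).
  have -> : \sum_b clash12 s' u b = 0 by rewrite big1 // => b _; rewrite new_u.
  rewrite s'u (negPf n3).
  have le12 : \sum_(a | a != u) \sum_(b | b != u) clash12 s' a b <= \sum_(a | a != u) \sum_(b | b != u) clash12 s a b.
    by apply: leq_sum => a na; apply: leq_sum => b nb; exact: old.
  have le3 : \sum_(a | a != u) e3 a (s' a) <= \sum_(a | a != u) e3 a (s a).
    by apply: leq_sum => a na; exact: old3.
  by move: cu le12 le3; clear; lia.
- by move=> v; apply: (@load_swap _ _ _ _ _ u u') => //; rewrite s'u.
move=> v; apply: (@load_swap _ _ _ _ _ (s u) (s u')) => //.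
  by rewrite /s' invMg permM permK tpermV tpermL.
move=> y ny ny'; rewrite /s' invMg permM tpermV tpermD //.
  by apply: contra ny => /eqP ->; rewrite permKV.
by apply: contra ny' => /eqP ->; rewrite permKV.
Qed.

Lemma resolve_conflicts k (s : {perm T}) : conflicts s <= 2 * k ->
  (forall v, load e1 e2 s v + k * (D + 100) <= L) ->
  (forall v, load e2 e1 (s^-1)%g v + k * (D + 100) <= L) -> packable e1 e2 e3.
Proof.
elim: k s => [|k IHk] s cs l1 l2; first by apply: (@no_conflict s); lia.
case: (ltnP (conflicts s) 2) => [|c2]; first exact: no_conflict.
have [/existsP[u cu]|none] := boolP [exists u, 0 < \sum_b clash12 s u b + e3 u (s u)]; last first.
  move: none; rewrite negb_exists => /forallP none.
  exists s; split; first exact: perm_inj.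
  have H u : \sum_b clash12 s u b + e3 u (s u) = 0 by have := none u; lia.
  split=> [u|u v e1uv]; first by have := H u; case: (e3 u (s u)) => //; rewrite addn1.
  apply/negP => e2uv; have := H u; rewrite (bigD1 v) //= /clash12 e1uv e2uv; lia.
have [||s' [c' l1' l2']] := swap_step cu.
- by apply: leq_trans (l1 u); exact: leq_addr.
- by apply: leq_trans (l2 (s u)); exact: leq_addr.
apply: (IHk s'); first by move: cs c'; lia.
- by move=> v; have := l1 v; have := l1' v; lia.
- by move=> v; have := l2 v; have := l2' v; lia.
Qed.

End Swap.

End OneType.

(** * The first moment of the number of conflicts *)

Section NatAverages.
Variable T : finType.
Import GRing.Theory Num.Theory.

Lemma sum_perm1_nat (g : T -> nat) (x : T) :
  (\sum_(s : {perm T}) g (s x)) * #|T| = (\sum_y g y) * #|{perm T}|.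
Proof.
have := sum_perm1 (fun y => (g y)%:R%R) x; rewrite -!natr_sum -!mulrnA => /eqP.
by rewrite eqr_nat => /eqP.
Qed.

Lemma sum_perm2_nat (g : T -> T -> nat) (x x' : T) : x != x' ->
  (\sum_(s : {perm T}) g (s x) (s x')) * (#|T| * #|T|.-1) =
  (\sum_y \sum_(y' | y' != y) g y y') * #|{perm T}|.
Proof.
move=> nx; have := sum_perm2 (fun y y' => (g y y')%:R%R) nx.
have -> : (\sum_y \sum_(y' | y' != y) (g y y')%:R)%R =
    ((\sum_y \sum_(y' | y' != y) g y y')%N%:R : int)%R.
  by rewrite natr_sum; apply: eq_bigr => y _; rewrite natr_sum.
by rewrite -natr_sum -!mulrnA => /eqP; rewrite eqr_nat => /eqP.
Qed.

Variables (e1 e2 : rel T) (e3 : T -> T -> bool).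
Hypotheses (g1 : simple_graph e1) (g2 : simple_graph e2).

Lemma massE (e : T -> T -> bool) : mass e = \sum_u \sum_v e u v.
Proof. by apply: eq_bigr => u _; rewrite -sum1dep_card big_mkcond /=; apply: eq_bigr => v _; case: (e u v). Qed.

Lemma conflicts_average :
  (\sum_s conflicts e1 e2 e3 s) * (#|T| * #|T|.-1) =
  (mass e1 * mass e2 + 2 * mass e3 * #|T|.-1) * #|{perm T}|.
Proof.
rewrite big_split /= -big_distrr /= mulnDl mulnDl; congr (_ + _).
  rewrite exchange_big /=.
  under eq_bigr do rewrite exchange_big /=.
  rewrite big_distrl /= massE !big_distrl /=; apply: eq_bigr => u _.
  rewrite !big_distrl /=; apply: eq_bigr => v _.
  case: (boolP (e1 u v)) => e1uv; last first.
    by rewrite /clash12 (negPf e1uv) big1.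
  have nuv : u != v by apply: contraTN e1uv => /eqP ->; rewrite (proj2 g1).
  have -> : \sum_(s : {perm T}) clash12 e1 e2 s u v = \sum_(s : {perm T}) nat_of_bool (e2 (s u) (s v)).
    by apply: eq_bigr => s _; rewrite /clash12 e1uv.
  rewrite mul1n (sum_perm2_nat (fun a b => nat_of_bool (e2 a b)) nuv) massE; congr (_ * _).
  apply: eq_bigr => y _; rewrite [RHS](bigD1 y) //= (proj2 g2) add0n.
  by apply: eq_bigr => z _.
rewrite exchange_big /= mulnA.
rewrite -[_ * _ * #|T|]mulnA [(\sum_u _) * _]big_distrl /=.
under eq_bigr do rewrite (sum_perm1_nat (fun y => e3 _ y)).
rewrite -big_distrl /= -massE; lia.
Qed.

Lemma first_moment :
  mass e1 * mass e2 + 2 * mass e3 * #|T|.-1 < 2 * (#|T| * #|T|.-1) -> packable e1 e2 e3.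
Proof.
move=> small.
have [/existsP[s cs]|none] := boolP [exists s : {perm T}, conflicts e1 e2 e3 s < 2].
  exact: no_conflict cs.
have P0 : 0 < #|{perm T}| by apply/card_gt0P; exists 1%g.
have : 2 * #|{perm T}| <= \sum_s conflicts e1 e2 e3 s.
  rewrite mulnC -sum_nat_const; apply: leq_sum => s _.
  by move: none; rewrite negb_exists => /forallP/(_ s); rewrite -leqNgt.
move=> h; have := conflicts_average; move: h small P0; clear.
move: (\sum_s _) (#|T| * _) (mass e1 * _ + _) #|{perm T}| => a b c d; nia.
Qed.

End NatAverages.

(** Averages over permutations need a single vertex type, so G2 and the second side of G3 are
    carried over to T1 by a fixed bijection. *)
Lemma transport (T1 T2 : finType) (e1 : rel T1) (e2 : rel T2) (e3 : T1 -> T2 -> bool) :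
  #|T1| = #|T2| -> simple_graph e2 ->
  exists (e2' : rel T1) (e3' : T1 -> T1 -> bool), [/\ simple_graph e2',
    (forall x, exists y, #|nbr e2' x| = #|nbr e2 y| /\ #|nbr (flip e3') x| = #|nbr (flip e3) y|),
    (forall x, #|nbr e3' x| = #|nbr e3 x|),
    mass e2' = mass e2 /\ mass e3' = mass e3 &
    packable e1 e2' e3' -> packable e1 e2 e3].
Proof.
move=> eqT [s2 i2].
have [g [h [gK hK]]] : exists (g : T1 -> T2) (h : T2 -> T1), cancel g h /\ cancel h g.
  have inj : injective (fun x : T1 => enum_val (cast_ord eqT (enum_rank x))).
    by move=> x y /enum_val_inj/cast_ord_inj/enum_rank_inj.
  have [h hK hK'] : bijective (fun x : T1 => enum_val (cast_ord eqT (enum_rank x))).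
    by apply: inj_card_bij; rewrite ?eqT.
  by exists (fun x : T1 => enum_val (cast_ord eqT (enum_rank x))), h.
have injg := can_inj gK; have injh := can_inj hK.
have cg (P : pred T2) : #|[set x | P (g x)]| = #|[set y | P y]|.
  rewrite -(card_imset _ injg); apply: eq_card => y; rewrite !inE.
  apply/imsetP/idP => [[x]|Py]; first by rewrite inE => ? ->.
  by exists (h y); rewrite ?inE hK.
exists (fun x y => e2 (g x) (g y)), (fun x y => e3 x (g y)); split.
- by split=> [x y|x]; [exact: s2 | exact: i2].
- move=> x; exists (g x); split; first exact: (cg (fun y => e2 (g x) y)).
  by apply: eq_card => y; rewrite !inE.
- move=> x; exact: (cg (fun y => e3 x y)).
- split; last by apply: eq_bigr => x _; exact: (cg (fun y => e3 x y)).
  rewrite /mass [RHS](reindex g) /=; last by exists h => x _.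
  by apply: eq_bigr => x _; exact: (cg (fun y => e2 (g x) y)).
move=> [f [finj [f3 f12]]]; exists (g \o f); split; first exact: inj_comp.
by split.
Qed.

Lemma first_moment_packs (T1 T2 : finType) (e1 : rel T1) (e2 : rel T2) (e3 : T1 -> T2 -> bool) :
  #|T1| = #|T2| -> simple_graph e1 -> simple_graph e2 ->
  mass e1 * mass e2 + 2 * mass e3 * #|T1|.-1 < 2 * (#|T1| * #|T1|.-1) -> packable e1 e2 e3.
Proof.
move=> eqT g1 g2 small; have [e2' [e3' [g2' _ _ [m2 m3] back]]] := @transport T1 T2 e1 e2 e3 eqT g2.
by apply: back; apply: first_moment => //; rewrite m2 m3.
Qed.

(** * Concentration of the loads *)

Section Sparse.
Variable T : finType.
Import Order.TTheory GRing.Theory Num.Theory.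
Local Open Scope ring_scope.

(* Scaled by #|T| to stay in the integers. *)
Definition centred (e : rel T) (y : T) : int := (#|T| * #|nbr e y|)%:R - (mass e)%:R.

(** This is #|T| times the difference between the load at u and its average over all
    permutations. *)
Definition deviation (e e' : rel T) (s : {perm T}) (u : T) : int :=
  \sum_(x in nbr e u) centred e' (s x).

Lemma centred_sum0 (e : rel T) : \sum_y centred e y = 0.
Proof.
rewrite sumrB sumr_const -natr_sum -big_distrr /= -/(mass e) -mulrnA mulnC.
by rewrite [(mass e * _)%N]mulnC subrr.
Qed.

Lemma deviationE (e e' : rel T) s u :
  deviation e e' s u = (#|T| * load e e' s u)%:R - (#|nbr e u| * mass e')%:R.
Proof.
rewrite /deviation sumrB sumr_const -natr_sum -big_distrr /= -mulrnA.
by rewrite [(mass e' * _)%N]mulnC.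
Qed.

Lemma centred_sq (e : rel T) (D : nat) : (forall y, (#|nbr e y| <= D)%N) ->
  \sum_y centred e y ^+ 2 <= (#|T| ^ 2 * (D * mass e))%:R.
Proof.
move=> dD.
have sq y : centred e y ^+ 2 = (#|T| ^ 2 * #|nbr e y| ^ 2 + mass e ^ 2)%:R
   - (2 * #|T| * mass e * #|nbr e y|)%:R.
  by rewrite /centred; move: #|T| #|nbr e y| (mass e) => a b c; lia.
rewrite (eq_bigr _ (fun y _ => sq y)) sumrB -!natr_sum -big_distrr /= big_split /=.
rewrite -/(mass e) sum_nat_const -big_distrr /=.
have : (\sum_y #|nbr e y| ^ 2 <= D * mass e)%N.
  rewrite /mass big_distrr /=; apply: leq_sum => y _.
  by rewrite -mulnn leq_mul2r dD orbT.
have : (#|T| * mass e ^ 2 + 0 <= 2 * #|T| * mass e * mass e)%N by nia.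
rewrite -[(#|{: T}| * _)%N]/(#|T| * _)%N.
move: (\sum_y _)%N (mass e) => a b h1 h2.
have h3 : (#|T| ^ 2 * a <= #|T| ^ 2 * (D * b))%N by rewrite leq_mul2l h2 orbT.
move: h1 h3; move: (#|T| ^ 2 * a)%N (#|T| ^ 2 * (D * b))%N (#|T| * b ^ 2)%N (2 * #|T| * b * b)%N.
by move=> c d f g; rewrite natrD; lia.
Qed.

Lemma deviation_average (e e' : rel T) (D : nat) : (0 < #|T|)%N -> (forall y, (#|nbr e' y| <= D)%N) ->
  \sum_(s : {perm T}) \sum_u deviation e e' s u ^+ 2 <=
    (#|T| * D * (mass e * mass e') * #|{perm T}|)%:R.
Proof.
move=> T0 dD; rewrite exchange_big /= -(ler_pMn2r T0) -sumrMnl.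
apply: (@le_trans _ _ (\sum_u ((\sum_y centred e' y ^+ 2) *+ #|{perm T}|) *+ #|nbr e u|)).
  by apply: ler_sum => u _; apply: second_moment; exact: centred_sum0.
rewrite sumrMnr -/(mass e) -mulrnA.
apply: (@le_trans _ _ ((#|T| ^ 2 * (D * mass e'))%:R *+ (#|{perm T}| * mass e)%N)).
  by apply: ler_wMn2r; exact: centred_sq.
rewrite -!mulrnA ler_nat; apply: eq_leq; move: #|T| #|{perm T}| (mass e) (mass e') => a b c d; rewrite -mulnn; lia.
Qed.

End Sparse.

Section SparseArith.
Import Order.TTheory GRing.Theory Num.Theory.
Local Open Scope ring_scope.

(** The mean part d * m2 is at most 6n^2/250 = 0.024 n^2, and the deviation is below q/100 = 0.37
    n^2; together they give the 0.394. *)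
Lemma load_of_sq (x A : int) (q n l d m2 m1 m3 D : nat) :
  q = (37 * n ^ 2)%N -> (1000 <= n)%N -> (250 * D <= n)%N -> (d <= D)%N ->
  (m1 + m2 + 2 * m3 <= 6 * n)%N ->
  x = (n * l)%:R - (d * m2)%:R -> x ^+ 2 <= A -> 100%:R * 100%:R * A < (q * q)%:R ->
  (1000 * l <= 394 * n)%N.
Proof.
move=> qE hn hD hd hm xE hx hA.
have h1 : (d * m2 <= D * (6 * n))%N by apply: leq_mul => //; lia.
have h2 : (250 * (D * (6 * n)) <= 6 * n ^ 2)%N by nia.
rewrite leqNgt; apply/negP => hl.
have h3 : q%:R <= 100%:R * x.
  have : (394 * n ^ 2 <= 1000 * (n * l))%N by nia.
  lia.
have h4: (0:int) <= q%:R by [].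
have := ler_pM h4 h4 h3 h3.
by move: hA hx; rewrite expr2; clear; lia.
Qed.

Lemma average_contradiction (n D M W P q SC : nat) (SA : int) :
  q = (37 * n ^ 2)%N -> (1000 <= n)%N -> (250 * D <= n)%N -> (0 < P)%N ->
  (M <= 9 * n ^ 2)%N -> (W <= 9 * n ^ 2)%N ->
  SA <= (2 * (n * D * M * P))%:R -> (SC * (n * n.-1) = W * P)%N ->
  (29 * (q * q) * P)%:R <= 29%:R * (100%:R * 100%:R) * SA + (q * q * SC)%:R -> False.
Proof.
move=> qE T0 hD P0 M9 W9 i1 i2 i3.
have n0 : (0 < n)%N by apply: leq_trans T0.
have D9 : (250 * (n * D * M) <= 9 * n ^ 4)%N.
  have : (250 * D * n * M <= n * n * (9 * n ^ 2))%N by rewrite leq_mul // leq_mul.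
  by rewrite (_ : n ^ 4 = n * n * n ^ 2)%N ?mulnn -?expnD //; lia.
have qq : (q * q = 1369 * n ^ 4)%N by rewrite qE (_ : n ^ 4 = n ^ 2 * n ^ 2)%N -?expnD //; lia.
rewrite qq in i3; move: D9 i3; clear qq qE.
have n40 : (0 < n ^ 4)%N by rewrite expn_gt0 n0.
move: (n ^ 4)%N (n * D * M)%N i1 n40 => x Q i1 x0 D9 i3.
have j3 : (29 * (1369 * x) * P <= 600 * 1000 * (Q * P) + 1369 * (x * SC))%N.
  move: i1 i3; clear; move: (Q * P)%N => z; lia.
have j4 : (600 * 1000 * (Q * P) <= 2400 * (9 * (x * P)))%N.
  have : (250 * Q * P <= 9 * x * P)%N by rewrite leq_mul2r D9 orbT.
  by clear; lia.
have j5 : (1810 * 10 * P <= 1369 * SC)%N.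
  by move: j3 j4 x0; clear; nia.
have j6 : (1810 * 10 * (n * n.-1) <= 1369 * (9 * n ^ 2))%N.
  move: P0 j5 i2 W9; clear; move: (n * n.-1)%N (n ^ 2)%N => y z P0 j5 i2 W9.
  have : (SC * y <= 9 * z * P)%N by rewrite i2 leq_mul2r W9 orbT.
  have : (1810 * 10 * P * y <= 1369 * SC * y)%N by move: j5; clear; nia.
  by move: P0; clear; nia.
by move: j6 T0; clear; nia.
Qed.
End SparseArith.

Section SparsePacking.
Variable T : finType.
Variables (e1 e2 : rel T) (e3 : T -> T -> bool).
Hypotheses (g1 : simple_graph e1) (g2 : simple_graph e2).
Import Order.TTheory GRing.Theory Num.Theory.

Lemma balanced_perm (D : nat) : 1000 <= #|T| -> 250 * D <= #|T| ->
  (forall y, #|nbr e1 y| <= D) -> (forall y, #|nbr e2 y| <= D) ->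
  mass e1 + mass e2 + 2 * mass e3 <= 6 * #|T| ->
  exists s : {perm T}, [/\ conflicts e1 e2 e3 s < 29,
    (forall u, 1000 * load e1 e2 s u <= 394 * #|T|) &
    (forall y, 1000 * load e2 e1 (s^-1)%g y <= 394 * #|T|)].
Proof.
move=> T0 hD d1 d2 hm; set n := #|T| in T0 hD hm *.
pose A (s : {perm T}) : int := (\sum_u deviation e1 e2 s u ^+ 2 + \sum_u deviation e2 e1 (s^-1)%g u ^+ 2)%R.
have [q qE] : exists q, q = 37 * n ^ 2 by eexists.
pose ok (s : {perm T}) := (conflicts e1 e2 e3 s < 29) && (100%:R * 100%:R * A s < (q * q)%:R)%R.
have A0 s : (0 <= A s)%R by rewrite addr_ge0 // sumr_ge0 // => *; exact: sqr_ge0.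
have A1 s u : (deviation e1 e2 s u ^+ 2 <= A s)%R.
  rewrite /A [X in (_ <= X + _)%R](bigD1 u) // -addrA lerDl addr_ge0 // ?sumr_ge0 // => *; exact: sqr_ge0.
have A2 s u : (deviation e2 e1 s^-1%g u ^+ 2 <= A s)%R.
  rewrite /A [X in (_ <= _ + X)%R](bigD1 u) // addrCA lerDl addr_ge0 // ?sumr_ge0 // => *; exact: sqr_ge0.
have [/existsP[s /andP[cs As]]|none] := boolP [exists s, ok s].
  have hm' : mass e2 + mass e1 + 2 * mass e3 <= 6 * n by rewrite [mass e2 + _]addnC.
  exists s; split=> [|u|u]; first exact: cs.
    exact: (load_of_sq qE T0 hD (d1 u) hm (deviationE e1 e2 s u) (A1 s u) As).
  exact: (load_of_sq qE T0 hD (d2 u) hm' (deviationE e2 e1 s^-1%g u) (A2 s u) As).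
have n0 : 0 < n by apply: leq_trans T0.
have P0 : 0 < #|{perm T}| by apply/card_gt0P; exists 1%g.
(* With r = 6n - (a + b), the left-hand side is at most (6n - r)^2/4 + rn, and r <= 6n makes this at
   most 9n^2. *)
have W9 : mass e1 * mass e2 + 2 * mass e3 * n.-1 <= 9 * n ^ 2.
  move: hm n0; clear; move: (mass e1) (mass e2) (mass e3) n => a b c m hm n0.
  have [agm _] := nat_AGM2 a b; pose r := 6 * m - (a + b).
  have er : a + b + r = 6 * m by rewrite /r; lia.
  have cr : 2 * c * m.-1 <= r * m by apply: leq_mul; rewrite ?leq_pred //; lia.
  have rr : r * r <= 6 * m * r by rewrite leq_mul2r; apply/orP; right; lia.
  have sq : (a + b) ^ 2 + r * r + 2 * (a + b) * r = 36 * m ^ 2.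
    by rewrite -[36]/(6 ^ 2) -expnMn -er -!mulnn; lia.
  have sr : (a + b) * r + r * r = 6 * m * r by rewrite -er; lia.
  move: agm cr rr sq sr; move: ((a + b) ^ 2) (2 * c * m.-1) => x y.
  by rewrite -mulnn; clear; lia.
have M9 : mass e1 * mass e2 <= 9 * n ^ 2 by apply: leq_trans W9; exact: leq_addr.
exfalso; apply: (average_contradiction qE T0 hD P0 M9 W9 (SA := (\sum_s A s)%R) (SC := \sum_s conflicts e1 e2 e3 s)).
- rewrite /A big_split mulSn mul1n natrD lerD ?deviation_average //.
  rewrite (sum_perm_inv (+%R) (fun s : {perm T} => \sum_u deviation e2 e1 s u ^+ 2)%R).
  by rewrite [(mass e1 * _)%N]mulnC deviation_average.
- exact: conflicts_average.
have -> : ((29 * (q * q) * #|{perm T}|)%:R = \sum_(s : {perm T}) (29 * (q * q))%:R :> int)%R.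
  by rewrite sumr_const natrM mulr_natr.
rewrite mulr_sumr big_distrr natr_sum -big_split.
apply: ler_sum => s _; move: none; rewrite negb_exists => /forallP/(_ s).
move: (A0 s); rewrite /ok; move: (A s) (conflicts e1 e2 e3 s) (q * q) => a b c a0.
rewrite negb_and -leqNgt -leNgt => /orP[c30|ha].
  have hc : 29 * c <= c * b by rewrite mulnC leq_mul2l c30 orbT.
  apply: (@le_trans _ _ (c * b)%:R%R); first by rewrite ler_nat.
  by rewrite lerDr mulr_ge0.
have : (0 <= (c * b)%:R :> int)%R by [].
move=> bc0.
have key : ((29 * c)%:R <= 29%:R * (100%:R * 100%:R) * a + (c * b)%:R)%R.
  by move: ha bc0; move: (c * b) => d; clear; lia.
exact: key.
Qed.

Lemma sparse_packs_same (D : nat) : 130 * 1000 <= #|T| -> 250 * D <= #|T| ->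
  (forall y, #|nbr e1 y| <= D) -> (forall y, #|nbr e2 y| <= D) ->
  (forall y, #|nbr e3 y| <= D) -> (forall y, #|nbr (flip e3) y| <= D) ->
  mass e1 + mass e2 + 2 * mass e3 <= 6 * #|T| -> packable e1 e2 e3.
Proof.
move=> T0 hD d1 d2 d3 d3r hm.
have [|s [c l1 l2]] := balanced_perm _ hD d1 d2 hm; first by apply: leq_trans T0; lia.
(* At most 28 = 2 * 14 units of conflict call for 14 swaps, which raise a load from 0.394 n by 14(D
   + 100), at most 0.056 n + 1400, hence within 0.463 n when n >= 130000. The partners excluded at a
   swap then number about 0.926 n + 0.012 n + 0.06 n, just below n. *)
pose L := 463 * #|T| %/ 1000.
have L1 : 1000 * L <= 463 * #|T| by rewrite mulnC leq_divM.
have L2 : 463 * #|T| < 1000 * L + 1000 by rewrite /L; lia.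
apply: (@resolve_conflicts T e1 e2 e3 g1 g2 D L d1 d2 d3 d3r _ 14 s).
- by move: L1 hD T0 hm; clear; lia.
- by lia.
- by move=> v; have := l1 v; move: L2 hD T0; clear; lia.
- by move=> v; have := l2 v; move: L2 hD T0; clear; lia.
Qed.
End SparsePacking.

Lemma sparse_packs (T1 T2 : finType) (e1 : rel T1) (e2 : rel T2) (e3 : T1 -> T2 -> bool) (D : nat) :
  #|T1| = #|T2| -> simple_graph e1 -> simple_graph e2 ->
  130 * 1000 <= #|T1| -> 250 * D <= #|T1| ->
  (forall y, #|nbr e1 y| <= D) -> (forall y, #|nbr e2 y| <= D) ->
  (forall y, #|nbr e3 y| <= D) -> (forall y, #|nbr (flip e3) y| <= D) ->
  mass e1 + mass e2 + 2 * mass e3 <= 6 * #|T1| -> packable e1 e2 e3.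
Proof.
move=> eqT g1 g2 T0 hD d1 d2 d3 d3r hm.
have [e2' [e3' [g2' deg2 deg3 [m2 m3] back]]] := @transport T1 T2 e1 e2 e3 eqT g2.
apply: back; apply: (@sparse_packs_same T1 e1 e2' e3' g1 g2' D) => //.
- by move=> x; have [y [-> _]] := deg2 x.
- by move=> x; rewrite deg3.
- by move=> x; have [y [_ ->]] := deg2 x.
by rewrite m2 m3.
Qed.

(** * Very large degrees *)

Lemma row_row_mass (A B : finType) (r : A -> B -> bool) (p v : A) :
  p != v -> #|nbr r p| + #|nbr r v| <= mass r.
Proof.
move=> npv; rewrite /mass (bigD1 v) //= (bigD1 p) //= addnA [X in _ <= X + _]addnC.
exact: leq_addr.
Qed.

Lemma row_col_mass (A B : finType) (r : A -> B -> bool) (v : A) (y : B) :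
  #|nbr (flip r) y :\ v| + #|nbr r v| <= mass r.
Proof.
rewrite /mass (bigD1 v) //= addnC leq_add2l -sum1dep_card.
rewrite [X in _ <= X](bigID (fun x => r x y)) /=; apply: (leq_trans _ (leq_addr _ _)).
rewrite (eq_bigl (fun x => (x != v) && r x y)); last by move=> x; rewrite !inE.
apply: leq_sum => x /andP[_ rxy]; by apply/card_gt0P; exists y; rewrite inE.
Qed.

Section Single.

Variables (C n : nat) (T1 T2 : finType) (e1 : rel T1) (e2 : rel T2) (e3 : T1 -> T2 -> bool).
Variables (Dl D3 : nat).
Hypothesis bg : budget C n e1 e2 e3 Dl D3.
Hypothesis IH : packs_below C n.

Lemma reduction_single (x : T1) (y : T2) (D3' : nat) : ~~ e3 x y ->
  Dl + 3 <= n -> D3' + 2 <= n ->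
  (forall x', x' != x -> #|nbr e3 x' :\ y| + (if e1 x x' then #|nbr e2 y| else 0) <= D3') ->
  (forall y', y' != y -> #|nbr (flip e3) y' :\ x| + (if e2 y y' then #|nbr e1 x| else 0) <= D3') ->
  #|nbr e1 x| * #|nbr e2 y| + D3' + 3 <=
    #|nbr e1 x| + #|nbr e2 y| + #|nbr e3 x| + #|nbr (flip e3) y| + D3 ->
  packable e1 e2 e3.
Proof.
move=> nxy hDl hD3 hx hy hs.
have [_ _ [s1 i1] [s2 i2] _ _ _ _ _ _ _] := bg.
have eX : Xof [:: (x, y)] = [set x] by apply/setP => z; rewrite !inE.
have eY : Yof [:: (x, y)] = [set y] by apply/setP => z; rewrite !inE.
have o1 : outer1 e1 [:: (x, y)] (x, y) = #|nbr e1 x|.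
  rewrite /outer1 eX; apply: eq_card => z; rewrite !inE.
  by case: eqVneq => [->|]; rewrite ?i1.
have o2 : outer2 e2 [:: (x, y)] (x, y) = #|nbr e2 y|.
  rewrite /outer2 eY; apply: eq_card => z; rewrite !inE.
  by case: eqVneq => [->|]; rewrite ?i2.
apply: (reduction bg IH (ps := [:: (x, y)]) (D3' := D3')) => //.
- split=> //= [p|p q]; rewrite ?inE => /eqP -> //.
  by move=> /eqP -> /=; rewrite i1.
- by rewrite /=; lia.
- by rewrite /=; lia.
- by move=> x'; rewrite eX eY inE big_mkcond big_seq1 o2 /=; exact: hx.
- by move=> y'; rewrite eX eY inE big_mkcond big_seq1 o1 /=; exact: hy.
rewrite !big_seq1 o1 o2 /= eX.
have -> : #|nbr (flip e3) y :\: [set x]| = #|nbr (flip e3) y|.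
  apply: eq_card => z; rewrite !inE; by case: eqVneq => [->|]; rewrite ?andbT // /flip (negPf nxy).
lia.
Qed.

(** The hypothesis forces every other row and column to be shorter than d by about Dl, so the degree
    bound of G3 drops to d - 1 as soon as one entry of the row of v goes. Placing a nearly isolated
    x on some y in this row achieves that. If no such move gains the required 3 units, then x is
    isolated and the vertices of the row meet no edge except the one to v; then v itself can be
    placed outside its row, which frees d pairs. *)
Lemma heavy_list_packs (v : T1) :
  mass e1 + 2 * mass e3 + 2 * Dl + 20 <= 4 * #|nbr e3 v| -> packable e1 e2 e3.
Proof.
have [c1 c2 [s1 i1] [s2 i2] h1 h2 h3 h4 b1 b2 b3] := bg.
set d := #|nbr e3 v| => hd.
have dD3 : d <= D3 := h3 v.
have row p : p != v -> #|nbr e3 p| + d <= mass e3 by exact: row_row_mass.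
have col y : #|nbr (flip e3) y| + d <= mass e3 + 1.
  have := row_col_mass e3 v y; rewrite -/d.
  have := cardsD1 v (nbr (flip e3) y); lia.
have dm : d <= mass e3 by rewrite /mass (bigD1 v) //= leq_addr.
have colD y x : #|nbr (flip e3) y :\ x| <= #|nbr (flip e3) y| by rewrite subset_leq_card ?subsetDl.
have rowD y x : #|nbr e3 x :\ y| <= #|nbr e3 x| by rewrite subset_leq_card ?subsetDl.
(* Otherwise the vertices other than v give 2(n - 1) <= mass e1 + mass e3 - d, whereas the
   hypothesis bounds the right-hand side by 2d - 20. *)
have [x [nxv nvx dx]] : exists x, [/\ x != v, ~~ e1 v x & #|nbr e1 x| + #|nbr e3 x| <= 1].
  have [/existsP[x /and3P[]]|none] :=
    boolP [exists x, [&& x != v, ~~ e1 v x & #|nbr e1 x| + #|nbr e3 x| <= 1]]; first by exists x.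
  have low x : x != v -> 2 <= #|nbr e1 x| + #|nbr e3 x| + e1 v x.
    move=> nx; move: none; rewrite negb_exists => /forallP/(_ x); rewrite nx /=.
    have : e1 v x -> 0 < #|nbr e1 x| by move=> e; apply/card_gt0P; exists v; rewrite inE s1.
    by case: (e1 v x) => [/(_ isT)|]; rewrite -?ltnNge; lia.
  have : \sum_(x | x != v) 2 <= \sum_(x | x != v) (#|nbr e1 x| + #|nbr e3 x| + e1 v x).
    by apply: leq_sum.
  rewrite !big_split /= sum_nat_const cardC1 c1.
  have -> : \sum_(x | x != v) e1 v x = #|nbr e1 v|.
    rewrite -sum1dep_card [RHS]big_mkcond [RHS](bigD1 v) //= i1.
    by apply: eq_bigr => x _; case: (e1 v x).
  have : \sum_(x | x != v) #|nbr e1 x| + #|nbr e1 v| = mass e1 by rewrite /mass [RHS](bigD1 v) //= addnC.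
  have : \sum_(x | x != v) #|nbr e3 x| + d = mass e3 by rewrite /mass [RHS](bigD1 v) //= addnC.
  by move: hd b2 dD3; clear; lia.
have [x1|x0] := ltnP 0 #|nbr e1 x|.
  have x30 : #|nbr e3 x| = 0 by lia.
  have /card_gt0P[y] : 0 < #|nbr e3 v| by rewrite -/d; lia.
  rewrite inE => vy.
  have yr : 0 < #|nbr (flip e3) y| by apply/card_gt0P; exists v; rewrite inE.
  have nxy : ~~ e3 x y by apply/negP => xy; move/eqP: x30; rewrite cards_eq0 => /eqP/setP/(_ y); rewrite !inE xy.
  apply: (@reduction_single x y d.-1 nxy); [by lia|by lia| | |].
  - move=> x' nx'; case: (eqVneq x' v) => [->|nv].
      rewrite s1 (negPf nvx) addn0; have := cardsD1 y (nbr e3 v); rewrite inE vy; lia.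
    have := row _ nv; have := rowD y x'; have := h2 y.
    by case: (e1 x x'); lia.
  - move=> y' ny'; have := col y'; have := colD y' x.
    by case: (e2 y y'); lia.
  - by nia.
have x0' : #|nbr e1 x| = 0 by lia.
have noe1 x' : e1 x x' = false.
  by move/eqP: x0'; rewrite cards_eq0 => /eqP/setP/(_ x'); rewrite !inE.
have [/existsP[y /and3P[vy nxy ysum]]|none] :=
  boolP [exists y, [&& e3 v y, ~~ e3 x y & 2 <= #|nbr e2 y| + #|nbr (flip e3) y| + #|nbr e3 x|]].
  apply: (@reduction_single x y d.-1 nxy); [by lia|by lia| | |].
  - move=> x' nx'; rewrite noe1 addn0; case: (eqVneq x' v) => [->|nv].
      have := cardsD1 y (nbr e3 v); rewrite inE vy; lia.
    by have := row _ nv; have := rowD y x'; lia.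
  - move=> y' ny'; rewrite x0' if_same addn0.
    by have := col y'; have := colD y' x; lia.
  - by rewrite x0' mul0n; lia.
have low y : e3 v y -> ~~ e3 x y -> #|nbr e2 y| + #|nbr (flip e3) y| + #|nbr e3 x| <= 1.
  move=> vy nxy; move: none; rewrite negb_exists => /forallP/(_ y); rewrite vy nxy /=; lia.
have vyr y : e3 v y -> 0 < #|nbr (flip e3) y| by move=> vy; apply/card_gt0P; exists v; rewrite inE.
have x30 : #|nbr e3 x| = 0.
  have : 0 < #|nbr e3 v :\: nbr e3 x| by rewrite cardsD; have := subset_leq_card (subsetIr (nbr e3 v) (nbr e3 x)); lia.
  by case/card_gt0P=> y; rewrite !inE => /andP[nxy vy]; have := low _ vy nxy; have := vyr _ vy; lia.
have nox y : ~~ e3 x y by apply/negP => xy; move/eqP: x30; rewrite cards_eq0 => /eqP/setP/(_ y); rewrite !inE xy.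
have lone y : e3 v y -> #|nbr e2 y| = 0 by move=> vy; have := low _ vy (nox y); have := vyr _ vy; lia.
have last_move w : ~~ e3 v w -> #|nbr e2 w| <= 2 -> packable e1 e2 e3.
  move=> vw w2; have dl := h1 v; have colv y' : #|nbr (flip e3) y' :\ v| + d <= mass e3 by exact: row_col_mass.
  apply: (@reduction_single v w d.-1 vw); [by lia|by lia| | |].
  - by move=> x' nv; have := row _ nv; have := rowD w x'; case: (e1 v x'); lia.
  - by move=> y' nw; have := colv y'; case: (e2 w y'); lia.
  rewrite -/d; move: w2 dl hd dD3 dm; clear; move: #|nbr e2 w| #|nbr e1 v| => b a b2.
  move: (mass e1) (mass e3) #|nbr (flip e3) w| => m1 m3 f.
  move: d => k; case: b b2 => [|[|[|//]]] _ => *; rewrite ?muln0 ?muln1 ?muln2; lia.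
(* The next move keeps d as degree bound, which a residual triple of order n - 1 allows only if d +
   2 <= n. If d = n - 1, the single vertex w outside the row has no neighbour, all other vertices
   being isolated in G2. *)
have [Z2|Z1] := leqP (d + 2) n.
  have [/existsP[w /andP[vw wsum]]|noneZ] :=
    boolP [exists w, ~~ e3 v w && (3 <= #|nbr e2 w| + #|nbr (flip e3) w|)].
    apply: (@reduction_single x w d (nox w)); [by lia|by lia| | |].
    - move=> x' nx'; rewrite noe1 addn0; case: (eqVneq x' v) => [->|nv]; first exact: rowD.
      by have := row _ nv; have := rowD w x'; lia.
    - move=> y' ny'; rewrite x0' if_same addn0.
      by have := col y'; have := colD y' x; lia.
    - by rewrite x0' mul0n; lia.
  have /card_gt0P[w] : 0 < #|~: nbr e3 v| by rewrite cardsCs setCK c2 -/d; lia.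
  rewrite !inE => vw; apply: (last_move w vw).
  by move: noneZ; rewrite negb_exists => /forallP/(_ w); rewrite vw /=; lia.
have /card_gt0P[w] : 0 < #|~: nbr e3 v| by rewrite cardsCs setCK c2 -/d; lia.
rewrite !inE => vw; apply: (last_move w vw); rewrite leqNgt; apply/negP => /ltnW/ltnW/card_gt0P[y].
rewrite inE => wy; have nyw : y != w by apply: contraTN wy => /eqP ->; rewrite i2.
have vy : e3 v y.
  apply/negPn/negP => nvy; have : 2 <= #|~: nbr e3 v|.
    by rewrite (cardD1 w) (cardD1 y) !inE vw nyw nvy.
  by rewrite cardsCs setCK c2 -/d; lia.
by have /eqP := lone _ vy; rewrite cards_eq0 => /eqP/setP/(_ w); rewrite !inE s2 wy.
Qed.

End Single.

(** * A discharging bound on the number of edges *)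

Section LeafCharge.

Variables (T : finType) (e : rel T) (A B : {set T}) (h : nat).
Hypothesis g : simple_graph e.
Hypothesis h0 : 0 < h.
Hypothesis no_isolated : forall w, w \notin A -> #|nbr e w| != 0.
Hypothesis no_leaf : forall w u, w \notin A -> #|nbr e w| = 1 -> e w u -> u \notin B -> h <= #|nbr e u|.

Let touched w := (w \in A) || (w \in B).
Let leaf w := #|nbr e w| == 1.

(* Discharging: an edge carries 2(h+1) units, split between its ends by [share], and every
   vertex outside A and B receives at least 2h of them. *)
Let share w u :=
  if touched w then (if touched u then h + 1 else 0)
  else if touched u then 2 * (h + 1)
  else if leaf w && ~~ leaf u then 2 * h
  else if ~~ leaf w && leaf u then 2 else h + 1.

Lemma share_sum w u : share w u + share u w = 2 * (h + 1).
Proof. by rewrite /share; case: (touched w); case: (touched u); case: (leaf w); case: (leaf u) => /=; lia. Qed.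

Lemma share_total : \sum_w \sum_(u in nbr e w) share w u = (h + 1) * mass e.
Proof.
have sw : \sum_w \sum_(u in nbr e w) share w u = \sum_w \sum_(u in nbr e w) share u w.
  rewrite [RHS](exchange_big_dep xpredT) //=; apply: eq_bigr => w _.
  by apply: eq_bigl => u; rewrite !inE (proj1 g).
have : \sum_w \sum_(u in nbr e w) (share w u + share u w) = 2 * (h + 1) * mass e.
  rewrite /mass big_distrr /=; apply: eq_bigr => w _.
  rewrite (eq_bigr (fun _ => 2 * (h + 1))); last by move=> u _; exact: share_sum.
  by rewrite sum_nat_const mulnC.
under eq_bigr do rewrite big_split /=.
by rewrite big_split /= -sw; lia.
Qed.

Lemma share_ge w : 2 * h <= \sum_(u in nbr e w) share w u + 2 * (h + 1) * (w \in A) + 2 * (h + 1) * (w \in B).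
Proof.
case: (boolP (touched w)) => tw.
  by move: tw; rewrite /touched; case: (w \in A); case: (w \in B) => //= _; lia.
have /negP/negP := tw; rewrite negb_or => /andP[wA wB].
rewrite (negPf wA) (negPf wB) !muln0 !addn0.
have shareE u : share w u = if touched u then 2 * (h + 1)
  else if leaf w && ~~ leaf u then 2 * h else if ~~ leaf w && leaf u then 2 else h + 1.
  by rewrite /share (negPf tw).
have := no_isolated wA; rewrite -lt0n => dw.
have hB u : e w u -> ~~ touched u -> leaf w -> h <= #|nbr e u|.
  by move=> wu; rewrite negb_or => /andP[uA uB] /eqP lw; exact: (no_leaf wA lw wu uB).
case: (boolP (leaf w)) => lw.
  have /card_gt0P[u] := dw; rewrite inE => wu.
  rewrite (bigD1 u) ?inE //=; apply: (leq_trans _ (leq_addr _ _)).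
  rewrite shareE lw /=; case: (boolP (touched u)) => tu; first by lia.
  case: (boolP (leaf u)) => lu //=.
  by have := hB _ wu tu lw; rewrite (eqP lu); lia.
have sge u : e w u -> 2 <= share w u.
  by move=> wu; rewrite shareE (negPf lw) /=; case: (touched u); case: (leaf u); lia.
(* A vertex next to an untouched leaf has degree at least h and receives at least 2 from each edge;
   any other non-leaf has degree at least 2 and receives at least h + 1 from each edge. *)
case: (boolP [exists u, [&& e w u, ~~ touched u & leaf u]]) => [/existsP[u /and3P[wu tu lu]]|none].
  have hw : h <= #|nbr e w|.
    move: tu; rewrite negb_or => /andP[uA uB].
    by apply: (no_leaf uA (eqP lu) _ wB); rewrite (proj1 g).
  apply: (@leq_trans (\sum_(u' in nbr e w) 2)); first by rewrite sum_nat_const; lia.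
  by apply: leq_sum => u'; rewrite inE; exact: sge.
apply: (@leq_trans (\sum_(u' in nbr e w) (h + 1))).
  by rewrite sum_nat_const; move: dw lw; rewrite /leaf; move: #|nbr e w| => [|[|k]] //; nia.
apply: leq_sum => u; rewrite inE => wu; rewrite shareE (negPf lw) /=.
case: (boolP (touched u)) => tu; first by lia.
case: (boolP (leaf u)) => lu //.
by move: none; rewrite negb_exists => /forallP/(_ u); rewrite wu tu lu.
Qed.

(** With A and B empty, disjoint stars with h leaves attain equality: h + 1 vertices and mass 2h
    each. Every vertex of A or B can spoil this by at most one edge's worth of charge. *)
Lemma leaf_charge : 2 * h * #|T| <= (h + 1) * (mass e + 2 * #|A| + 2 * #|B|).
Proof.
have : \sum_(w : T) 2 * h <= \sum_w (\sum_(u in nbr e w) share w u + 2 * (h + 1) * (w \in A) + 2 * (h + 1) * (w \in B)).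
  by apply: leq_sum => w _; exact: share_ge.
rewrite sum_nat_const !big_split /= share_total -!big_distrr /=.
have cnt (S : {set T}) : \sum_w (w \in S) = #|S|.
  by rewrite -sum1_card [RHS]big_mkcond; apply: eq_bigr => w _; case: (w \in S).
rewrite !cnt (eq_card (B := T)) //; lia.
Qed.

End LeafCharge.

Section LeafPair.

Variables (T1 T2 : finType) (e1 : rel T1) (e2 : rel T2) (e3 : T1 -> T2 -> bool).
Hypotheses (g1 : simple_graph e1) (g2 : simple_graph e2).
Variables (v q : T1) (w u : T2).
Hypotheses (nqv : q != v) (nvq : ~~ e1 v q) (nvw : ~~ e3 v w) (nqu : ~~ e3 q u).
Hypotheses (wu : e2 w u) (w1 : #|nbr e2 w| = 1).

Let ps := [:: (v, w); (q, u)].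

Lemma leaf_pair_neq : w != u.
Proof. by apply: contraTneq wu => ->; rewrite (proj2 g2). Qed.

Lemma leaf_pair_valid : partial_packing e1 e2 e3 ps.
Proof.
split=> /=; rewrite ?inE ?(eq_sym v) ?nqv ?leaf_pair_neq //.
  by move=> p; rewrite !inE => /orP[] /eqP ->.
move=> p p'; rewrite !inE => /orP[] /eqP -> /orP[] /eqP -> /=; rewrite ?(proj2 g1) //.
  by rewrite (negPf nvq).
by rewrite (proj1 g1) (negPf nvq).
Qed.

Lemma leaf_pair_Xof : Xof ps = [set v; q]. Proof. by apply/setP => z; rewrite !inE. Qed.
Lemma leaf_pair_Yof : Yof ps = [set w; u]. Proof. by apply/setP => z; rewrite !inE. Qed.

Lemma leaf_pair_outer1 : outer1 e1 ps (v, w) = #|nbr e1 v| /\ outer1 e1 ps (q, u) = #|nbr e1 q|.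
Proof.
rewrite /outer1 leaf_pair_Xof; split; apply: eq_card => z; rewrite !inE negb_or /=.
  by case: (eqVneq z v) => [->|]; rewrite ?(proj2 g1) //=; case: (eqVneq z q) => [->|]; rewrite ?(negPf nvq).
by case: (eqVneq z v) => [->|] /=; [rewrite (proj1 g1) (negPf nvq)|case: (eqVneq z q) => [->|]; rewrite ?(proj2 g1)].
Qed.

Lemma leaf_pair_nbr : nbr e2 w = [set u].
Proof.
by apply/eqP; rewrite eq_sym eqEcard w1 cards1 leqnn andbT sub1set inE.
Qed.

(** The purpose of the pair: q occupies the only neighbour of w, so v creates no pair of G3, however
    large its degree. Only q, usually of low degree, pays. *)
Lemma leaf_pair_outer2 : outer2 e2 ps (v, w) = 0 /\ outer2 e2 ps (q, u) + 1 = #|nbr e2 u|.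
Proof.
rewrite /outer2 leaf_pair_Yof; split.
  apply/eqP; rewrite cards_eq0 /= leaf_pair_nbr; apply/eqP/setP => z; rewrite !inE.
  by case: (eqVneq z u); rewrite ?orbT ?andbF.
rewrite (cardsD1 w (nbr e2 u)) inE (proj1 g2) wu addnC; congr (_ + _); apply: eq_card => z.
by rewrite !inE; case: (eqVneq z w) => //=; case: (eqVneq z u) => [->|] //=; rewrite (proj2 g2).
Qed.

End LeafPair.

(** * Vertices adjacent to almost all of their own graph *)

Lemma residual_first_moment (T1 T2 : finType) (e1 : rel T1) (e2 : rel T2) (e3 : T1 -> T2 -> bool)
    (ps : seq (T1 * T2)) (n : nat) :
  #|T1| = n -> #|T2| = n -> simple_graph e1 -> simple_graph e2 ->
  partial_packing e1 e2 e3 ps ->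
  mass (@re1 T1 T2 e1 ps) * mass (@re2 T1 T2 e2 ps) + 2 * mass (@re3 T1 T2 e1 e2 e3 ps) * (n - size ps).-1
    < 2 * ((n - size ps) * (n - size ps).-1) -> packable e1 e2 e3.
Proof.
move=> c1 c2 [s1 i1] [s2 i2] pp small; have [u1 u2 _ _] := pp.
have k1 : #|res1 ps| = n - size ps by rewrite -c1 -(card_res1 u1) addnK.
have k2 : #|res2 ps| = n - size ps by rewrite -c2 -(card_res2 u2) addnK.
apply: (packable_residual s1 s2 pp).
apply: first_moment_packs; first by rewrite k1 k2.
- by split=> [x y|x]; [exact: s1|exact: i1].
- by split=> [x y|x]; [exact: s2|exact: i2].
by rewrite k1.
Qed.

Lemma isolated_image_arith (n c2 m2 m3 K : nat) : 3 <= n -> c2 + m2 + 2 * m3 + 2 * K <= 2 * n -> 2 <= K ->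
  c2 * m2 + 2 * m3 * (n - 1).-1 < 2 * ((n - 1) * (n - 1).-1).
Proof.
move=> n3 hs K2; rewrite -subn1 -subnDA.
have [k nk] : exists k, n = k + 2 by exists (n - 2); lia.
rewrite nk !addnK (_ : k + 2 - 1 = k + 1); last by lia.
have [agm _] := nat_AGM2 c2 m2.
have : (c2 + m2) ^ 2 <= (c2 + m2) * (2 * (k + 2 - K)) by rewrite -mulnn leq_mul2l; apply/orP; right; lia.
have : (c2 + m2 + 2 * m3) * k <= 2 * (k + 2 - K) * k by rewrite leq_mul2r; apply/orP; right; lia.
have : (c2 + m2) * (2 * (k + 2 - K)) <= (c2 + m2) * (2 * k) by rewrite leq_mul2l; apply/orP; right; lia.
have : 2 * (k + 2 - K) * k <= 2 * k * k by rewrite leq_mul2r; apply/orP; right; lia.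
have k0 : 0 < k by lia.
by move: agm k0; clear; nia.
Qed.

(** Here [kap] is the degree of q, which may create kap * (h - 1) pairs of G3. The charging bound
    leaves only 2n/(h + 1) for M1 + 2 kap + 2z + 2K, and the factor h + 1 absorbs h - 1. *)
Lemma leaf_image_arith (n M1 M2 M3 kap h m2 m3 t z K : nat) :
  10 <= n -> 0 < h -> M1 + 2 * kap + m2 + 2 * m3 + 2 * K <= 2 * n ->
  2 * n * h <= (h + 1) * (m2 + 2 * t) -> m3 = t + z -> M2 <= m2 -> 3 <= K ->
  M3 <= z + kap * (h - 1) ->
  M1 * M2 + 2 * M3 * (n - 2).-1 < 2 * ((n - 2) * (n - 2).-1).
Proof.
move=> n10 h0 hs hl hz hM2 K3 hM3; rewrite -subn1 -subnDA.
have [k nk] : exists k, n = k + 3 by exists (n - 3); lia.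
rewrite nk addnK (_ : k + 3 - 2 = k + 1); last by lia.
have a1 : (h + 1) * (M1 + 2 * kap + 2 * z + 2 * K) <= 2 * n.
  have : (h + 1) * (M1 + 2 * kap + m2 + 2 * m3 + 2 * K) <= (h + 1) * (2 * n) by rewrite leq_mul2l hs orbT.
  by rewrite hz; move: hl; clear; lia.
have a2 : 2 * M1 + 2 * M3 + 2 * K * (h + 1) <= 2 * n.
  move: a1 hM3 h0; clear; case: h => // h; rewrite subn1 /= => a1 hM3 _.
  have ex : (h.+1 + 1) * (M1 + 2 * kap + 2 * z + 2 * K) =
     2 * (M1 + 2 * kap + 2 * z + 2 * K) + (h * M1 + 2 * (kap * h) + 2 * (h * z) + 2 * (K * h)) by lia.
  have ey : 2 * K * (h.+1 + 1) = 4 * K + 2 * (K * h) by lia.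
  move: a1 hM3; rewrite ex ey; move: (h * M1) (kap * h) (h * z) (K * h) => x1 x2 x3 x4; lia.
have a3 : M1 * M2 <= M1 * (2 * k) by rewrite leq_mul2l; apply/orP; right; lia.
have a4 : (2 * M1 + 2 * M3) * k <= 2 * k * k by rewrite leq_mul2r; apply/orP; right; nia.
by move: a3 a4; clear -n10 nk; nia.
Qed.

Section NearStar.

Variables (C n : nat) (T1 T2 : finType) (e1 : rel T1) (e2 : rel T2) (e3 : T1 -> T2 -> bool).
Variables (Dl D3 : nat).
Hypothesis bg : budget C n e1 e2 e3 Dl D3.
Hypothesis C_large : 418 * 1000 <= C.

(** The degree of v enters the budget twice through G1 and twice through [Dl], about 4n in all. Once
    v is placed at low cost, on an isolated vertex or on a leaf, what remains has doubled size just
    under 2n, and a random bijection of the rest succeeds. *)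
Lemma near_star_packs (v : T1) : n <= #|nbr e1 v| + 200 * 1000 -> packable e1 e2 e3.
Proof.
move=> hv; have [c1 c2 g1 g2 h1 h2 h3 h4 b1 b2 b3] := bg.
have [s1 i1] := g1; have [s2 i2] := g2.
have dv := h1 v.
have nC : C <= 3 * n by lia.
have [w0|no_isolated] := boolP [exists w, ~~ e3 v w && (#|nbr e2 w| == 0)].
  have /existsP[w /andP[nvw /eqP dw]] := w0.
  have pp : partial_packing e1 e2 e3 [:: (v, w)].
    split=> //= [p|p p']; rewrite ?inE => /eqP -> //.
    by move=> /eqP -> /=; rewrite i1.
  have eX : Xof [:: (v, w)] = [set v] by apply/setP => z; rewrite !inE.
  have o1 : outer1 e1 [:: (v, w)] (v, w) = #|nbr e1 v|.
    rewrite /outer1 eX; apply: eq_card => z; rewrite !inE.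
    by case: eqVneq => [->|]; rewrite ?i1.
  have o2 : outer2 e2 [:: (v, w)] (v, w) = 0.
    apply/eqP; rewrite -leqn0 -dw; exact/subset_leq_card/subsetDl.
  apply: (residual_first_moment c1 c2 g1 g2 pp).
  have [u1 u2 _ _] := pp.
  have := mass_re1 s1 u1; have := mass_re2 s2 u2; have := mass_re3 e2 e3 s1 u1 u2.
  rewrite !big_seq1 o1 o2 dw muln0 !addn0 /=.
  move: (mass (@re1 _ _ _ _)) (mass (@re2 _ _ _ _)) (mass (@re3 _ _ _ _ _ _)) => M1 M2 M3 r3 r2 r1.
  apply: (@leq_ltn_trans (M1 * M2 + 2 * mass e3 * (n - 1).-1)).
    by rewrite leq_add2l leq_mul2r leq_mul2l; apply/orP; right; apply/orP; right; lia.
  apply: (@isolated_image_arith n M1 M2 (mass e3) 10); [by lia| |by []].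
  by move: b3 r1 r2 dv hv C_large; clear; lia.
have iso w : w \notin nbr e3 v -> #|nbr e2 w| != 0.
  rewrite inE => nvw; apply/negP => dw; case/negP: no_isolated; apply/existsP; exists w.
  by rewrite nvw.
have [q [nqv nvq]] : exists q, q != v /\ ~~ e1 v q.
  have : 1 < #|~: nbr e1 v| by rewrite cardsCs setCK c1; lia.
  rewrite (cardD1 v) !inE i1 /= ltnS => /card_gt0P[q]; rewrite !inE => /andP[? ?].
  by exists q.
(* Taking h minimal serves twice: it is the cost of putting q on u, and minimality supplies the
   hypothesis of [leaf_charge] with threshold h. *)
pose good (h : nat) := [exists w, exists u, [&& ~~ e3 v w, #|nbr e2 w| == 1, e2 w u, ~~ e3 q u & #|nbr e2 u| == h]].
have rows : #|nbr e3 q| + #|nbr e3 v| <= mass e3 by exact: row_row_mass.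
(* Twice 418000, less four times the 200000 by which the degree of v may fall short of n, is 2 *
   18000. *)
have budget' : mass e1 + mass e2 + 2 * mass e3 + 2 * (18 * 1000) <= 2 * n + 2 * #|nbr e1 v|.
  by move: b3 dv hv C_large; clear; lia.
have charge h : 0 < h -> (forall h', h' < h -> ~~ good h') ->
    2 * n * h <= (h + 1) * (mass e2 + 2 * (#|nbr e3 v| + #|nbr e3 q|)).
  move=> h0 minh; have := @leaf_charge T2 e2 (nbr e3 v) (nbr e3 q) h g2 h0 iso.
  rewrite c2 => lc; apply: leq_trans (leq_trans _ (lc _)) _; first by rewrite mulnAC.
    move=> w u; rewrite !inE => nvw dw wu nqu; rewrite leqNgt; apply/negP => /minh/negP; apply.
    by apply/existsP; exists w; apply/existsP; exists u; rewrite nvw dw wu nqu !eqxx.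
  by rewrite -addnA -mulnDr.
have m1v : 2 * #|nbr e1 v| <= mass e1.
  have pp : uniq (unzip1 [:: (v, v)]) by [].
  have := mass_re1 s1 pp; rewrite big_seq1.
  have -> : outer1 e1 [:: (v, v)] (v, v) = #|nbr e1 v|.
    rewrite /outer1; apply: eq_card => z; rewrite !inE.
    by case: eqVneq => [->|]; rewrite ?i1.
  rewrite /=; lia.
have exg : exists h, good h.
  have [/existsP[h gh]|none] := boolP [exists h : 'I_n, good (val h)]; first by exists (val h).
  have n0 : 0 < n by lia.
  have all_bad h' : h' < n -> ~~ good h'.
    by move=> lt; move: none; rewrite negb_exists => /forallP/(_ (Ordinal lt)).
  have := charge n n0 all_bad; move: budget' rows m1v n0; clear.
  move: (mass e1) (mass e2) (mass e3) #|nbr e1 v| #|nbr e3 v| #|nbr e3 q| n => m1 m2 m3 a b c m bd rw mv m0.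
  have : m2 + 2 * (b + c) + 2 * (18 * 1000) <= 2 * m by lia.
  by move: (m2 + _) => x; nia.
case: (ex_minnP exg) => h /existsP[w /existsP[u /and5P[nvw /eqP dw wu nqu /eqP du]]] hmin.
have h0 : 0 < h by rewrite -du; apply/card_gt0P; exists w; rewrite inE s2.
have lc : 2 * n * h <= (h + 1) * (mass e2 + 2 * (#|nbr e3 v| + #|nbr e3 q|)).
  by apply: charge => // h' lt; apply/negP => /hmin; rewrite leqNgt lt.
have pp := leaf_pair_valid g1 g2 nqv nvq nvw nqu wu.
have [u1 u2 _ _] := pp.
have [o1 o1'] := leaf_pair_outer1 g1 w u nvq.
have [o2 o2'] := leaf_pair_outer2 g2 v q wu dw.
apply: (residual_first_moment c1 c2 g1 g2 pp).
have := mass_re1 s1 u1; have := mass_re2 s2 u2; have := mass_re3 e2 e3 s1 u1 u2.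
rewrite !big_cons !big_nil o1 o1' o2 muln0 !add0n !addn0 dw.
move: (mass (@re1 _ _ _ _)) (mass (@re2 _ _ _ _)) (mass (@re3 _ _ _ _ _ _)) => M1 M2 M3 r3 r2 r1.
rewrite [size _]/=.
apply: (@leaf_image_arith n M1 M2 M3 #|nbr e1 q| h (mass e2) (mass e3) (#|nbr e3 v| + #|nbr e3 q|)
  (mass e3 - (#|nbr e3 v| + #|nbr e3 q|)) (18 * 1000)) => //.
- by lia.
- by move: budget' r1; rewrite /=; clear; lia.
- by rewrite subnKC // addnC.
- by move: r2; clear; lia.
- move: r3 o2' rows; rewrite /= du; clear -h0.
  move: (outer2 _ _ _) => o r3 oh rows.
  have -> : h - 1 = o by lia.
  by move: r3 rows; move: (_ * o) => x; lia.
Qed.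

End NearStar.

(** * Moves in a minimal counterexample *)

(** A minimal counterexample. [cr_Dl] reflects [near_star_packs]. The 139000 of [cr_3l] and [cr_3r]
    lies just under C/3: by the budget, a larger G3-degree satisfies the hypothesis of
    [heavy_list_packs]. *)
Record critical (C n : nat) (T1 T2 : finType) (e1 : rel T1) (e2 : rel T2)
    (e3 : T1 -> T2 -> bool) (Dl D3 : nat) : Prop := Critical {
  cr_bg : budget C n e1 e2 e3 Dl D3;
  cr_IH : packs_below C n;
  cr_np : ~ packable e1 e2 e3;
  cr_C : 418 * 1000 + 275 <= C;
  cr_Dl : Dl + 200 * 1000 <= n;
  cr_3l : forall x, #|nbr e3 x| + 139 * 1000 <= n;
  cr_3r : forall y, #|nbr (flip e3) y| + 139 * 1000 <= n }.

Lemma critical_flip C n (T1 T2 : finType) (e1 : rel T1) (e2 : rel T2) e3 Dl D3 :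
  critical C n e1 e2 e3 Dl D3 -> critical C n e2 e1 (flip e3) Dl D3.
Proof.
case=> bg IH np hC hD h3 h4; split=> //; first exact: budget_flip.
by move=> pk; apply: np; apply: packable_flip => //; rewrite (bg_card1 bg) (bg_card2 bg).
Qed.

Section Moves.

Variables (C n : nat) (T1 T2 : finType) (e1 : rel T1) (e2 : rel T2) (e3 : T1 -> T2 -> bool).
Variables (Dl D3 : nat).
Hypothesis cr : critical C n e1 e2 e3 Dl D3.

(** The degree bound of G3 may grow by S, at a price of 2S, but is capped by the order of the
    residual triple; the cap is the reason for the separate absolute bounds on rows and columns. *)
Lemma reduction_slack (ps : seq (T1 * T2)) (S : nat) :
  0 < size ps -> size ps <= 1000 -> partial_packing e1 e2 e3 ps ->
  (forall x, x \notin Xof ps -> \sum_(p <- ps | e1 p.1 x) outer2 e2 ps p <= S) ->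
  (forall y, y \notin Yof ps -> \sum_(p <- ps | e2 p.2 y) outer1 e1 ps p <= S) ->
  (forall x, x \notin Xof ps ->
     #|nbr e3 x| + \sum_(p <- ps | e1 p.1 x) outer2 e2 ps p + size ps + 1 <= n) ->
  (forall y, y \notin Yof ps ->
     #|nbr (flip e3) y| + \sum_(p <- ps | e2 p.2 y) outer1 e1 ps p + size ps + 1 <= n) ->
  2 * \sum_(p <- ps) outer1 e1 ps p * outer2 e2 ps p + 2 * S + 6 * size ps <=
    \sum_(p <- ps) (#|nbr e1 p.1| + outer1 e1 ps p) +
    \sum_(p <- ps) (#|nbr e2 p.2| + outer2 e2 ps p) +
    2 * \sum_(p <- ps) #|nbr e3 p.1| -> False.
Proof.
case: (cr) => bg IH np hC hDl h3l h3r k0 k100 pp hx hy ox oy hs.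
have [_ _ _ _ _ _ hd3 hd3r _ _ _] := bg.
have lk : size ps + 2 <= n by move: hDl k100; clear; lia.
apply: np; apply: (reduction bg IH (ps := ps) (D3' := minn (D3 + S) (n - size ps - 1))) => //.
- by move: hDl k100; clear; lia.
- by move: lk; clear; lia.
- move=> x nx; have := ox x nx; have := hx x nx; have := hd3 x.
  have : #|nbr e3 x :\: Yof ps| <= #|nbr e3 x| by rewrite subset_leq_card ?subsetDl.
  by clear; lia.
- move=> y ny; have := oy y ny; have := hy y ny; have := hd3r y.
  have : #|nbr (flip e3) y :\: Xof ps| <= #|nbr (flip e3) y| by rewrite subset_leq_card ?subsetDl.
  by clear; lia.
have -> : \sum_(p <- ps) (#|nbr e3 p.1| + #|nbr (flip e3) p.2 :\: Xof ps|) =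
    \sum_(p <- ps) #|nbr e3 p.1| + \sum_(p <- ps) #|nbr (flip e3) p.2 :\: Xof ps| by rewrite big_split.
by move: hs; clear; lia.
Qed.

(** Since hosts occupy every neighbour of w, placing v creates no pair of G3 and its total degree is
    pure gain. All costs stem from the hosts, whose degrees are at most a. *)
Lemma host_move (a : nat) (v : T1) (w : T2) (hs : seq (T1 * T2)) :
  ~~ e3 v w -> unzip2 hs =i nbr e2 w -> uniq (unzip2 hs) ->
  v \notin unzip1 hs -> uniq (unzip1 hs) ->
  (forall p, p \in hs -> [/\ ~~ e3 p.1 p.2, ~~ e1 v p.1 & #|nbr e1 p.1| <= a]) ->
  (forall p q, p \in hs -> q \in hs -> ~~ e1 p.1 q.1) ->
  0 < a -> size hs <= 10 ->
  a * \sum_(p <- hs) #|nbr e2 p.2| + a * size hs + 3 * (size hs).+1 <= #|nbr e1 v| + #|nbr e3 v| ->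
  (forall x, x != v -> #|nbr e3 x| + \sum_(p <- hs | e1 p.1 x) #|nbr e2 p.2| + 20 <= n) ->
  (forall y, #|nbr (flip e3) y| + a * size hs + 20 <= n) -> False.
Proof.
move=> nvw img u2 nv u1 hh hind a0 h5 gain ox oy.
have [bg _ _ _ _ _ _] := cr.
have [_ _ [s1 i1] [s2 i2] _ _ _ _ _ _ _] := bg.
pose ps := (v, w) :: hs.
have inY y : (y \in Yof ps) = (y == w) || e2 w y by rewrite inE /= inE img inE.
have inX x : (x \in Xof ps) = (x == v) || (x \in unzip1 hs) by rewrite inE /= inE.
have o2v : outer2 e2 ps (v, w) = 0.
  apply/eqP; rewrite cards_eq0; apply/eqP/setP => y; rewrite in_setD inY !inE /=.
  by case: (e2 w y); rewrite ?orbT ?andbF.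
have o1v : outer1 e1 ps (v, w) = #|nbr e1 v|.
  apply: eq_card => x; rewrite in_setD inX inE /=; case: (boolP (e1 v x)) => evx; rewrite ?andbF ?andbT //.
  rewrite negb_or; apply/andP; split; first by apply: contraTneq evx => ->; rewrite i1.
  by apply/negP => /mapP[p pin xE]; have [_ + _] := hh _ pin; rewrite -xE evx.
have o1h p : outer1 e1 ps p <= #|nbr e1 p.1| by exact/subset_leq_card/subsetDl.
have o2h p : outer2 e2 ps p <= #|nbr e2 p.2| by exact/subset_leq_card/subsetDl.
have pp : partial_packing e1 e2 e3 ps.
  split=> /=.
  - by rewrite nv u1.
  - by rewrite img inE i2 u2.
  - by move=> p; rewrite inE => /orP[/eqP ->|/hh[]].
  move=> p q; rewrite !inE => /orP[/eqP ->|pin] /orP[/eqP ->|qin] /=; rewrite ?i1 //.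
  - by have [_ /negPf -> _] := hh _ qin.
  - by rewrite s1; have [_ /negPf -> _] := hh _ pin.
  by rewrite (negPf (hind _ _ pin qin)).
have sub_sum (I : eqType) (s : seq I) (P : pred I) (F : I -> nat) : \sum_(i <- s | P i) F i <= \sum_(i <- s) F i.
  by rewrite [X in _ <= X](bigID P) leq_addr.
have inc1 x : \sum_(p <- ps | e1 p.1 x) outer2 e2 ps p <= \sum_(p <- hs | e1 p.1 x) #|nbr e2 p.2|.
  rewrite big_cons /= o2v add0n if_same; exact: leq_sum.
have inc2 y : y \notin Yof ps -> \sum_(p <- ps | e2 p.2 y) outer1 e1 ps p <= a * size hs.
  rewrite inY negb_or => /andP[_ /negPf nwy]; rewrite big_cons /= nwy.
  rewrite mulnC -sum1_size big_distrl /=; apply: leq_trans (sub_sum _ _ _ _) _.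
  rewrite big_seq [X in _ <= X]big_seq; apply: leq_sum => p pin; rewrite mul1n.
  by have [_ _ ap] := hh _ pin; exact: leq_trans (o1h p) ap.
pose Sd := \sum_(p <- hs) #|nbr e2 p.2|.
apply: (@reduction_slack ps (Sd + a * size hs)) => //.
- by rewrite /=; lia.
- move=> x _; apply: leq_trans (inc1 x) _; apply: leq_trans (sub_sum _ _ _ _) _; exact: leq_addr.
- by move=> y ny; apply: leq_trans (inc2 y ny) _; exact: leq_addl.
- move=> x; rewrite inX negb_or => /andP[nxv _]; have := ox x nxv; have := inc1 x.
  by rewrite [size ps]/=; move: h5; clear; lia.
- move=> y ny; have := oy y; have := inc2 y ny; rewrite [size ps]/=; move: h5; clear; lia.
rewrite !big_cons o1v o2v muln0 add0n [size ps]/=.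
(* The edges removed with a host and its image pay for one of the a units per edge at the image. The
   remaining (a - 1) * Sd and the slack Sd add up to a * Sd. *)
have hosts : 2 * \sum_(p <- hs) outer1 e1 ps p * outer2 e2 ps p <=
    2 * (a - 1) * Sd + \sum_(p <- hs) (#|nbr e1 p.1| + outer1 e1 ps p)
      + \sum_(p <- hs) (#|nbr e2 p.2| + outer2 e2 ps p).
  rewrite /Sd !big_distrr /= -!big_split /= big_seq [X in _ <= X]big_seq; apply: leq_sum => p pin.
  have [_ _ ap] := hh _ pin; have := o1h p; have := o2h p.
  move: ap; move: (outer1 _ _ _) (outer2 _ _ _) #|nbr e1 p.1| #|nbr e2 p.2| => x y d1 d2 da yd xd.
  case: x xd => [|x] xd; first by rewrite mul0n.
  have : x * y <= (a - 1) * d2 by apply: leq_mul => //; move: da xd; clear; lia.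
  by rewrite mulSn -mulnA; move: yd; clear; lia.
have aS : (a - 1) * Sd + Sd = a * Sd by rewrite addnC -mulSn subn1 prednK.
move: hosts gain; rewrite -/Sd; move: aS; clear.
move: (\sum_(p <- hs) #|nbr e3 p.1|) (\sum_(p <- hs) outer1 _ _ _ * _) => x3 x12.
move: (\sum_(p <- hs) (#|nbr e1 _| + _)) (\sum_(p <- hs) (#|nbr e2 _| + _)) => x1 x2.
rewrite -mulnA; move: (a * Sd) ((a - 1) * Sd) (a * size hs) => y1 y2 y3 /=; lia.
Qed.

End Moves.

(** Greedy choice: each earlier host excludes itself and at most a neighbours. *)
Lemma choose_hosts (T1 T2 : finType) (e1 : rel T1) (a : nat) (G : T2 -> {set T1}) (ys : seq T2) :
  simple_graph e1 -> (forall y x, y \in ys -> x \in G y -> #|nbr e1 x| <= a) ->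
  (forall y, y \in ys -> (a + 1) * size ys <= #|G y|) ->
  exists hs : seq (T1 * T2), [/\ unzip2 hs = ys, uniq (unzip1 hs),
    (forall p, p \in hs -> p.1 \in G p.2) & (forall p q, p \in hs -> q \in hs -> ~~ e1 p.1 q.1)].
Proof.
move=> [s1 i1]; elim: ys => [|y ys IH] dG cG; first by exists [::]; split.
have [|y' yin|hs [hs2 hs1 hsG hsI]] := IH.
- by move=> y' x yin; apply: dG; rewrite inE yin orbT.
- by apply: leq_trans (cG y' _); rewrite ?inE ?yin ?orbT // leq_mul2l /= leqnSn orbT.
have szs : size hs = size ys by rewrite -hs2 size_map.
pose F := \bigcup_(p <- hs) (p.1 |: nbr e1 p.1).
have cF : #|F| <= (a + 1) * size hs.
  apply: (@leq_trans (\sum_(p <- hs) (a + 1))); last by rewrite big_const_seq count_predT iter_addn_0.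
  apply: (@leq_trans (\sum_(p <- hs) #|p.1 |: nbr e1 p.1|)).
    rewrite /F; elim: (hs) => [|p s IHs]; first by rewrite !big_nil cards0.
    rewrite !big_cons; exact: leq_trans (leq_card_setU _ _) (leq_add (leqnn _) IHs).
  rewrite big_seq [X in _ <= X]big_seq; apply: leq_sum => p pin.
  rewrite cardsU1 addnC leq_add ?leq_b1 //; apply: (dG p.2); last exact: hsG.
  by rewrite inE -hs2; apply/orP; right; apply: map_f.
have : 0 < #|G y :\: F|.
  have := cG y (mem_head _ _); have := cardsID F (G y); have := subset_leq_card (subsetIr (G y) F).
  rewrite [size _]/= -szs mulnS; lia.
case/card_gt0P => x; rewrite inE => /andP[nF xG].
have nFp p : p \in hs -> (x != p.1) && ~~ e1 p.1 x.
  move=> pin; rewrite -negb_or; apply: contraNN nF => h.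
  by rewrite /F (big_rem p) //= !inE h.
exists ((x, y) :: hs); split=> /=.
- by rewrite hs2.
- by rewrite hs1 andbT; apply/mapP => -[p pin xE]; have := nFp p pin; rewrite xE eqxx.
- by move=> p; rewrite inE => /orP[/eqP ->|/hsG].
move=> p q; rewrite !inE => /orP[/eqP ->|pin] /orP[/eqP ->|qin] /=; rewrite ?i1 //.
- by rewrite s1; have /andP[] := nFp q qin.
- by have /andP[] := nFp p pin.
exact: hsI.
Qed.

Lemma card_nonnbr (T : finType) (e : rel T) (v : T) : simple_graph e ->
  #|[set x | (x != v) && ~~ e v x]| + #|nbr e v| + 1 = #|T|.
Proof.
move=> [_ i1]; rewrite -(cardsC (v |: nbr e v)) cardsU1 inE i1 /=.
have -> : ~: (v |: nbr e v) = [set x | (x != v) && ~~ e v x] by apply/setP => x; rewrite !inE negb_or.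
lia.
Qed.

Lemma mass_nonnbr (T : finType) (e : rel T) (v : T) : simple_graph e ->
  2 * #|nbr e v| + \sum_(x in [set x | (x != v) && ~~ e v x]) #|nbr e x| <= mass e.
Proof.
move=> [s1 i1].
rewrite /mass [X in _ <= X](bigD1 v) //= [X in _ <= _ + X](bigID (mem (nbr e v))) /= mul2n -addnn.
rewrite -addnA leq_add2l; apply: leq_add.
  rewrite (eq_bigl (mem (nbr e v))).
    rewrite -sum1_card; apply: leq_sum => x; rewrite inE => vx.
    by apply/card_gt0P; exists v; rewrite inE s1.
  by move=> x; rewrite /= inE; case: eqVneq => [->|]; rewrite ?i1.
rewrite [X in X <= _](eq_bigl (fun x => (x != v) && (x \notin nbr e v))) // => x.
by rewrite !inE.
Qed.

(* [B] will consist of the vertices of V2 of total degree above D/20 and of the G3-neighbours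
   of a vertex of least total degree among the non-neighbours of v. *)
Record dominant (n : nat) (T1 T2 : finType) (e1 : rel T1) (e2 : rel T2) (e3 : T1 -> T2 -> bool)
    (v : T1) (B : {set T2}) : Prop := Dominant {
  dm_max : forall x, #|nbr e1 x| + #|nbr e3 x| <= #|nbr e1 v| + #|nbr e3 v|;
  dm_D : n <= 1500 * (#|nbr e1 v| + #|nbr e3 v|);
  dm_pos : forall w, ~~ e3 v w -> 0 < #|nbr e2 w|;
  dm_leaf : forall w u, ~~ e3 v w -> #|nbr e2 w| = 1 -> e2 w u -> u \in B;
  dm_small : forall u, u \notin B ->
    20 * (#|nbr e2 u| + #|nbr (flip e3) u|) <= #|nbr e1 v| + #|nbr e3 v| }.

(** * A vertex of largest total degree *)

Section DominantVertex.

Variables (C n : nat) (T1 T2 : finType) (e1 : rel T1) (e2 : rel T2) (e3 : T1 -> T2 -> bool).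
Variables (Dl D3 : nat).
Hypothesis cr : critical C n e1 e2 e3 Dl D3.
Variable v : T1.

Notation tot x := (#|nbr e1 x| + #|nbr e3 x|).
Notation D := (tot v).
Hypothesis vmax : forall x, tot x <= D.
Hypothesis vbig : n <= 1500 * D.

Lemma dominant_ge : 92 <= D.
Proof. by have := cr_3l cr v; lia. Qed.

Lemma dominant_isolated w : ~~ e3 v w -> 0 < #|nbr e2 w|.
Proof.
move=> nvw; rewrite lt0n; apply/eqP => dw.
have [bg IH np hC hDl _ _] := cr; have [_ _ _ [s2 _] _ _ h3 h4 _ b2 _] := bg.
have D92 := dominant_ge.
have h3v := cr_3l cr v.
apply: np; apply: (reduction_single bg IH nvw (D3' := minn D3 (n - 2))).
- by lia.
- by lia.
- move=> x _; rewrite dw if_same addn0.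
  have : #|nbr e3 x :\ w| <= #|nbr e3 x| by rewrite subset_leq_card ?subsetDl.
  by have := h3 x; have := cr_3l cr x; lia.
- move=> y _; have : e2 w y = false.
    by apply/negP => wy; move/eqP: dw; rewrite cards_eq0 => /eqP/setP/(_ y); rewrite !inE wy.
  move=> ->; rewrite addn0.
  have : #|nbr (flip e3) y :\ v| <= #|nbr (flip e3) y| by rewrite subset_leq_card ?subsetDl.
  by have := h4 y; have := cr_3r cr y; lia.
by rewrite dw muln0; move: D92; clear; lia.
Qed.

Section Companion.

Variable q : T1.
Hypotheses (nqv : q != v) (nvq : ~~ e1 v q).
Hypothesis qmin : forall x, x != v -> ~~ e1 v x -> tot q <= tot x.

Let Q := [set x | (x != v) && ~~ e1 v x].

Lemma card_nonnbr_v : #|Q| + #|nbr e1 v| + 1 = n.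
Proof. by have [c1 _ g1 _ _ _ _ _ _ _ _] := cr_bg cr; rewrite -c1 card_nonnbr. Qed.

Lemma mass_nonnbr_v : 2 * #|nbr e1 v| + \sum_(x in Q) #|nbr e1 x| <= mass e1.
Proof. by have [_ _ g1 _ _ _ _ _ _ _ _] := cr_bg cr; exact: mass_nonnbr. Qed.

Lemma total_degree_nonnbr_v (P : {set T1}) : #|Q :\: P| * tot q <= \sum_(x in Q :\: P) tot x.
Proof.
rewrite -sum_nat_const; apply: leq_sum => x; rewrite !inE => /and3P[_ nxv nvx]; exact: qmin.
Qed.

Lemma mass_nonnbr_split (P : {set T1}) : v \notin P ->
  2 * #|nbr e1 v| + #|nbr e3 v| + #|Q :\: P| * tot q + \sum_(x in P) #|nbr e3 x| <= mass e1 + mass e3.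
Proof.
move=> vP; have := total_degree_nonnbr_v P; rewrite big_split /=.
have : \sum_(x in Q :\: P) #|nbr e1 x| <= \sum_(x in Q) #|nbr e1 x|.
  by rewrite [X in _ <= X](big_setID P) /= leq_addl.
have : #|nbr e3 v| + \sum_(x in P) #|nbr e3 x| + \sum_(x in Q :\: P) #|nbr e3 x| <= mass e3.
  rewrite /mass [X in _ <= X](bigD1 v) //= -addnA leq_add2l.
  rewrite [X in _ <= X](bigID (mem P)) /=; apply: leq_add.
    rewrite [X in X <= _](eq_bigl (fun i => (i != v) && (i \in P))) // => x.
    by case: eqVneq => [->|]; rewrite ?(negPf vP).
  rewrite [X in X <= _]big_mkcond [X in _ <= X]big_mkcond; apply: leq_sum => x _.
  by rewrite !inE; case: (x \in P); case: eqVneq; case: (e1 v x).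
by have := mass_nonnbr_v; clear; lia.
Qed.

(** An overfull row at p would hold almost n pairs besides the row of v, while each other
    non-neighbour of v has total degree at least 1; together this exceeds the budget. *)
Lemma companion_overflow1 u p : 0 < tot q -> e1 q p -> 20 * #|nbr e2 u| <= D ->
  #|nbr e3 p| + #|nbr e2 u| + 3 <= n.
Proof.
move=> k0 qp du; rewrite leqNgt; apply/negP => over.
have [bg _ _ hC _ _ _] := cr; have [_ _ [s1 _] _ h1 _ h3 _ _ _ b3] := bg.
have npv : p != v by apply: contraNneq nvq => <-; rewrite s1.
have vP : v \notin [set p] by rewrite inE eq_sym.
have := mass_nonnbr_split vP; rewrite big_set1.
have rows := row_row_mass e3 npv.
have cQ := card_nonnbr_v; have cQp : #|Q| <= #|Q :\: [set p]| + 1.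
  by rewrite (cardsD1 p Q) addnC leq_add ?leq_b1.
have : #|Q :\: [set p]| <= #|Q :\: [set p]| * tot q by rewrite leq_pmulr.
have h1v := h1 v; have h3p := h3 p; have mp := vmax p; have m2 : 0 <= mass e2 by [].
move: (#|Q :\: [set p]| * _) rows cQ cQp b3 over du hC h1v h3p mp; clear; lia.
Qed.

Lemma companion_overflow2 y : #|nbr (flip e3) y| + tot q + 3 <= n.
Proof.
have [bg _ _ hC hDl _ h3r] := cr; have [_ _ [s1 _] _ h1 _ h3 h4 _ _ b3] := bg.
have hy := h3r y; have [k4|k4] := leqP (tot q) 3; first by lia.
rewrite leqNgt; apply/negP => over.
have v0 : v \notin set0 by rewrite inE.
have := mass_nonnbr_split v0; rewrite big_set0 setD0 addn0.
have rc := row_col_mass e3 v y.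
have cy : #|nbr (flip e3) y| <= #|nbr (flip e3) y :\ v| + 1.
  by rewrite (cardsD1 v (nbr _ _)) addnC leq_add ?leq_b1.
have cQ := card_nonnbr_v; have h1v := h1 v; have h4y := h4 y.
have [k kE] : exists k, tot q = k + 4 by exists (tot q - 4); lia.
rewrite kE mulnDr.
have : k * (199 * 1000) <= #|Q| * k by rewrite mulnC leq_mul2r; apply/orP; right; lia.
move: (#|Q| * k) rc cy cQ h1v h4y kE over b3 hC; clear; lia.
Qed.

(* The rejected placement is v on w and q on u. *)
Lemma companion_leaf w u : ~~ e3 v w -> ~~ e3 q u -> e2 w u -> #|nbr e2 w| = 1 ->
  20 * #|nbr e2 u| <= D -> 4 * tot q * #|nbr e2 u| <= D -> False.
Proof.
move=> nvw nqu wu dw du kdu.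
have [bg _ _ hC hDl h3l h3r] := cr; have [_ _ g1 g2 h1 _ h3 h4 _ _ b3] := bg.
have pp := leaf_pair_valid g1 g2 nqv nvq nvw nqu wu.
have [o1 o1'] := leaf_pair_outer1 g1 w u nvq.
have [o2 o2'] := leaf_pair_outer2 g2 v q wu dw.
have D92 := dominant_ge.
have oq : outer2 e2 [:: (v, w); (q, u)] (q, u) <= #|nbr e2 u| by lia.
apply: (@reduction_slack _ _ _ _ _ _ _ _ _ cr [:: (v, w); (q, u)] (#|nbr e2 u| + tot q)) => //.
- move=> x _; rewrite !big_cons big_nil /= o2 add0n if_same addn0.
  by case: (e1 q x); lia.
- move=> y; rewrite !big_cons big_nil /= o1 o1' addn0 inE /= !inE negb_or => /andP[nyw nyu].
  have -> : e2 w y = false.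
    by rewrite -in_nbr (leaf_pair_nbr wu dw) inE (negPf nyu).
  by case: (e2 u y); lia.
- move=> x _; rewrite !big_cons big_nil /= o2 add0n if_same addn0.
  case: (boolP (e1 q x)) => qx; last by have := h3l x; lia.
  have k0 : 0 < tot q by apply: (leq_trans _ (leq_addr _ _)); apply/card_gt0P; exists x; rewrite inE.
  by have := companion_overflow1 k0 qx du; lia.
- move=> y; rewrite !big_cons big_nil /= o1 o1' addn0 inE /= !inE negb_or => /andP[nyw nyu].
  have -> : e2 w y = false.
    by rewrite -in_nbr (leaf_pair_nbr wu dw) inE (negPf nyu).
  by have := companion_overflow2 y; case: (e2 u y); lia.
rewrite !big_cons !big_nil o1 o1' o2 muln0 [size _]/= !addn0 !add0n /= dw.
have : #|nbr e1 q| * outer2 e2 [:: (v, w); (q, u)] (q, u) <= tot q * #|nbr e2 u|.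
  by apply: leq_mul; rewrite ?leq_addr.
have kq : tot q <= tot q * #|nbr e2 u| by rewrite leq_pmulr //; lia.
rewrite -mulnA in kdu.
move: (tot q * #|nbr e2 u|) (_ * outer2 _ _ _) kq kdu du D92 o2'; clear; lia.
Qed.

(** If q had total degree k + 4, then so would, at least, all n - 1 - deg v non-neighbours of v, at
    least 199000 of them, costing 199000 k beyond what the budget can bear. The charging bound on G2
    loses only 15000 per unit of this degree. *)
Lemma companion_small : tot q <= 3.
Proof.
have [bg _ _ hC hDl h3l h3r] := cr; have [_ c2 g1 g2 h1 _ h3 h4 _ _ b3] := bg.
rewrite leqNgt; apply/negP => k4.
(* Below this threshold [companion_leaf] applies. As h exceeds D/(5 tot q) and n <= 1500 D, the loss
   2n/h of the charging bound is less than 15000 tot q. *)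
pose h := D %/ (5 * tot q) + 1.
have h0 : 0 < h by rewrite /h addn1.
have iso w : w \notin nbr e3 v -> #|nbr e2 w| != 0.
  by rewrite inE => /dominant_isolated; rewrite lt0n.
have charge := @leaf_charge T2 e2 (nbr e3 v) (nbr e3 q) h g2 h0 iso.
have {}charge : 2 * h * n <= (h + 1) * (mass e2 + 2 * #|nbr e3 v| + 2 * #|nbr e3 q|).
  rewrite -c2; apply: charge => w u; rewrite !inE => nvw dw wu nqu.
  rewrite leqNgt; apply/negP => lth; apply: (companion_leaf nvw nqu wu dw).
  - have : 5 * tot q * #|nbr e2 u| <= D.
      by rewrite mulnC -leq_divRL; [move: lth; rewrite /h; lia|lia].
    have : 4 * #|nbr e2 u| <= tot q * #|nbr e2 u| by rewrite leq_mul2r k4 orbT.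
    by rewrite -mulnA; move: (tot q * _) => t; lia.
  have : 5 * tot q * #|nbr e2 u| <= D.
    by rewrite mulnC -leq_divRL; [move: lth; rewrite /h; lia|lia].
  by rewrite -!mulnA; move: (tot q * _) => t; lia.
have hD : D < h * (5 * tot q) by rewrite /h mulnC addn1 mulnC; apply: ltn_ceil; lia.
have X : 2 * n <= mass e2 + 2 * #|nbr e3 v| + 2 * #|nbr e3 q| + 15 * 1000 * tot q.
  move: charge hD vbig; rewrite addn1.
  move: (mass e2 + _ + _) => x; move: (tot q) D => k d ch hd vb.
  rewrite leqNgt; apply/negP => lt.
  have e1' : h.+1 * x + h.+1 * (15 * 1000 * k) < h.+1 * (2 * n) by rewrite -mulnDr ltn_mul2l.
  have e2' : h.+1 * (2 * n) = 2 * h * n + 2 * n by rewrite mulSn -mulnA mulnCA; lia.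
  have e3' : h.+1 * (15 * 1000 * k) = 15 * 1000 * k + 3 * 1000 * (h * (5 * k)) by rewrite mulSn; lia.
  by move: e1' e2' e3' ch hd vb; clear; lia.
have v0 : v \notin set0 by rewrite inE.
have := mass_nonnbr_split v0; rewrite big_set0 setD0 addn0.
have rows := row_row_mass e3 nqv.
have cQ := card_nonnbr_v; have h1v := h1 v; have h3q := h3 q.
have [k kE] : exists k, tot q = k + 4 by exists (tot q - 4); lia.
have : k * (199 * 1000) <= #|Q| * k by rewrite mulnC leq_mul2r; apply/orP; right; lia.
rewrite kE mulnDr; rewrite kE in X.
move: (#|Q| * k) X rows cQ h1v h3q b3 hC; clear; lia.
Qed.

End Companion.

Lemma dominant_exists (b : nat) : 120 * n <= b * D -> exists2 B : {set T2}, dominant n e1 e2 e3 v B & #|B| <= b + 3.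
Proof.
move=> hb; have [bg _ _ hC hDl h3l h3r] := cr; have [c1 c2 g1 g2 h1 _ h3 h4 _ _ b3] := bg.
have [q0 nq0] : exists q, (q != v) && ~~ e1 v q.
  have : 1 < #|~: nbr e1 v| by rewrite cardsCs setCK c1; have := h1 v; lia.
  rewrite (cardD1 v) !inE (proj2 g1) /= ltnS => /card_gt0P[q]; rewrite !inE => /andP[h h'].
  by exists q; rewrite h h'.
case: (@arg_minnP _ q0 (fun q => (q != v) && ~~ e1 v q) (fun x => tot x) nq0) => q /andP[nqv nvq] qmin.
have qmin' x : x != v -> ~~ e1 v x -> tot q <= tot x by move=> h h'; apply: qmin; rewrite h h'.
have k3 := companion_small nqv nvq qmin'.
have D92 := dominant_ge.
pose L := [set u | D < 20 * (#|nbr e2 u| + #|nbr (flip e3) u|)].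
exists (L :|: nbr e3 q).
  split=> //.
  - exact: dominant_isolated.
  - move=> w u nvw dw wu; rewrite !inE -implyNb; apply/implyP; rewrite -leqNgt => small.
    apply/negPn/negP => nqu; apply: (companion_leaf nqv nvq qmin' nvw nqu wu dw).
      by move: small; clear; lia.
    have : 4 * tot q * #|nbr e2 u| <= 12 * #|nbr e2 u| by rewrite leq_mul2r; apply/orP; right; lia.
    by move: small; clear; lia.
  by move=> u; rewrite !inE negb_or -leqNgt => /andP[].
apply: leq_trans (leq_card_setU _ _) _; apply: leq_add; last by lia.
(* Each member of L has 20 times its total degree above D, and the total degrees in V2 sum to at
   most 6n. *)
have : #|L| * D <= b * D.
  apply: leq_trans hb; rewrite -sum_nat_const.
  apply: (@leq_trans (\sum_u 20 * (#|nbr e2 u| + #|nbr (flip e3) u|))).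
    rewrite big_mkcond; apply: leq_sum => u _; case: ifP => //; rewrite inE; exact: ltnW.
  rewrite -big_distrr big_split /=.
  have := mass_flip e3; rewrite /mass /= => ->; rewrite -!/(mass _).
  by move: b3; clear; lia.
by rewrite leq_pmul2r //; lia.
Qed.

End DominantVertex.

(** * Hosts for the neighbours of a light vertex *)

Lemma weighted_sum (T : finType) (e : rel T) (B : {set T}) : symmetric e ->
  \sum_(w in ~: B) (2 * #|nbr e w :&: B| + #|nbr e w :\: B|) <= mass e.
Proof.
move=> se; rewrite -(mass_outside B se) big_split /= addnC leq_add2l -big_distrr /= exchange_card.
rewrite big_distrr /=; apply: leq_sum => p pB; rewrite mul2n -addnn nbr_flip_sym // -setDE.
by rewrite leq_add2r subset_leq_card ?subsetDl.
Qed.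

Lemma card_split (T : finType) (A B : {set T}) : #|A :&: B| + #|A :\: B| = #|A|.
Proof. exact: cardsID. Qed.

Section Hosts.

Variables (C n : nat) (T1 T2 : finType) (e1 : rel T1) (e2 : rel T2) (e3 : T1 -> T2 -> bool).
Variables (Dl D3 : nat).
Hypothesis cr : critical C n e1 e2 e3 Dl D3.

(** In the last hypothesis the second alternative is meant for rows of G3 too full to receive new
    pairs: no candidate host may be adjacent to such an x. *)
Lemma hosted_move (a : nat) (v : T1) (w : T2) (G : T2 -> {set T1}) :
  0 < a <= 3 -> ~~ e3 v w -> #|nbr e2 w| <= 5 ->
  (forall y x, e2 w y -> x \in G y -> [/\ x != v, ~~ e1 v x, ~~ e3 x y & #|nbr e1 x| <= a]) ->
  (forall y, e2 w y -> 100 <= #|G y|) ->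
  a * \sum_(y in nbr e2 w) #|nbr e2 y| + a * #|nbr e2 w| + 3 * #|nbr e2 w|.+1 <= #|nbr e1 v| + #|nbr e3 v| ->
  (forall x, x != v -> #|nbr e3 x| + \sum_(y in nbr e2 w) #|nbr e2 y| + 20 <= n \/
     forall y z, e2 w y -> z \in G y -> ~~ e1 z x) -> False.
Proof.
move=> /andP[a0 a3] nvw dw hG cG gain over.
have [_ _ g1 _ _ _ _ _ _ _ _] := cr_bg cr.
pose ys := enum (nbr e2 w).
have inys y : (y \in ys) = e2 w y by rewrite mem_enum inE.
have szys : size ys = #|nbr e2 w| by rewrite -cardE.
have [|y yin|hs [hs2 hs1 hsG hsI]] := @choose_hosts T1 T2 e1 a G ys g1.
- by move=> y x; rewrite inys => wy xG; have [] := hG _ _ wy xG.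
- rewrite szys; apply: leq_trans (cG y _); last by rewrite -inys.
  apply: (@leq_trans (4 * 5)) => //; apply: leq_mul; [by rewrite addn1|exact: dw].
have sumE : \sum_(p <- hs) #|nbr e2 p.2| = \sum_(y in nbr e2 w) #|nbr e2 y|.
  by rewrite -(big_map snd xpredT (fun y => #|nbr e2 y|)) -/(unzip2 hs) hs2 big_enum.
have szhs : size hs = #|nbr e2 w| by rewrite -szys -hs2 size_map.
have inw p : p \in hs -> e2 w p.2 by move=> pin; rewrite -inys -hs2 map_f.
apply: (@host_move _ _ _ _ _ _ _ _ _ cr a v w hs) => //.
- by move=> y; rewrite hs2 inys inE.
- by rewrite hs2 enum_uniq.
- by apply/mapP => -[p pin vE]; have [] := hG _ _ (inw _ pin) (hsG _ pin); rewrite vE eqxx.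
- by move=> p pin; have [] := hG _ _ (inw _ pin) (hsG _ pin).
- by rewrite szhs; lia.
- by rewrite sumE szhs.
- move=> x nxv; have [le|none] := over x nxv.
    apply: leq_trans le; rewrite leq_add2r leq_add2l -sumE.
    by rewrite [X in _ <= X](bigID (fun p => e1 p.1 x)) leq_addr.
  rewrite big1_seq ?addn0; first by have := cr_3l cr x; lia.
  by move=> p /andP[px pin]; have := none _ _ (inw _ pin) (hsG _ pin); rewrite px.
move=> y; have := cr_3r cr y; rewrite szhs.
by have := leq_mul a3 dw; lia.
Qed.

Variables (v : T1) (B : {set T2}).
Hypothesis dm : dominant n e1 e2 e3 v B.
Hypothesis smallB : #|B| <= 180 * 1000 + 3.

Notation D := (#|nbr e1 v| + #|nbr e3 v|).

(** The limit of [leaf_charge] for large h: leaves outside the row of v hang only on B, and h = 2n +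
    1 is large enough for the fraction to round away. *)
Lemma dominant_mass : 2 * n <= mass e2 + 2 * #|nbr e3 v| + 2 * #|B|.
Proof.
have [_ c2 _ g2 _ _ _ _ _ _ _] := cr_bg cr.
have iso w : w \notin nbr e3 v -> #|nbr e2 w| != 0.
  by rewrite inE -lt0n; exact: (dm_pos dm).
have noleaf w u : w \notin nbr e3 v -> #|nbr e2 w| = 1 -> e2 w u -> u \notin B -> 2 * n + 1 <= #|nbr e2 u|.
  by rewrite inE => nvw dw wu nuB; move: (dm_leaf dm nvw dw wu); rewrite (negPf nuB).
have h0 : 0 < 2 * n + 1 by rewrite addn1.
have := leaf_charge g2 h0 iso noleaf; rewrite c2.
by move: (mass e2 + _ + _) => X; clear; nia.
Qed.

Lemma many_hosts (z : T1) (y : T2) :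
  100 <= #|[set x | [&& x != z, ~~ e1 z x, ~~ e3 x y & #|nbr e1 x| + #|nbr e3 x| <= 3]]|.
Proof.
have [c1 _ g1 _ h1 _ h3 h4 _ _ b3] := cr_bg cr.
set G := [set _ | _]; pose R := [set x | (x != z) && ~~ e1 z x].
rewrite leqNgt; apply/negP => few.
have cR : #|R| + #|nbr e1 z| + 1 = n by rewrite -c1 card_nonnbr.
have sR : 2 * #|nbr e1 z| + \sum_(x in R) #|nbr e1 x| <= mass e1 := mass_nonnbr z g1.
have rc := row_col_mass e3 v y.
have cy : #|nbr (flip e3) y| <= #|nbr (flip e3) y :\ v| + 1.
  by rewrite (cardsD1 v (nbr _ _)) addnC leq_add ?leq_b1.
have cnt k (S : {set T1}) : \sum_x (x \in S) * k = #|S| * k.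
  rewrite -sum_nat_const [RHS]big_mkcond; apply: eq_bigr => x _.
  by case: (x \in S); rewrite ?mul1n.
(* Each non-neighbour of z claims 4 units. If it is not a host, it has total degree at least 4, or
   it lies in the column of y and has one pair of its own and 3 extra units; v is treated apart so
   that its whole row counts on the left. *)
have : \sum_x ((x \in R) * 4 + (x == v) * #|nbr e3 v|) <=
   \sum_x ((x \in R) * #|nbr e1 x| + #|nbr e3 x| + (x \in G) * 4 + (x \in nbr (flip e3) y) * 3 + (x \in [set v]) * 4).
  apply: leq_sum => x _; rewrite [x \in [set v]]inE.
  case: (eqVneq x v) => [->|nxv]; first by case: (v \in R); lia.
  rewrite mul0n addn0; case: (boolP (x \in R)) => //; rewrite inE => /andP[nxz nzx].
  case: (boolP (x \in nbr (flip e3) y)) => yx.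
    suff : 0 < #|nbr e3 x| by lia.
    by apply/card_gt0P; exists y; rewrite inE; rewrite inE in yx.
  case: (boolP (x \in G)) => xG; first by lia.
  have : 3 < #|nbr e1 x| + #|nbr e3 x|.
    by rewrite ltnNge; apply: contraNN xG => le; rewrite inE nxz nzx le andbT; rewrite inE in yx.
  by lia.
rewrite !big_split /= !cnt cards1.
have -> : \sum_x (x == v) * #|nbr e3 v| = #|nbr e3 v|.
  by rewrite (bigD1 v) //= eqxx mul1n big1 ?addn0 // => x /negPf ->.
have -> : \sum_x (x \in R) * #|nbr e1 x| = \sum_(x in R) #|nbr e1 x|.
  by rewrite [RHS]big_mkcond; apply: eq_bigr => x _; case: (x \in R); rewrite ?mul1n.
have dmm := dominant_mass; have hC := cr_C cr.
have h1z := h1 z; have h4y := h4 y; have h3v := h3 v.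
rewrite -/(mass e3).
by move: cR sR rc cy dmm few b3 hC h1z h4y h3v smallB; clear; lia.
Qed.

Lemma light_vertex (k : nat) : k * (#|nbr e3 v| + #|B|) + mass e2 < k * n ->
  exists w, [/\ ~~ e3 v w, w \notin B & 2 * #|nbr e2 w :&: B| + #|nbr e2 w :\: B| < k].
Proof.
have [_ c2 _ [s2 _] _ _ _ _ _ _ _] := cr_bg cr.
move=> lt; have [/existsP[w /and3P[? ? ?]]|none] := boolP [exists w, [&& ~~ e3 v w, w \notin B &
    2 * #|nbr e2 w :&: B| + #|nbr e2 w :\: B| < k]]; first by exists w.
have big_w w : w \in ~: (nbr e3 v :|: B) -> k <= 2 * #|nbr e2 w :&: B| + #|nbr e2 w :\: B|.
  rewrite !inE negb_or => /andP[nvw nwB]; rewrite leqNgt; apply: contraNN none => h.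
  by apply/existsP; exists w; rewrite nvw nwB h.
have : \sum_(w in ~: (nbr e3 v :|: B)) k <= mass e2.
  apply: leq_trans (weighted_sum B s2).
  apply: (@leq_trans (\sum_(w in ~: (nbr e3 v :|: B)) (2 * #|nbr e2 w :&: B| + #|nbr e2 w :\: B|))).
    exact: leq_sum.
  rewrite [X in X <= _]big_mkcond [X in _ <= X]big_mkcond; apply: leq_sum => w _.
  by rewrite !inE negb_or; case: (e3 v w); case: (w \in B).
have cU : n <= #|~: (nbr e3 v :|: B)| + #|nbr e3 v| + #|B|.
  by rewrite -c2 -(cardsC (nbr e3 v :|: B)); have := (leq_card_setU (nbr e3 v) B).1; lia.
rewrite sum_nat_const mulnC => le; have := leq_mul (leqnn k) cU.
by rewrite !mulnDr; move: lt le; rewrite mulnDr; lia.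
Qed.

(** If the average fails for 6, then mass e2 is at least 6n - 6(d + #|B|) with d the G3-degree of v.
    The budget then gives the hypothesis of [heavy_list_packs], as 2C exceeds 6 #|B|. *)
Lemma light_vertex_below6 : #|B| <= 30 * 1000 + 3 ->
  exists w, [/\ ~~ e3 v w, w \notin B & 2 * #|nbr e2 w :&: B| + #|nbr e2 w :\: B| < 6].
Proof.
move=> smallB'; apply: light_vertex; rewrite ltnNge; apply/negP => le.
have [bg IH np hC _ _ _] := cr; have [_ _ _ _ _ _ h3 _ _ _ b3] := bg.
apply: np; apply: (heavy_list_packs bg IH (v := v)).
by have := h3 v; move: le b3 hC smallB'; clear; lia.
Qed.

(** With G1-degree below 0.24 D, v goes on w without hosts: at most 0.72 D new pairs and a growth of
    0.24 D of the degree bound stay below D. Otherwise hosts of degree at most 3 cost about 3 * 0.23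
    D, and the large G1-degree of v leaves no room in the budget for an overfull row. *)
Lemma low_vertex (w : T2) : ~~ e3 v w -> #|nbr e2 w| <= 3 ->
  100 * \sum_(y in nbr e2 w) #|nbr e2 y| <= 23 * D ->
  (forall y, 100 * #|nbr e1 v| < 24 * D -> e2 w y -> #|nbr (flip e3) y| + #|nbr e1 v| + 20 <= n) -> False.
Proof.
move=> nvw dw sw over.
have [bg IH np hC hDl h3l h3r] := cr; have [_ _ g1 [s2 _] h1 _ h3 h4 _ _ b3] := bg.
have D92 : 92 <= D := dominant_ge cr (dm_D dm).
have [lt|ge] := ltnP (100 * #|nbr e1 v|) (24 * D).
  apply: np; apply: (reduction_single bg IH nvw (D3' := minn (D3 + maxn #|nbr e1 v| 3) (n - 2))).
  - by lia.
  - by have := h3r w; lia.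
  - move=> x _; have : #|nbr e3 x :\ w| <= #|nbr e3 x| by rewrite subset_leq_card ?subsetDl.
    by have := h3 x; have := h3l x; case: (e1 v x); lia.
  - move=> y _; have : #|nbr (flip e3) y :\ v| <= #|nbr (flip e3) y| by rewrite subset_leq_card ?subsetDl.
    have := h4 y; have := h3r y; case: (boolP (e2 w y)) => wy; last by lia.
    by have := over y lt wy; lia.
  have : #|nbr e1 v| * #|nbr e2 w| <= #|nbr e1 v| * 3 by rewrite leq_mul2l dw orbT.
  by move: (_ * #|nbr e2 w|) lt D92; clear; lia.
pose G y := [set x | [&& x != v, ~~ e1 v x, ~~ e3 x y & #|nbr e1 x| + #|nbr e3 x| <= 3]].
apply: (@hosted_move 3 v w G) => //.
- exact: leq_trans dw _.
- by move=> y x _; rewrite inE => /and4P[-> -> -> h]; split=> //; apply: leq_trans h; apply: leq_addr.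
- by move=> y _; exact: many_hosts.
- by move: dw sw D92; move: (\sum_(_ in _) _) => s; clear; lia.
move=> x nxv; left; rewrite leqNgt; apply/negP => lt.
have mx := dm_max dm x; have rows := row_row_mass e3 nxv.
have h1v := h1 v; have h3x := h3 x; have dmm := dominant_mass.
have m1 : 2 * #|nbr e1 v| <= mass e1 by apply: leq_trans (mass_nonnbr v g1); apply: leq_addr.
move: (\sum_(_ in _) _) sw ge lt mx rows h1v h3x dmm m1 b3 hC smallB; clear; lia.
Qed.

End Hosts.

(** * Large vertices on one side only *)

Section Unbalanced.

Variables (C n : nat) (T1 T2 : finType) (e1 : rel T1) (e2 : rel T2) (e3 : T1 -> T2 -> bool).
Variables (Dl D3 : nat).
Hypothesis cr : critical C n e1 e2 e3 Dl D3.
Variables (v : T1) (B : {set T2}).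
Hypothesis dm : dominant n e1 e2 e3 v B.
Hypothesis smallB : #|B| <= 30 * 1000 + 3.
Notation D := (#|nbr e1 v| + #|nbr e3 v|).
Hypothesis lopsided : forall y, 6 * (#|nbr e2 y| + #|nbr (flip e3) y|) < D.

Lemma nbr_degree_sum w :
  60 * \sum_(y in nbr e2 w) #|nbr e2 y| <= (10 * #|nbr e2 w :&: B| + 3 * #|nbr e2 w :\: B|) * D.
Proof.
rewrite (big_setID B) /= mulnDr mulnDl; apply: leq_add.
  rewrite -mulnA -sum_nat_const !big_distrr /=; apply: leq_sum => y _.
  by have := lopsided y; clear; lia.
rewrite -mulnA -sum_nat_const !big_distrr /=; apply: leq_sum => y; rewrite inE => /andP[nyB _].
by have := dm_small dm nyB; clear; lia.
Qed.

(* The vertices whose degree in G3 could overflow when up to 2D/5 edges are added. *)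
Let P := [set p | (p != v) && (5 * n < 5 * #|nbr e3 p| + 2 * D + 100)].

Lemma card_giants : #|P| <= 15.
Proof.
have [bg IH np hC hDl h3l h3r] := cr; have [_ _ _ _ h1 _ h3 h4 _ _ b3] := bg.
have n0 : 0 < n by lia.
have : #|P| * n <= 15 * n.
  (* D is below 2n by more than 50, so each member of P has at least n/5 pairs, and mass e3 <=
     3n. *)
  apply: (@leq_trans (5 * mass e3)); last by move: b3; clear; lia.
  rewrite -sum_nat_const /mass big_distrr /= [X in X <= _]big_mkcond; apply: leq_sum => p _.
  case: ifP => //; rewrite inE => /andP[_].
  by have := h1 v; have := h3l v; move: hDl; clear; lia.
by rewrite leq_pmul2r.
Qed.

Let G y := [set x | [&& x != v, ~~ e1 v x, ~~ e3 x y, #|nbr e1 x| <= 1 & nbr e1 x :&: P == set0]].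

Lemma giant_free_hosts y :
  2 * n <= mass e1 + 2 * #|G y| + 2 * #|nbr (flip e3) y| + 2 * #|P| + 2.
Proof.
have [c1 _ g1 _ _ _ _ _ _ _ _] := cr_bg cr; have [s1 i1] := g1.
pose R := [set x | (x != v) && ~~ e1 v x].
pose L := [set x in R | (#|nbr e1 x| <= 1) && (nbr e1 x :&: P != set0)].
have cR : #|R| + #|nbr e1 v| + 1 = n by rewrite -c1 card_nonnbr.
have cL : #|L| <= \sum_(p in P) #|nbr e1 p :&: L|.
  rewrite -[#|L|]sum1_card.
  apply: (@leq_trans (\sum_(x in L) #|nbr e1 x :&: P|)).
    by apply: leq_sum => x; rewrite !inE => /and3P[_ _]; rewrite -card_gt0.
  by rewrite exchange_card; apply: leq_sum => p _; rewrite nbr_flip_sym.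
have cnt k (S : {set T1}) : \sum_x (x \in S) * k = #|S| * k.
  rewrite -sum_nat_const [RHS]big_mkcond; apply: eq_bigr => x _.
  by case: (x \in S); rewrite ?mul1n.
(* Every non-neighbour of v claims 2 units. A leaf at a vertex of P pays only one by its degree; the
   other, counted by L, is recovered from the edge at P. *)
have : \sum_x ((x == v) * #|nbr e1 v| + (x \in nbr e1 v) * 1 + (x \in P) * #|nbr e1 x :&: L| + (x \in R) * 2)
    <= \sum_x (#|nbr e1 x| + (x \in G y) * 2 + (x \in nbr (flip e3) y) * 2 + (x \in P) * 2 + (x \in L) * 1).
  apply: leq_sum => x _.
  have dL : #|nbr e1 x :&: L| <= #|nbr e1 x| by rewrite subset_leq_card ?subsetIl.
  case: (eqVneq x v) => [->|nxv].
    by rewrite !inE i1 eqxx /= mul1n; lia.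
  rewrite mul0n add0n.
  case: (boolP (e1 v x)) => vx.
    have -> : x \in nbr e1 v by rewrite inE.
    have -> : x \in R = false by rewrite inE vx andbF.
    case: (boolP (x \in P)) => xP; last first.
      suff : 0 < #|nbr e1 x| by lia.
      by apply/card_gt0P; exists v; rewrite inE s1.
    by lia.
  have -> : x \in nbr e1 v = false by rewrite inE (negPf vx).
  have xR : x \in R by rewrite inE nxv vx.
  rewrite xR; case: (boolP (x \in L)) => xL.
    have : 0 < #|nbr e1 x|.
      move: xL; rewrite !inE => /and3P[_ _] /set0Pn[p]; rewrite !inE => /andP[xp _].
      by apply/card_gt0P; exists p; rewrite inE.
    by case: (x \in P); lia.
  case: (boolP (x \in P)) => xP; first by lia.
  case: (boolP (x \in nbr (flip e3) y)) => yx; first by lia.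
  case: (boolP (x \in G y)) => xG; first by lia.
  suff : 1 < #|nbr e1 x| by lia.
  rewrite ltnNge; apply: contraNN xG => le; rewrite inE nxv vx le /=.
  rewrite inE in yx; rewrite yx /=.
  by move: xL; rewrite inE xR le /= negbK.
rewrite !big_split /= !cnt.
have -> : \sum_x (x == v) * #|nbr e1 v| = #|nbr e1 v|.
  by rewrite (bigD1 v) //= eqxx mul1n big1 ?addn0 // => x /negPf ->.
have -> : \sum_x (x \in P) * #|nbr e1 x :&: L| = \sum_(p in P) #|nbr e1 p :&: L|.
  by rewrite [RHS]big_mkcond; apply: eq_bigr => x _; case: (x \in P); rewrite ?mul1n.
by rewrite -/(mass e1); move: cL cR; clear; lia.
Qed.

(** Neighbours of w in B count at most D/6 and the others D/20. A weight below 4 gives at most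
    13D/60 < 0.23 D, enough for [low_vertex]. If such a vertex is not guaranteed, G2 and the row of
    v consume so much that G1 is sparse and has many hosts of degree at most 1. With a = 1, a weight
    below 6 suffices: at most 23D/60, less than the 2D/5 in the definition of P. *)
Lemma unbalanced_case : False.
Proof.
have [bg IH np hC hDl h3l h3r] := cr; have [_ _ g1 _ h1 _ h3 h4 _ _ b3] := bg.
have D92 : 92 <= D := dominant_ge cr (dm_D dm).
have smallB' : #|B| <= 180 * 1000 + 3 by apply: leq_trans smallB _; lia.
have h1v := h1 v; have h3v := h3 v.
have [lt|ge] := ltnP (4 * (#|nbr e3 v| + #|B|) + mass e2) (4 * n).
  have [w [nvw nwB tw]] := light_vertex cr smallB' lt.
  have ds := nbr_degree_sum w.
  apply: (low_vertex cr dm smallB' nvw).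
  - by have := card_split (nbr e2 w) B; move: tw; clear; lia.
  - have : (10 * #|nbr e2 w :&: B| + 3 * #|nbr e2 w :\: B|) * D <= 13 * D.
      by rewrite leq_mul2r; apply/orP; right; move: tw; clear; lia.
    by move: ds; clear; lia.
  move=> y l24 wy; have := lopsided y; have := h1 v; have := h3l v.
  by move: l24 hDl; clear; lia.
have [w [nvw nwB tw]] := light_vertex_below6 cr v smallB' smallB.
have dw := card_split (nbr e2 w) B.
have ds : 60 * \sum_(y in nbr e2 w) #|nbr e2 y| <= 23 * D.
  apply: leq_trans (nbr_degree_sum w) _; rewrite leq_mul2r; apply/orP; right.
  by move: tw; clear; lia.
apply: (@hosted_move _ _ _ _ _ _ _ _ _ cr 1 v w G) => //.
- by move: dw tw; clear; lia.
- by move=> y x wy; rewrite inE => /and5P[-> -> -> -> _].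
- move=> y wy; rewrite leqNgt; apply/negP => few.
  have hosts := giant_free_hosts y; have cP := card_giants.
  have rc := row_col_mass e3 v y.
  have cy : #|nbr (flip e3) y| <= #|nbr (flip e3) y :\ v| + 1.
    by rewrite (cardsD1 v (nbr _ _)) addnC leq_add ?leq_b1.
  move: hosts cP rc cy few b3 hC ge smallB h3v; clear; lia.
- by move: ds tw dw D92; move: (\sum_(_ in _) _) => s; clear; lia.
move=> x nxv; case: (boolP (x \in P)) => xP.
  right=> y z wy; rewrite inE => /and5P[_ _ _ _ /eqP zP]; apply/negP => zx.
  by move/setP: zP => /(_ x); rewrite in_setI xP inE zx in_set0.
left; move: xP; rewrite inE nxv /= -leqNgt.
by move: ds; move: (\sum_(_ in _) _) => s; clear; lia.
Qed.

End Unbalanced.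

(** * Large vertices on both sides *)

(** An edge between a small and a large vertex gives both its units of the doubled count to the
    small end; this is why the weights of all small vertices fit into the budget. *)
Definition weight (T T' : finType) (e : rel T) (r : T -> T' -> bool) (B : {set T}) (B' : {set T'}) (x : T) :=
  2 * #|nbr e x :&: B| + #|nbr e x :\: B| + (2 * #|nbr r x :&: B'| + #|nbr r x :\: B'|).

Lemma weight_total (T1 T2 : finType) (e1 : rel T1) (e2 : rel T2) (e3 : T1 -> T2 -> bool)
    (B1 : {set T1}) (B2 : {set T2}) : symmetric e1 -> symmetric e2 ->
  \sum_(x in ~: B1) weight e1 e3 B1 B2 x + \sum_(y in ~: B2) weight e2 (flip e3) B2 B1 y
    <= mass e1 + mass e2 + 2 * mass e3.
Proof.
move=> s1 s2; rewrite /weight !big_split /=.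
have := weighted_sum B1 s1; have := weighted_sum B2 s2.
have := bip_mass_outside e3 B1 B2.
have x1 : \sum_(x in ~: B1) #|nbr e3 x :&: B2| = \sum_(q in B2) #|nbr (flip e3) q :\: B1|.
  by rewrite exchange_card; apply: eq_bigr => q _; rewrite setDE.
have x2 : \sum_(y in ~: B2) #|nbr (flip e3) y :&: B1| <= \sum_(p in B1) #|nbr e3 p|.
  by rewrite exchange_card; apply: leq_sum => p _; rewrite subset_leq_card ?subsetIl.
have x3 : \sum_(y in ~: B2) #|nbr (flip e3) y :\: B1| = \sum_(x in ~: B1) #|nbr e3 x :\: B2|.
  transitivity (\sum_(y in ~: B2) #|nbr (flip e3) y :&: ~: B1|); first by apply: eq_bigr => y _; rewrite setDE.
  by rewrite exchange_card; apply: eq_bigr => x _; rewrite setDE.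
rewrite !big_split /= !big1_eq x1 x3; move: x2.
clear; lia.
Qed.

(** The 557 is 139425/250 rounded down, where 139425 = 418275/3 bounds n from below. *)
Record balanced n (T1 T2 : finType) (e1 : rel T1) (e2 : rel T2) (e3 : T1 -> T2 -> bool)
    (v : T1) (y : T2) (B1 : {set T1}) (B2 : {set T2}) : Prop := Balanced {
  bl_dm1 : dominant n e1 e2 e3 v B2;
  bl_dm2 : dominant n e2 e1 (flip e3) y B1;
  bl_le1 : #|nbr e1 v| + #|nbr e3 v| <= 6 * (#|nbr e2 y| + #|nbr (flip e3) y|);
  bl_le2 : #|nbr e2 y| + #|nbr (flip e3) y| <= 6 * (#|nbr e1 v| + #|nbr e3 v|);
  bl_sum : 557 <= #|nbr e1 v| + #|nbr e3 v| + (#|nbr e2 y| + #|nbr (flip e3) y|);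
  bl_B1 : #|B1| <= 180 * 1000 + 3;
  bl_B2 : #|B2| <= 180 * 1000 + 3;
  bl_B : #|B1| + #|B2| <= 210 * 1000 + 6 }.

Lemma balanced_flip n (T1 T2 : finType) (e1 : rel T1) (e2 : rel T2) e3 v y B1 B2 :
  balanced n e1 e2 e3 v y B1 B2 -> balanced n e2 e1 (flip e3) y v B2 B1.
Proof. by case=> *; split=> //; rewrite addnC. Qed.

Lemma hub_in_big n (T1 T2 : finType) (e1 : rel T1) (e2 : rel T2) e3 v y B1 B2 :
  balanced n e1 e2 e3 v y B1 B2 -> v \in B1.
Proof.
case=> _ dm2 le1 le2 sm _ _ _; apply/negPn/negP => /(dm_small dm2).
rewrite -[#|nbr (flip (flip e3)) v|]/(#|nbr e3 v|); move: le1 le2 sm; clear; lia.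
Qed.

Lemma weight_ge2 n (T1 T2 : finType) (e1 : rel T1) (e2 : rel T2) e3 v y B1 B2 w :
  balanced n e1 e2 e3 v y B1 B2 -> 2 <= weight e2 (flip e3) B2 B1 w.
Proof.
move=> bl; have vB := hub_in_big bl; have dm := bl_dm1 bl; rewrite /weight.
case: (boolP (e3 v w)) => vw.
  have : 0 < #|nbr (flip e3) w :&: B1| by apply/card_gt0P; exists v; rewrite !inE vB andbT.
  by clear; lia.
have := dm_pos dm vw; have := card_split (nbr e2 w) B2.
have [w1|] := eqVneq #|nbr e2 w| 1; last by clear; lia.
have : 0 < #|nbr e2 w| by rewrite w1.
case/card_gt0P => u; rewrite inE => wu.
have : 0 < #|nbr e2 w :&: B2| by apply/card_gt0P; exists u; rewrite !inE wu (dm_leaf dm vw w1 wu).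
by clear; lia.
Qed.

Section Counts.

Variables (C n : nat) (T1 T2 : finType) (e1 : rel T1) (e2 : rel T2) (e3 : T1 -> T2 -> bool).
Variables (Dl D3 : nat).
Hypothesis cr : critical C n e1 e2 e3 Dl D3.
Variables (v : T1) (y : T2) (B1 : {set T1}) (B2 : {set T2}).
Hypothesis bl : balanced n e1 e2 e3 v y B1 B2.

Notation t1 := (weight e1 e3 B1 B2).
Notation t2 := (weight e2 (flip e3) B2 B1).
Notation Dv := (#|nbr e1 v| + #|nbr e3 v|).
Notation Dy := (#|nbr e2 y| + #|nbr (flip e3) y|).

Let ge1 x : 2 <= t1 x. Proof. exact: (weight_ge2 x (balanced_flip bl)). Qed.
Let ge2 w : 2 <= t2 w. Proof. exact: (weight_ge2 w bl). Qed.

Lemma sum_threshold (T : finType) (B : {set T}) (t : T -> nat) (k : nat) :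
  k * #|~: B| <= \sum_(x in ~: B) t x + \sum_(x in ~: B) (k - t x).
Proof. by rewrite mulnC -sum_nat_const -big_split; apply: leq_sum => x _ /=; lia. Qed.

Lemma sum_deficit (T : finType) (B : {set T}) (t : T -> nat) (k : nat) : (forall x, 2 <= t x) ->
  \sum_(x in ~: B) (k - t x) <= (k - 2) * #|[set x in ~: B | t x < k]|.
Proof.
move=> t2; rewrite mulnC -sum_nat_const big_mkcond [X in _ <= X]big_mkcond; apply: leq_sum => x _.
rewrite [x \in [set _ | _]]inE; case: (x \in ~: B) => //=; case: ltnP => h; last by lia.
by have := t2 x; lia.
Qed.

(** Weights are at least 2, so a vertex below the threshold k misses at most k - 2. The pair (2,2)
    bounds the degrees, (2,4) yields many vertices of weight below 4 in V2, and (3,3) yields many of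
    weight 2 on one side. *)
Lemma threshold_count k1 k2 : 2 <= k1 -> 2 <= k2 ->
  (k1 + k2) * n + 2 * (Dl + D3) + 2 * C <=
   6 * n + k1 * #|B1| + k2 * #|B2| + (k1 - 2) * #|[set x in ~: B1 | t1 x < k1]|
     + (k2 - 2) * #|[set x in ~: B2 | t2 x < k2]|.
Proof.
move=> k12 k22; have [c1 c2 [s1 _] [s2 _] _ _ _ _ _ _ b3] := cr_bg cr.
have cB1 : k1 * #|B1| + k1 * #|~: B1| = k1 * n by rewrite -mulnDr cardsC c1.
have cB2 : k2 * #|B2| + k2 * #|~: B2| = k2 * n by rewrite -mulnDr cardsC c2.
have := sum_threshold B1 t1 k1; have := sum_threshold B2 t2 k2.
have := sum_deficit B1 k1 ge1; have := sum_deficit B2 k2 ge2.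
have := weight_total e3 B1 B2 s1 s2.
rewrite mulnDl; move: b3 cB1 cB2; clear; lia.
Qed.

Lemma max_degrees_bound : Dl + D3 + C <= n + #|B1| + #|B2|.
Proof. by have := threshold_count (leqnn 2) (leqnn 2); rewrite subnn !mul0n; clear; lia. Qed.

Lemma max_degrees_bound' : Dl + D3 + 200 * 1000 <= n.
Proof. by have := max_degrees_bound; move: (bl_B bl) (cr_C cr); clear; lia. Qed.

Definition singles := [set w in ~: B2 | t2 w < 4].

Lemma card_singles : Dl + D3 + C <= #|singles| + #|B1| + 2 * #|B2|.
Proof. by have := @threshold_count 2 4 isT isT; rewrite subnn mul0n -/singles; clear; lia. Qed.

Lemma pure_large : Dl + D3 < #|[set x in ~: B1 | t1 x < 3]| \/ Dl + D3 < #|[set x in ~: B2 | t2 x < 3]|.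
Proof.
have := @threshold_count 3 3 isT isT; rewrite !mul1n.
move: (bl_B bl) (cr_C cr) => h1 h2 h3; apply/orP; move: h1 h2 h3; clear.
by case: ltnP => //= ; lia.
Qed.

(** By [low_vertex] the neighbours of w have degree sum above 0.23 Dv. Small ones contribute at most
    0.05 Dv each, so some neighbour is large; weight below 4 permits only one such and at most one
    small neighbour, which leaves 0.18 Dv to z. *)
Lemma single_structure w : w \in singles -> ~~ e3 v w ->
  exists z, [/\ nbr e2 w :&: B2 = [set z], 18 * Dv <= 100 * #|nbr e2 z|,
    #|nbr e2 w :\: B2| <= 1, nbr (flip e3) w :&: B1 = set0 &
    t2 w < 3 -> nbr e2 w = [set z] /\ nbr (flip e3) w = set0].
Proof.
rewrite !inE => /andP[nwB tw] nvw.
have [_ _ _ _ h1 _ _ h4 _ _ _] := cr_bg cr.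
have dw := card_split (nbr e2 w) B2.
have D92 : 92 <= Dv := dominant_ge cr (dm_D (bl_dm1 bl)).
have Sbig : 23 * Dv < 100 * \sum_(u in nbr e2 w) #|nbr e2 u|.
  rewrite ltnNge; apply/negP => le; apply: (low_vertex cr (bl_dm1 bl) (bl_B2 bl) nvw _ le).
    by move: tw dw; rewrite /weight; clear; lia.
  by move=> u _ _; have := h1 v; have := h4 u; move: max_degrees_bound'; clear; lia.
have Sout : 20 * \sum_(u in nbr e2 w :\: B2) #|nbr e2 u| <= #|nbr e2 w :\: B2| * Dv.
  rewrite -sum_nat_const big_distrr /=; apply: leq_sum => u; rewrite inE => /andP[nuB _].
  by have := dm_small (bl_dm1 bl) nuB; clear; lia.
move: Sbig; rewrite (big_setID B2) /= => Sbig.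
have c1 : #|nbr e2 w :&: B2| = 1.
  have : 0 < #|nbr e2 w :&: B2|.
    rewrite lt0n; apply/negP => /eqP c0; move: Sbig.
    move: c0 => /eqP; rewrite cards_eq0 => /eqP c0; rewrite c0 big_set0 add0n => Sbig.
    have : #|nbr e2 w :\: B2| * Dv <= 3 * Dv.
      by rewrite leq_mul2r; apply/orP; right; move: tw; rewrite /weight; clear; lia.
    by move: Sbig Sout D92; clear; lia.
  by move: tw; rewrite /weight; clear; lia.
have d1 : #|nbr e2 w :\: B2| <= 1 by move: tw; rewrite /weight c1; clear; lia.
have /eqP/cards1P[z zE] := c1; exists z; split=> //.
- move: Sbig; rewrite zE big_set1 => Sbig.
  have : #|nbr e2 w :\: B2| * Dv <= 1 * Dv by rewrite leq_mul2r d1 orbT.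
  by move: Sbig Sout; clear; lia.
- by apply/eqP; rewrite -cards_eq0; move: tw; rewrite /weight c1; clear; lia.
rewrite /weight c1 => t3.
have d0 : nbr e2 w :\: B2 = set0 by apply/eqP; rewrite -cards_eq0; move: t3; clear; lia.
split; first by rewrite -(setID (nbr e2 w) B2) zE d0 setU0.
apply/eqP; rewrite -cards_eq0 -(card_split (nbr (flip e3) w) B1); move: t3; clear; lia.
Qed.

Lemma card_outside (S : {set T2}) : #|S| <= #|S :\: nbr e3 v| + D3.
Proof.
have [_ _ _ _ _ _ h3 _ _ _ _] := cr_bg cr.
rewrite -(card_split S (nbr e3 v)) addnC leq_add2l; apply: leq_trans (h3 v).
by rewrite subset_leq_card ?subsetIr.
Qed.

Lemma pure_pair : Dl + D3 < #|[set x in ~: B2 | t2 x < 3]| ->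
  exists w w' z z', [/\ nbr e2 w = [set z], nbr e2 w' = [set z'], z != z',
    nbr (flip e3) w = set0 /\ nbr (flip e3) w' = set0 &
    [/\ w \notin B2, w' \notin B2, z \in B2, z' \in B2 &
     18 * Dv <= 100 * #|nbr e2 z| /\ 18 * Dv <= 100 * #|nbr e2 z'|]].
Proof.
have [_ _ _ [s2 _] _ h2 _ _ _ _ _] := cr_bg cr.
set S := [set _ in _ | _] => large.
have str w : w \in S :\: nbr e3 v -> exists z, [/\ nbr e2 w = [set z], nbr (flip e3) w = set0,
    w \notin B2, z \in B2 & 18 * Dv <= 100 * #|nbr e2 z|].
  rewrite !inE => /and3P[nvw nwB tw]; have ws : w \in singles by rewrite !inE nwB ltnW.
  have [z [zE zd _ _ /(_ tw)[wz w0]]] := single_structure ws nvw.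
  exists z; split=> //; have : z \in nbr e2 w :&: B2 by rewrite zE inE.
  by rewrite inE => /andP[].
have cS := card_outside S.
have : 0 < #|S :\: nbr e3 v| by move: large cS; clear; lia.
case/card_gt0P => w wS; have [z [wz w0 nwB zB zd]] := str w wS.
have : 0 < #|(S :\: nbr e3 v) :\: nbr e2 z|.
  have := card_split (S :\: nbr e3 v) (nbr e2 z).
  have := subset_leq_card (subsetIr (S :\: nbr e3 v) (nbr e2 z)).
  by have := h2 z; move: large cS; clear; lia.
case/card_gt0P => w'; rewrite in_setD => /andP[nzw' w'S].
have [z' [w'z w'0 nw'B z'B z'd]] := str w' w'S.
exists w, w', z, z'; split=> //; apply: contraNneq nzw' => zz.
by rewrite inE s2 -in_nbr w'z zz inE.
Qed.

(** The set W need not be large enough to avoid both the neighbours of z0 and [K w0], whose size can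
    reach about Dv/20. Hence three choices: w1 avoids the neighbours of z0, and w2 avoids [K w0] and
    [K w1]. The large neighbour of w2 differs from z0 or from z1, and w2 is paired accordingly. *)
Lemma independent_singles :
  exists w w' z z', [/\ nbr e2 w :&: B2 = [set z], nbr e2 w' :&: B2 = [set z'],
    nbr e2 w :&: nbr e2 w' = set0 /\ ~~ e2 w w',
    #|nbr e2 w :\: B2| <= 1 /\ #|nbr e2 w' :\: B2| <= 1 &
    [/\ w \notin B2, w' \notin B2, nbr (flip e3) w :&: B1 = set0, nbr (flip e3) w' :&: B1 = set0 &
     18 * Dv <= 100 * #|nbr e2 z| /\ 18 * Dv <= 100 * #|nbr e2 z'|]].
Proof.
have [_ _ _ [s2 _] _ h2 _ _ _ _ _] := cr_bg cr.
pose W := singles :\: nbr e3 v.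
have str w : w \in W -> exists z, [/\ nbr e2 w :&: B2 = [set z], 18 * Dv <= 100 * #|nbr e2 z|,
    #|nbr e2 w :\: B2| <= 1, nbr (flip e3) w :&: B1 = set0 & w \notin B2].
  rewrite in_setD inE => /andP[nvw ws]; have [z [? ? ? ? _]] := single_structure ws nvw.
  by exists z; split=> //; move: ws; rewrite !inE => /andP[].
(* In the worst case #|B1| + 2 #|B2| is 210006 + 180003, which leaves 28266 of C. *)
have cW : Dl + 28 * 1000 <= #|W|.
  have := card_outside singles; have := card_singles; rewrite -/W.
  by move: (bl_B bl) (bl_B2 bl) (cr_C cr); clear; lia.
pose K w := \bigcup_(u in nbr e2 w :\: B2) (u |: nbr e2 u).
have cK w : w \in W -> 20 * #|K w| <= Dv + 20.
  move=> /str[z [_ _ le1 _ _]].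
  have [/eqP|] := posnP #|nbr e2 w :\: B2|.
    by rewrite cards_eq0 => /eqP e0; rewrite /K e0 big_set0 cards0 muln0.
  move=> gt0; have /cards1P[u uE] : #|nbr e2 w :\: B2| == 1 by rewrite eqn_leq le1 gt0.
  rewrite /K uE big_set1 cardsU1.
  have nuB : u \notin B2 by have : u \in nbr e2 w :\: B2 by [rewrite uE inE]; rewrite inE => /andP[].
  have := dm_small (bl_dm1 bl) nuB; have := leq_b1 (u \notin nbr e2 u); clear; lia.
have pair w w' z z' : w \in W -> w' \in W -> w' \notin K w ->
    nbr e2 w :&: B2 = [set z] -> nbr e2 w' :&: B2 = [set z'] -> z != z' ->
    nbr e2 w :&: nbr e2 w' = set0 /\ ~~ e2 w w'.
  move=> wW w'W nK wz w'z zz'.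
  have [_ [_ _ _ _ nw'B]] := str w' w'W.
  split; last first.
    apply: contraNN nK => ww'; apply/bigcupP; exists w'; last by rewrite !inE eqxx.
    by rewrite !inE nw'B ww'.
  apply/setP => u; rewrite [RHS]inE; apply/negP; rewrite in_setI => /andP[wu w'u].
  case: (boolP (u \in B2)) => uB.
    have : u \in nbr e2 w :&: B2 by rewrite inE wu uB.
    have : u \in nbr e2 w' :&: B2 by rewrite inE w'u uB.
    by rewrite wz w'z !inE => /eqP -> /eqP e; rewrite e eqxx in zz'.
  case/negP: nK; apply/bigcupP; exists u; first by rewrite in_setD uB wu.
  by rewrite in_setU in_set1 inE s2; move: w'u; rewrite inE => ->; rewrite orbT.
have : 0 < #|W| by move: cW; clear; lia.
case/card_gt0P => w0 w0W; have [z0 [wz0 d0 u0 e0 n0]] := str _ w0W.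
have : 0 < #|W :\: nbr e2 z0|.
  have := card_split W (nbr e2 z0); have := subset_leq_card (subsetIr W (nbr e2 z0)).
  by have := h2 z0; move: cW; clear; lia.
case/card_gt0P => w1; rewrite in_setD => /andP[nz0w1 w1W]; have [z1 [wz1 d1 u1 e1' n1]] := str _ w1W.
have zz : z0 != z1.
  apply: contraNneq nz0w1 => zz; have : z1 \in nbr e2 w1 :&: B2 by rewrite wz1 inE.
  by rewrite -zz !inE s2 => /andP[].
have : 0 < #|W :\: (K w0 :|: K w1)|.
  have := card_split W (K w0 :|: K w1); have := subset_leq_card (subsetIr W (K w0 :|: K w1)).
  have := (leq_card_setU (K w0) (K w1)).1; have := cK _ w0W; have := cK _ w1W.
  by have := h2 z0; move: cW d0; clear; lia.
case/card_gt0P => w2; rewrite in_setD in_setU negb_or => /andP[/andP[nK0 nK1] w2W].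
have [z2 [wz2 d2 u2 e2' n2]] := str _ w2W.
have [z02|z02] := eqVneq z0 z2.
  have z12 : z1 != z2 by rewrite -z02 eq_sym.
  by exists w1, w2, z1, z2; split=> //; exact: (pair w1 w2 z1 z2).
by exists w0, w2, z0, z2; split=> //; exact: (pair w0 w2 z0 z2).
Qed.

End Counts.

Section FourCycle.

Variables (C n : nat) (T1 T2 : finType) (e1 : rel T1) (e2 : rel T2) (e3 : T1 -> T2 -> bool).
Variables (Dl D3 : nat).
Hypothesis cr : critical C n e1 e2 e3 Dl D3.
Variables (v : T1) (t : T2) (B1 : {set T1}) (B2 : {set T2}).
Hypothesis bl : balanced n e1 e2 e3 v t B1 B2.

Notation Dv := (#|nbr e1 v| + #|nbr e3 v|).
Notation Dt := (#|nbr e2 t| + #|nbr (flip e3) t|).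

Variables (x x' z z' : T1) (w w' y y' : T2).
Hypotheses (Nx : nbr e1 x = [set z]) (Nx' : nbr e1 x' = [set z']) (zz' : z != z').
Hypotheses (x3 : nbr e3 x = set0) (x3' : nbr e3 x' = set0).
Hypotheses (xB : x \notin B1) (xB' : x' \notin B1) (zB : z \in B1) (zB' : z' \in B1).
Hypotheses (dz : 18 * Dt <= 100 * #|nbr e1 z|) (dz' : 18 * Dt <= 100 * #|nbr e1 z'|).
Hypotheses (Nw : nbr e2 w :&: B2 = [set y]) (Nw' : nbr e2 w' :&: B2 = [set y']).
Hypotheses (ww0 : nbr e2 w :&: nbr e2 w' = set0) (ww : ~~ e2 w w').
Hypotheses (uw : #|nbr e2 w :\: B2| <= 1) (uw' : #|nbr e2 w' :\: B2| <= 1).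
Hypotheses (wB : w \notin B2) (wB' : w' \notin B2).
Hypotheses (w3 : nbr (flip e3) w :&: B1 = set0) (w3' : nbr (flip e3) w' :&: B1 = set0).
Hypotheses (dy : 18 * Dv <= 100 * #|nbr e2 y|) (dy' : 18 * Dv <= 100 * #|nbr e2 y'|).

(* Placing x, x', z, z' on y, y', w', w creates no pair of G3, as every neighbourhood of x, x', w, w'
   is removed; only the hosts of the small neighbours of w and w' create some. *)
Lemma four_cycle : False.
Proof.
have [bg IH np hC hDl h3l h3r] := cr; have [_ _ g1 g2 h1 h2 h3 h4 _ _ b3] := bg.
have [s1 i1] := g1; have [s2 i2] := g2.
have ex u : e1 x u = (u == z) by move/setP: Nx => /(_ u); rewrite !inE.
have ex' u : e1 x' u = (u == z') by move/setP: Nx' => /(_ u); rewrite !inE.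
have nx3 u : e3 x u = false by move/setP: x3 => /(_ u); rewrite !inE.
have nx3' u : e3 x' u = false by move/setP: x3' => /(_ u); rewrite !inE.
have disj u : e2 w u -> e2 w' u = false.
  by move=> wu; move/setP: ww0 => /(_ u); rewrite !inE wu.
have disj' u : e2 w' u -> e2 w u = false.
  by move=> wu; move/setP: ww0 => /(_ u); rewrite !inE wu andbT.
have [wy yB] : e2 w y /\ y \in B2.
  by move/setP: Nw => /(_ y); rewrite !inE eqxx => /andP[].
have [wy' yB'] : e2 w' y' /\ y' \in B2.
  by move/setP: Nw' => /(_ y'); rewrite !inE eqxx => /andP[].
have wOnly u : e2 w u -> u \in B2 -> u = y.
  by move=> wu uB; move/setP: Nw => /(_ u); rewrite !inE wu uB => /esym/eqP.
have wOnly' u : e2 w' u -> u \in B2 -> u = y'.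
  by move=> wu uB; move/setP: Nw' => /(_ u); rewrite !inE wu uB => /esym/eqP.
have zw' : e3 z w' = false.
  by move/setP: w3' => /(_ z); rewrite !inE zB andbT.
have z'w : e3 z' w = false.
  by move/setP: w3 => /(_ z'); rewrite !inE zB' andbT.
have neqB (T : finType) (S : {set T}) a b : a \notin S -> b \in S -> a != b.
  by move=> aS bS; apply: contraNneq aS => ->.
have xx' : x != x'.
  by apply: contraNneq zz' => e; move: (ex' z); rewrite -e ex eqxx => /esym.
have yy' : y != y' by apply/eqP => e; move: (disj _ wy); rewrite e wy'.
have ww' : w != w' by apply/eqP => e; move: (disj _ wy); rewrite -e wy.
pose us := enum (nbr e2 w :\: B2) ++ enum (nbr e2 w' :\: B2).
have inus u : (u \in us) = (u \notin B2) && (e2 w u || e2 w' u).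
  by rewrite mem_cat !mem_enum !inE -andb_orr.
have uus : uniq us.
  rewrite cat_uniq !enum_uniq /= andbT; apply/hasPn => u; rewrite !mem_enum !inE => /andP[_ w'u].
  by rewrite (disj' _ w'u) andbF.
have sus : size us <= 2 by rewrite size_cat -!cardE; move: uw uw'; clear; lia.
(* The vertex placed next to u: z' goes on w and z on w', and the host of u must not be its
   neighbour. *)
pose zo u := if e2 w u then z' else z.
pose G u := [set h | [&& h != zo u, ~~ e1 (zo u) h, ~~ e3 h u & #|nbr e1 h| + #|nbr e3 h| <= 3]]
   :\: [set h in [:: x; x'; z; z']].
have GP u h : h \in G u -> [/\ h \notin [:: x; x'; z; z'], ~~ e1 (zo u) h, ~~ e3 h u & #|nbr e1 h| <= 3].
  rewrite in_setD inE => /andP[-> ]; rewrite inE => /and4P[_ -> -> le]; split=> //.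
  by apply: leq_trans le; apply: leq_addr.
have [|u uin|hs [hs2 hs1 hsG hsI]] := @choose_hosts T1 T2 e1 3 G us g1.
- by move=> u h _ /GP[].
- apply: (@leq_trans (4 * 2)); first by rewrite leq_mul2l sus orbT.
  rewrite /G; set M := [set h | _]; have : 100 <= #|M| := many_hosts cr (bl_dm1 bl) (bl_B2 bl) _ _.
  have : #|[set h in [:: x; x'; z; z']]| <= 4 by rewrite cardsE (leq_trans (card_size _)).
  set F := [set h in _]; have := card_split M F; have := subset_leq_card (subsetIr M F).
  by clear; lia.
have hsU p : p \in hs -> p.2 \in us by move=> pin; rewrite -hs2 map_f.
have szhs : size hs = size us by rewrite -hs2 size_map.
(* The placement is crossed: the edge xz is sent to the pair y, w', a non-edge because w and w' have
   no common neighbour. Putting z on w would hit the edge yw. *)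
pose ps := [:: (x, y), (x', y'), (z, w'), (z', w) & hs].
have inX u : (u \in Xof ps) = [|| u == x, u == x', u == z, u == z' | u \in unzip1 hs] by rewrite !inE.
have inY u : (u \in Yof ps) = [|| u == y, u == y', u == w', u == w | u \in us] by rewrite -hs2 !inE.
have hostsN h : h \in unzip1 hs -> h \notin [:: x; x'; z; z'].
  by case/mapP => p pin ->; have [] := GP _ _ (hsG _ pin).
have hostN p : p \in hs -> [/\ p.1 != x, p.1 != x', p.1 != z & p.1 != z'].
  move=> pin; have := hostsN p.1 (map_f fst pin); rewrite !inE !negb_or.
  by case/and4P.
have usN u : u \in us -> [/\ u != y, u != y', u != w' & u != w].
  rewrite inus => /andP[nuB /orP wu]; split.
  - exact: neqB nuB yB.
  - exact: neqB nuB yB'.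
  - by case: wu => wu; apply: contraTneq wu => ->; rewrite ?i2.
  by case: wu => wu; apply: contraTneq wu => ->; rewrite ?i2 // s2.
have yw' : e2 y w' = false by rewrite s2; exact: disj.
have y'w : e2 y' w = false by rewrite s2; exact: disj'.
have szps : size ps <= 6 by rewrite /= szhs; move: sus; clear; lia.
have pp : partial_packing e1 e2 e3 ps.
  split.
  - rewrite -[unzip1 ps]/[:: x, x', z, z' & unzip1 hs] /= hs1 andbT !inE !negb_or xx' zz' !(neqB _ B1) //=.
    by do ![apply/andP; split]; apply/negP => /hostsN; rewrite !inE eqxx ?orbT.
  - rewrite -[unzip2 ps]/[:: y, y', w', w & unzip2 hs] hs2 /= uus andbT !inE !negb_or yy' (eq_sym w') ww' /=.
    rewrite ![y == _]eq_sym ![y' == _]eq_sym !(neqB _ B2) //=.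
    by do ![apply/andP; split]; apply/negP => /usN[]; rewrite eqxx.
  - move=> p; rewrite !inE => /or4P[/eqP ->|/eqP ->|/eqP ->|/orP[/eqP ->|pin]] /=.
    + by rewrite nx3.
    + by rewrite nx3'.
    + by rewrite zw'.
    + by rewrite z'w.
    by have [] := GP _ _ (hsG _ pin).
  have zhost p : p \in hs -> e1 z p.1 -> ~~ e2 w' p.2.
    move=> pin zp; have [_ + _ _] := GP _ _ (hsG _ pin); rewrite /zo.
    case: ifP => [wu _|_]; last by rewrite zp.
    by rewrite disj.
  have zhost' p : p \in hs -> e1 z' p.1 -> ~~ e2 w p.2.
    move=> pin zp; have [_ + _ _] := GP _ _ (hsG _ pin); rewrite /zo.
    by case: ifP => [_|//]; rewrite zp.
  have xz' : x != z' by exact: neqB xB zB'.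
  have x'z : x' != z by exact: neqB xB' zB.
  have xz : x != z by exact: neqB xB zB.
  have x'z' : x' != z' by exact: neqB xB' zB'.
  move=> p q; rewrite !inE => /or4P[/eqP ->|/eqP ->|/eqP ->|/orP[/eqP ->|pin]]
    /or4P[/eqP ->|/eqP ->|/eqP ->|/orP[/eqP ->|qin]] /=;
   rewrite ?i1 ?ex ?ex' ?(s1 _ x) ?(s1 _ x') ?ex ?ex' ?(s2 w') ?yw' ?y'w //.
  all: rewrite ?(negPf xz') ?(negPf x'z) ?(negPf xz) ?(negPf x'z') ?(negPf zz') //.
  all: try by rewrite eq_sym (negPf zz').
  + by have [_ _ /negPf ->] := hostN _ qin.
  + by have [_ _ _ /negPf ->] := hostN _ qin.
  + by rewrite s2; exact: zhost.
  + by rewrite s2 y'w.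
  + exact: zhost'.
  + by have [_ _ /negPf ->] := hostN _ pin.
  + by have [_ _ _ /negPf ->] := hostN _ pin.
  + by rewrite s1 s2; exact: zhost.
  + by rewrite s1 s2; exact: zhost'.
  by rewrite (negPf (hsI _ _ pin qin)).
have wY u : e2 w u -> u \in Yof ps.
  move=> wu; rewrite inY inus wu /=; case: (boolP (u \in B2)) => uB; last by rewrite !orbT.
  by rewrite (wOnly _ wu uB) eqxx.
have wY' u : e2 w' u -> u \in Yof ps.
  move=> wu; rewrite inY inus wu orbT andbT; case: (boolP (u \in B2)) => uB; last by rewrite !orbT.
  by rewrite (wOnly' _ wu uB) eqxx orbT.
have o1x : outer1 e1 ps (x, y) = 0.
  apply/eqP; rewrite cards_eq0; apply/eqP/setP => u; rewrite in_setD inX [u \in nbr _ _]inE /= ex [in RHS]inE.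
  by case: (eqVneq u z); rewrite ?orbT ?andbF.
have o1x' : outer1 e1 ps (x', y') = 0.
  apply/eqP; rewrite cards_eq0; apply/eqP/setP => u; rewrite in_setD inX [u \in nbr _ _]inE /= ex' [in RHS]inE.
  by case: (eqVneq u z'); rewrite ?orbT ?andbF.
have o2w' : outer2 e2 ps (z, w') = 0.
  apply/eqP; rewrite cards_eq0; apply/eqP/setP => u; rewrite in_setD in_set0 [u \in nbr _ _]inE.
  by case: (boolP (e2 w' u)) => [/wY' ->|]; rewrite ?andbF.
have o2w : outer2 e2 ps (z', w) = 0.
  apply/eqP; rewrite cards_eq0; apply/eqP/setP => u; rewrite in_setD in_set0 [u \in nbr _ _]inE.
  by case: (boolP (e2 w u)) => [/wY ->|]; rewrite ?andbF.
have cX : #|Xof ps| <= 6 by rewrite cardsE (leq_trans (card_size _)) // size_map.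
have cY : #|Yof ps| <= 6 by rewrite cardsE (leq_trans (card_size _)) // size_map.
have o1z p : #|nbr e1 p.1| <= outer1 e1 ps p + 6.
  rewrite /outer1 -(card_split (nbr e1 p.1) (Xof ps)) addnC leq_add2l.
  by apply: leq_trans cX; rewrite subset_leq_card ?subsetIr.
have o2y p : #|nbr e2 p.2| <= outer2 e2 ps p + 6.
  rewrite /outer2 -(card_split (nbr e2 p.2) (Yof ps)) addnC leq_add2l.
  by apply: leq_trans cY; rewrite subset_leq_card ?subsetIr.
have o1h p : outer1 e1 ps p <= #|nbr e1 p.1| by exact/subset_leq_card/subsetDl.
have o2h p : outer2 e2 ps p <= #|nbr e2 p.2| by exact/subset_leq_card/subsetDl.
pose beta := Dv %/ 20.
have betaD : 20 * beta <= Dv by rewrite mulnC leq_divM.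
have ho2 p : p \in hs -> outer2 e2 ps p <= beta.
  move=> pin; apply: leq_trans (o2h p) _; have := hsU _ pin; rewrite inus => /andP[nuB _].
  have := dm_small (bl_dm1 bl) nuB; rewrite /beta leq_divRL // mulnDr mulnC.
  by apply: leq_trans; exact: leq_addr.
have ho1 p : p \in hs -> outer1 e1 ps p <= 3.
  by move=> pin; apply: leq_trans (o1h p) _; have [] := GP _ _ (hsG _ pin).
have sub_sum (I : eqType) (s : seq I) (P : pred I) (F : I -> nat) (k : nat) :
    (forall i, i \in s -> F i <= k) -> \sum_(i <- s | P i) F i <= k * size s.
  move=> Fk; apply: (@leq_trans (\sum_(i <- s) F i)).
    by rewrite [X in _ <= X](bigID P) leq_addr.
  rewrite mulnC -sum1_size big_distrl /= big_seq [X in _ <= X]big_seq.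
  by apply: leq_sum => i /Fk; rewrite mul1n.
have load1 u : u \notin Xof ps -> \sum_(p <- ps | e1 p.1 u) outer2 e2 ps p <= beta * 2.
  rewrite inX !negb_or => /and5P[_ _ nuz nuz' _].
  rewrite !big_cons /= ex ex' (negPf nuz) (negPf nuz') o2w o2w' !add0n !if_same.
  by apply: leq_trans (sub_sum _ _ _ _ _ ho2) _; rewrite leq_mul2l szhs sus orbT.
have load2 u : u \notin Yof ps -> \sum_(p <- ps | e2 p.2 u) outer1 e1 ps p <= 3 * 2.
  move=> nuY; rewrite !big_cons /= o1x o1x' !add0n !if_same.
  have -> : e2 w' u = false by apply: contraNF nuY; exact: wY'.
  have -> : e2 w u = false by apply: contraNF nuY; exact: wY.
  by apply: leq_trans (sub_sum _ _ _ _ _ ho1) _; rewrite leq_mul2l szhs sus orbT.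
have AD := max_degrees_bound' cr bl.
apply: (@reduction_slack _ _ _ _ _ _ _ _ _ cr ps (beta * 2 + 6)) => //.
- by apply: leq_trans szps _.
- by move=> u /load1 le; apply: leq_trans le (leq_addr _ _).
- by move=> u /load2 le; apply: leq_trans le (leq_addl _ _).
- move=> u /load1 le; have := h3 u; have := h2 y; move: AD betaD dy le szps; clear; lia.
- move=> u /load2 le; have := h3r u; move: le szps; clear; lia.
have hosts : 2 * \sum_(p <- hs) outer1 e1 ps p * outer2 e2 ps p <=
    \sum_(p <- hs) (#|nbr e2 p.2| + outer2 e2 ps p) + 4 * beta * 2.
  apply: (@leq_trans (\sum_(p <- hs) (#|nbr e2 p.2| + outer2 e2 ps p) + \sum_(p <- hs) 4 * beta)); last first.
    rewrite leq_add2l big_const_seq count_predT iter_addn_0 leq_mul2l szhs sus orbT //.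
  rewrite -big_split big_distrr /= big_seq [X in _ <= X]big_seq; apply: leq_sum => p pin.
  have := leq_mul (ho1 _ pin) (leqnn (outer2 e2 ps p)); have := ho2 _ pin; have := o2h p.
  by move: (_ * outer2 _ _ _) => k; clear; lia.
(* The four large vertices yield at least 0.72(Dv + Dt) - 24; hosts, slack and the 6 units per pair
   cost at most 0.6 Dv + 48. *)
have := o1z (z, w'); have := o1z (z', w); have := o2y (x, y); have := o2y (x', y').
have := bl_le1 bl; have := bl_le2 bl; have := bl_sum bl.
rewrite !big_cons o1x o1x' o2w o2w' !muln0 !mul0n !add0n /=.
move: hosts betaD dz dz' dy dy' szps.
move: (\sum_(p <- hs) outer1 _ _ _ * _) (\sum_(p <- hs) (#|nbr e2 _| + _)) => k1 k2.
move: (\sum_(p <- hs) _) (\sum_(p <- hs) _) => k3 k4; rewrite [size ps]/=; clear; lia.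
Qed.

End FourCycle.

Lemma pure_half C n (T1 T2 : finType) (e1 : rel T1) (e2 : rel T2) e3 Dl D3 v y B1 B2 :
  critical C n e1 e2 e3 Dl D3 -> balanced n e1 e2 e3 v y B1 B2 ->
  Dl + D3 < #|[set x in ~: B1 | weight e1 e3 B1 B2 x < 3]| -> False.
Proof.
move=> cr bl large.
have [x [x' [z [z' [xz x'z zz' [x3 x3'] [xB xB' zB zB' [dz dz']]]]]]] :=
  pure_pair (critical_flip cr) (balanced_flip bl) large.
have [w [w' [u [u' [wu wu' [ww0 ww] [uw uw'] [wB wB' w3 w3' [du du']]]]]]] := independent_singles cr bl.
exact: (four_cycle cr bl xz x'z zz' x3 x3' xB xB' zB zB' dz dz' wu wu' ww0 ww uw uw' wB wB' w3 w3' du du').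
Qed.

Lemma balanced_case C n (T1 T2 : finType) (e1 : rel T1) (e2 : rel T2) e3 Dl D3 v y B1 B2 :
  critical C n e1 e2 e3 Dl D3 -> balanced n e1 e2 e3 v y B1 B2 -> False.
Proof.
move=> cr bl; have [large|large] := pure_large cr bl; first exact: pure_half cr bl large.
exact: pure_half (critical_flip cr) (balanced_flip bl) large.
Qed.

(** * Case distinction and induction *)

Lemma dominated_case C n (T1 T2 : finType) (e1 : rel T1) (e2 : rel T2) e3 Dl D3 (v : T1) (y : T2) :
  critical C n e1 e2 e3 Dl D3 ->
  (forall x, #|nbr e1 x| + #|nbr e3 x| <= #|nbr e1 v| + #|nbr e3 v|) ->
  (forall x, #|nbr e2 x| + #|nbr (flip e3) x| <= #|nbr e2 y| + #|nbr (flip e3) y|) ->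
  #|nbr e2 y| + #|nbr (flip e3) y| <= #|nbr e1 v| + #|nbr e3 v| ->
  n < 250 * (#|nbr e1 v| + #|nbr e3 v|) -> False.
Proof.
move=> cr vmax ymax yv big.
have n_large : 139 * 1000 + 425 <= n by have := bg_sum (cr_bg cr); have := cr_C cr; clear; lia.
have vbig : n <= 1500 * (#|nbr e1 v| + #|nbr e3 v|) by move: big; clear; lia.
have [|B2 dm2 cB2] := dominant_exists cr vmax vbig (b := 30 * 1000); first by move: big; clear; lia.
have [lop|bal] := ltnP (6 * (#|nbr e2 y| + #|nbr (flip e3) y|)) (#|nbr e1 v| + #|nbr e3 v|).
  by apply: (unbalanced_case cr dm2 cB2) => u; have := ymax u; move: lop; clear; lia.
have ybig : n <= 1500 * (#|nbr e2 y| + #|nbr (flip e3) y|) by move: big bal; clear; lia.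
have [|B1 dm1 cB1] := dominant_exists (critical_flip cr) ymax ybig (b := 180 * 1000).
  by move: big bal; clear; lia.
apply: (@balanced_case _ _ _ _ _ _ _ _ _ v y B1 B2 cr); split=> //.
- by move: yv; clear; lia.
- by move: big n_large; clear; lia.
- by move: cB2; clear; lia.
- by move: cB1 cB2; clear; lia.
Qed.

Lemma critical_false C n (T1 T2 : finType) (e1 : rel T1) (e2 : rel T2) e3 Dl D3 :
  critical C n e1 e2 e3 Dl D3 -> False.
Proof.
move=> cr; have [bg IH np hC hDl h3l h3r] := cr; have [c1 c2 g1 g2 h1 h2 h3 h4 _ _ b3] := bg.
have n_large : 139 * 1000 + 425 <= n by move: b3 hC; clear; lia.
have /card_gt0P[v0 _] : 0 < #|T1| by rewrite c1; lia.
have /card_gt0P[y0 _] : 0 < #|T2| by rewrite c2; lia.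
case: (@arg_maxnP _ v0 xpredT (fun x => #|nbr e1 x| + #|nbr e3 x|) isT) => v _ vmax.
case: (@arg_maxnP _ y0 xpredT (fun x => #|nbr e2 x| + #|nbr (flip e3) x|) isT) => y _ ymax.
have {}vmax x : #|nbr e1 x| + #|nbr e3 x| <= #|nbr e1 v| + #|nbr e3 v| by exact: vmax.
have {}ymax x : #|nbr e2 x| + #|nbr (flip e3) x| <= #|nbr e2 y| + #|nbr (flip e3) y| by exact: ymax.
pose D := maxn (#|nbr e1 v| + #|nbr e3 v|) (#|nbr e2 y| + #|nbr (flip e3) y|).
have [small|big] := leqP (250 * D) n.
  apply: np; apply: (@sparse_packs _ _ e1 e2 e3 D) => //.
  - by rewrite c1 c2.
  - by rewrite c1; lia.
  - by rewrite c1.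
  - by move=> x; have := vmax x; rewrite /D; clear; lia.
  - by move=> x; have := ymax x; rewrite /D; clear; lia.
  - by move=> x; have := vmax x; rewrite /D; clear; lia.
  - by move=> x; have := ymax x; rewrite /D; clear; lia.
  by rewrite c1; move: b3; clear; lia.
have [le|/ltnW le] := leqP (#|nbr e2 y| + #|nbr (flip e3) y|) (#|nbr e1 v| + #|nbr e3 v|).
  by apply: (dominated_case cr vmax ymax le); move: big; rewrite /D (maxn_idPl le).
by apply: (dominated_case (critical_flip cr) ymax vmax le); move: big; rewrite /D (maxn_idPr le).
Qed.

Lemma packable_dec (T1 T2 : finType) (e1 : rel T1) (e2 : rel T2) (e3 : T1 -> T2 -> bool) :
  packable e1 e2 e3 \/ ~ packable e1 e2 e3.
Proof.
have [/existsP[f /and3P[/injectiveP fi /forallP f3 /forallP f12]]|none] := boolP [exists f : {ffun T1 -> T2},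
   [&& injectiveb f, [forall x, ~~ e3 x (f x)] & [forall x, forall x', e1 x x' ==> ~~ e2 (f x) (f x')]]].
  left; exists f; split=> //; split=> // u u'.
  by have /forallP/(_ u')/implyP := f12 u.
right=> -[f [fi [f3 f12]]]; case/negP: none; apply/existsP; exists (finfun f).
apply/and3P; split; first by apply/injectiveP => a b; rewrite !ffunE; exact: fi.
  by apply/forallP => x; rewrite ffunE.
by apply/forallP => x; apply/forallP => x'; rewrite !ffunE; apply/implyP; exact: f12.
Qed.

Lemma budget_packs C n (T1 T2 : finType) (e1 : rel T1) (e2 : rel T2) e3 Dl D3 :
  418 * 1000 + 275 <= C -> budget C n e1 e2 e3 Dl D3 -> packable e1 e2 e3.
Proof.
move=> hC; have [m] := ubnP n; elim: m n T1 T2 e1 e2 e3 Dl D3 => // m IHm n T1 T2 e1 e2 e3 Dl0 D30 ltn bg0.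
have IH : packs_below C n.
  move=> n' U1 U2 f1 f2 f3 El E3 lt'; apply: IHm; exact: leq_trans lt' _.
(* The bounds inherited from a larger triple are replaced by the true maxima. They are then
   attained, so a [Dl] close to n exhibits a vertex for [near_star_packs]. *)
pose Dl := maxn (\max_x #|nbr e1 x|) (\max_y #|nbr e2 y|).
pose D3 := maxn (\max_x #|nbr e3 x|) (\max_y #|nbr (flip e3) y|).
have bg : budget C n e1 e2 e3 Dl D3.
  have [c1 c2 g1 g2 h1 h2 h3 h4 b1 b2 b3] := bg0.
  have lDl : Dl <= Dl0 by rewrite geq_max; apply/andP; split; apply/bigmax_leqP.
  have lD3 : D3 <= D30 by rewrite geq_max; apply/andP; split; apply/bigmax_leqP.
  split=> //.
  - by move=> x; rewrite leq_max (leq_bigmax (F := fun x => #|nbr e1 x|)).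
  - by move=> x; rewrite leq_max (leq_bigmax (F := fun x => #|nbr e2 x|)) orbT.
  - by move=> x; rewrite leq_max (leq_bigmax (F := fun x => #|nbr e3 x|)).
  - by move=> x; rewrite leq_max (leq_bigmax (F := fun x => #|nbr (flip e3) x|)) orbT.
  - by move: lDl b1; clear; lia.
  - by move: lD3 b2; clear; lia.
  by move: lDl lD3 b3; clear; lia.
have [|np] := packable_dec e1 e2 e3; first by [].
have [c1 c2 g1 g2 h1 h2 h3 h4 b1 b2 b3] := bg.
have hC' : 418 * 1000 <= C by move: hC; clear; lia.
have np' : ~ packable e2 e1 (flip e3) by move=> pk; apply: np; apply: packable_flip pk; rewrite c1 c2.
case: (@critical_false C n T1 T2 e1 e2 e3 Dl D3); split=> //.
- have T0 : 0 < n by move: b1; clear; lia.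
  rewrite addn_maxl geq_max -!(rwP andP); split; rewrite leqNgt; apply/negP => lt.
    have : 0 < #|T1| by rewrite c1.
    case/(eq_bigmax (fun x => #|nbr e1 x|)) => x xE; apply: np; apply: (near_star_packs bg hC' (v := x)).
    by move: lt; rewrite xE; apply: ltnW.
  have : 0 < #|T2| by rewrite c2.
  case/(eq_bigmax (fun x => #|nbr e2 x|)) => x xE; apply: np'.
  apply: (near_star_packs (budget_flip bg) hC' (v := x)).
  by move: lt; rewrite xE; apply: ltnW.
- move=> x; rewrite leqNgt; apply/negP => lt; apply: np; apply: (heavy_list_packs bg IH (v := x)).
  by have := h3 x; move: b3 lt hC; clear; lia.
move=> x; rewrite leqNgt; apply/negP => lt; apply: np'.
apply: (heavy_list_packs (budget_flip bg) IH (v := x)); rewrite mass_flip.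
by have := h4 x; move: b3 lt hC; clear; lia.
Qed.

(** * From edge counts to degree sums *)

Lemma mass_nedges (n : nat) (e : rel 'I_n) : simple_graph e -> mass e = 2 * nedges e.
Proof.
move=> [s i]; pose S := [set p : 'I_n * 'I_n | (p.1 < p.2) && e p.1 p.2].
pose S' := [set p : 'I_n * 'I_n | (p.2 < p.1) && e p.1 p.2].
have -> : mass e = #|[set p : 'I_n * 'I_n | e p.1 p.2]|.
  rewrite -sum1dep_card -(pair_big_dep xpredT (fun x y => e x y) (fun _ _ => 1)) /=.
  by apply: eq_bigr => x _; rewrite sum1dep_card.
have -> : [set p : 'I_n * 'I_n | e p.1 p.2] = S :|: S'.
  apply/setP => -[x y]; rewrite !inE /=; case: (ltngtP x y) => //= xy; last first.
    by rewrite (val_inj xy) i.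
  by rewrite orbF.
rewrite cardsU (_ : S :&: S' = set0) ?cards0 ?subn0; last first.
  by apply/setP => -[x y]; rewrite !inE /=; case: (ltngtP x y) => _; rewrite ?andbF.
have sw : involutive (fun p : 'I_n * 'I_n => (p.2, p.1)) by case.
have -> : #|S'| = #|S|.
  rewrite -(card_imset (mem S) (inv_inj sw)); apply: eq_card => -[x y].
  apply/idP/imsetP => [xy|[[a b] ab [-> ->]]]; last by move: ab; rewrite !inE /= s.
  by exists (y, x) => //; move: xy; rewrite !inE /= s.
by rewrite mul2n -addnn.
Qed.

Lemma mass_nedges_bip (n : nat) (e3 : 'I_n -> 'I_n -> bool) : mass e3 = nedges_bip e3.
Proof.
rewrite /nedges_bip -sum1dep_card -(pair_big_dep xpredT (fun x y => e3 x y) (fun _ _ => 1)) /=.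
by apply: eq_bigr => x _; rewrite sum1dep_card.
Qed.

Theorem mainTheorem2 (n : nat) (e1 e2 : rel 'I_n) (e3 : 'I_n -> 'I_n -> bool) :
  2 <= n ->
  simple_graph e1 -> simple_graph e2 ->
  maxdeg e1 <= n - 2 -> maxdeg e2 <= n - 2 -> maxdeg_bip e3 <= n - 1 ->
  nedges e1 + nedges e2 + nedges_bip e3 + maxn (maxdeg e1) (maxdeg e2)
    + maxdeg_bip e3 + 11 * 195 ^ 2 <= 3 * n ->
  packs e1 e2 e3.
Proof.
move=> n2 g1 g2 d1 d2 d3 hsum.
have deg_le (e : rel 'I_n) x : #|nbr e x| <= maxdeg e by exact: (leq_bigmax (F := deg e)).
suff [f [fi [f3 f12]]] : packable e1 e2 e3 by exists f; split=> //; exact: injF_bij.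
(* 11 * 195^2 = 418275, exactly the constant 418 * 1000 + 275. *)
apply: (@budget_packs (11 * 195 ^ 2) n _ _ e1 e2 e3 (maxn (maxdeg e1) (maxdeg e2)) (maxdeg_bip e3)); first by lia.
split=> //; rewrite ?card_ord //.
- by move=> x; rewrite leq_max deg_le.
- by move=> x; rewrite leq_max deg_le orbT.
- by move=> x; rewrite leq_max (leq_bigmax (F := fun x => #|nbr e3 x|)).
- by move=> x; rewrite leq_max (leq_bigmax (F := fun x => #|nbr (flip e3) x|)) orbT.
- by move: d1 d2 n2; clear; lia.
- by move: d3 n2; clear; lia.
rewrite (mass_nedges g1) (mass_nedges g2) mass_nedges_bip; move: hsum.
move: (11 * _) (maxn _ _) => c k; clear; lia.
Qed.
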